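(* Let $p,q\in\mathbb N$, $n=p+q\ge1$, and $(G,K)=(\mathrm{Sp}(2n,\mathbb C),\mathrm{Sp}(2p,\mathbb C)\times\mathrm{Sp}(2q,\mathbb C))$. Suppose $\mathcal O=\mathcal O_\gamma$ is the $K$-orbit in $G/B$ indexed by the symmetric $(2p,2q)$-clan $\gamma$ (with $\mathrm{Neg}(\gamma)=\varnothing$). Let $k=|p-q|$ and $z=-\iota(\gamma)\in\mathcal I(W_n)$. Then $$d_{\mathcal O}(w)=0\ \text{ for all } w\in\mathcal A_{\mathrm{Brion}}(\mathcal O)\qquad\text{and}\qquad \mathcal A_{\mathrm{Brion}}(\mathcal O)=\bigsqcup_{M\in\mathsf{NCSP}^{\mathrm{CII}}_k(\gamma)}\mathcal A_k^{\mathsf{FPF}}(z,M).$$ Thus $\mathcal A_{\mathrm{Brion}}(\mathcal O)\subseteq\mathcal A_k^{\mathsf{FPF}}(z)$, and $\mathcal A_{\mathrm{Brion}}(\mathcal O)=\mathcal A_{\mathsf{FPF}}(z)$ if $|p-q|\le1$ and $\gamma$ is semi-alternating.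
   Context: **Signed permutations and atoms.** $[n]=\{1,\dots,n\}$, $[\pm n]=\{\pm1,\dots,\pm n\}$, $\bar m=-m$. $W_n$ is the group of bijections $w:[\pm n]\to[\pm n]$ with $w(-i)=-w(i)$, a Coxeter group with simple generators $t_0=(-1,1)$, $t_i=(-i,-i-1)(i,i+1)$ ($i\in[n-1]$) and length function $\ell$. For $w\in W_n$, $-w$ is the element $i\mapsto -w(i)$. The Demazure product $\circ$ is the unique associative product on $W_n$ with $s\circ s=s$ for simple $s$ and $u\circ v=uv$ if $\ell(uv)=\ell(u)+\ell(v)$. $\mathcal I(W_n)=\{w:w=w^{-1}\}$. For $y,z\in\mathcal I(W_n)$, $\mathcal A(y,z)$ is the (possibly empty) set of minimal-length $w\in W_n$ with $w^{-1}\circ y\circ w=z$; $\mathcal A(z)=\mathcal A(1,z)$; a superscript $-1$ on a set denotes the set of inverses. **Shapes.** Identify $w\in W_n$ with its one-line word $w_1\cdots w_n$. Starting from the word of $w\in\mathcal A(z)^{-1}$, repeatedly delete two consecutive letters $b\,a$ with $b>a$, until the remaining word $\xi(w)$ is increasing. For $w\in\mathcal A(z)^{-1}$, $\xi(w)$ and the set $\mathrm{NDes}(w)$ of deleted pairs $(b,a)$ do not depend on the choices. $\mathrm{NNeg}(w)$ is the set of absolute values of negative letters of $\xi(w)$. The shape $\mathrm{sh}(w)$ is the matching with blocks $\{a,b\},\{-a,-b\}$ for each $(a,-b)\in\mathrm{NDes}(w)$ with $0<a<b$, together with $\{e,-e\}$ for each $e\in\mathrm{NNeg}(w)$. A block $\{i,-i\}$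 is called trivial. A matching (set of disjoint 2-element subsets) in $X=-X\subset[\pm n]$ is perfect if it covers $X$, symmetric if $\{i,j\}\in M\Rightarrow\{-i,-j\}\in M$, and noncrossing if no blocks $\{i,k\},\{j,l\}$ have $i<j<k<l$. **Fixed-point-free relative atoms.** For $0\le k\le n$ with $n-k$ even, let $y^{\mathsf{FPF}}_{n,k}=(-1,1)(-2,2)\cdots(-k,k)\cdot t_{k+1}t_{k+3}\cdots t_{n-1}$ and $g^{\mathsf{FPF}}_{n,k}=g\cdot t_{k+1}t_{k+3}\cdots t_{n-1}$, where $g$ has one-line form $\bar k\cdots\bar2\,\bar1\,(k+1)\cdots n$. Put $\mathcal A_k^{\mathsf{FPF}}(z)=\mathcal A(y^{\mathsf{FPF}}_{n,k},z)$; if $w\in\mathcal A_k^{\mathsf{FPF}}(z)^{-1}$ then $w\cdot g^{\mathsf{FPF}}_{n,k}\in\mathcal A(z)^{-1}$ and $\mathrm{sh}^{\mathsf{FPF}}_k(w):=\mathrm{sh}(w\cdot g^{\mathsf{FPF}}_{n,k})$. Let $\mathcal A_k^{\mathsf{FPF}}(z,M)=\{w\in\mathcal A_k^{\mathsf{FPF}}(z):\mathrm{sh}_k^{\mathsf{FPF}}(w^{-1})=M\}$. Let $\mathcal A_{\mathsf{FPF}}(z)=\mathcal A^{\mathsf{FPF}}_0(z)$ if $n$ is even and $\mathcal A_{\mathsf{FPF}}(z)=\mathcal A^{\mathsf{FPF}}_1(z)$ if $n$ is odd. **Clans.** An $(a,b)$-clan is a sequence of $a+b$ symbols, each an integer or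 a sign $+$ or $-$, such that each integer that appears appears exactly twice and the number of $+$'s minus the number of $-$'s is $a-b$; two sequences are the same clan if they have the same signs in the same positions and the same pairs of positions with matching integers. $\mathrm{signs}(\gamma)$ is the subsequence of signs. A clan is symmetric if it equals its reversal as a clan. Write a symmetric $(2p,2q)$-clan as $\gamma=(c_{-n},\dots,c_{-1},c_1,\dots,c_n)$. $\iota(\gamma)\in\mathcal I(W_n)$ is the involution having $(i,j)$ as a 2-cycle, for distinct $i,j\in[\pm n]$, iff $c_i=c_j\in\mathbb Z$. $\mathrm{Neg}(\gamma)=\{i\in[n]:c_{-i}=c_i\in\mathbb Z\}$. $\gamma$ is semi-alternating if dividing $\mathrm{signs}(\gamma)$ in half gives two sequences with no adjacent repeated entries. $\mathsf{NCSP}_k^{\mathrm{CII}}(\gamma)$ is the set of noncrossing symmetric perfect matchings $M$ in $\{i\in[\pm n]:c_i\in\{+,-\}\}$ with exactly $k$ trivial blocks, such that $c_i$ and $c_j$ are opposite signs whenever $\{i,j\}\in M$ and $i+j\ne0$. **Orbits and Brion atoms.** Let $B\supset T$ be a Borel subgroup and torus of $G$, both preserved by the involution of $G$ with fixed-point subgroup $K$; the Weyl group is $W_n$. For a $K$-orbit $\mathcal O$ in $G/B$ and a simple generator $s$ with simple root $\alpha$ and projection $\pi_\alpha:G/B\to G/P_\alpha$ ($P_\alpha$ the minimal parabolic of type $\alpha$ containing $B$), $s\cdot\mathcal O$ is the unique dense $K$-orbit in $\pi_\alpha^{-1}(\pi_\alpha(\mathcal O))$. Form the directed graph on $K$-orbits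 with edges $\mathcal O\xrightarrow{s}s\cdot\mathcal O$ whenever $s\cdot\mathcal O\ne\mathcal O$; an edge is doubled if $\pi_\alpha$ restricted to $\overline{\mathcal O}$ has degree two. Let $\mathcal O_{\mathrm{dense}}$ be the dense orbit, which is the unique maximum of the resulting (weak) order. For a directed path $P=(\mathcal O\xrightarrow{s_1}\mathcal O'\xrightarrow{s_2}\cdots\xrightarrow{s_l}\mathcal O_{\mathrm{dense}})$ let $w(P)=s_l\cdots s_2s_1$ and let $d(P)$ be its number of doubled edges. $\mathcal A_{\mathrm{Brion}}(\mathcal O)$ is the set of all $w(P)$ for paths $P$ from $\mathcal O$ to $\mathcal O_{\mathrm{dense}}$, and $d_{\mathcal O}(w)=d(P)$ for any such $P$ with $w(P)=w$ (independent of $P$). The $K$-orbits are indexed as $\mathcal O_\gamma$ by symmetric $(2p,2q)$-clans $\gamma$ with $\mathrm{Neg}(\gamma)=\varnothing$ (standard parametrization of Matsuki–Oshima and Wyser), with $s\cdot\mathcal O_\gamma=\mathcal O_{s\cdot\gamma}$ where: (i) if $s=t_i$, $i\in[n-1]$, and $c_i,c_{i+1}$ are not both signs, or $s=t_0$ and $c_1$ is not a sign, then $s\cdot\gamma$ is the unique symmetric clan with $\iota(s\cdot\gamma)=s\circ\iota(\gamma)\circ s$ and $\mathrm{signs}(s\cdot\gamma)=\mathrm{signs}(\gamma)$; (ii) if $s=t_i$, $i\in[n-1]$, and $c_i,c_{i+1}$ are both signs, then $s\cdot\gamma=\gamma$ if $c_i=c_{i+1}$, and otherwise $s\cdot\gamma$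 is obtained by replacing $c_i,c_{i+1}$ by a pair of matching integers and $c_{-i-1},c_{-i}$ by another pair, both new; (iii) if $s=t_0$ and $c_1$ is a sign then $s\cdot\gamma=\gamma$; except that whenever rule (i) or (ii) would produce a clan with $\mathrm{Neg}(s\cdot\gamma)\ne\varnothing$, one sets $s\cdot\gamma=\gamma$ instead. In this case there are no doubled edges. *)

(* Defs.v *)
From mathcomp Require Import all_boot all_order all_fingroup all_algebra.
From mathcomp Require Import boolp classical_sets reals complex.
From mathcomp Require mpoly.

Set Implicit Arguments.
Unset Strict Implicit.
Unset Printing Implicit Defensive.

Local Open Scope classical_set_scope.

(* The set [±n] is modelled by 'I_(n + n): the ordinals 0, ..., n-1, n, ...,
   2n-1 stand for -n, ..., -1, 1, ..., n.  This identification preserves the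
   order, and m |-> -m becomes rev_ord.  Elements of [n] are indexed from 0:
   i : 'I_n stands for the integer i + 1. *)
Section SignedPermutations.
Variable n : nat.
Local Notation N := (n + n).

Definition pos (i : 'I_n) : 'I_N := rshift n i.
Definition neg (i : 'I_n) : 'I_N := rev_ord (pos i).
Definition is_pos (x : 'I_N) : bool := n <= x.
Definition is_neg (x : 'I_N) : bool := x < n.

Definition Wn : {set 'S_N} :=
  [set w : 'S_N | [forall x, w (rev_ord x) == rev_ord (w x)]]%SET.

(* Product of permutations as functions, (u \oW v)(x) = u (v x); in MathComp
   the product v * u of permutations applies v first. *)
Definition pcomp (u v : 'S_N) : 'S_N := (v * u)%g.

(* tgen i is t_i = (-i, -i-1)(i, i+1) for 1 <= i < n, and tgen 0 is (-1, 1). *)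
Definition tgen (i : 'I_n) : 'S_N :=
  if val i == 0 then tperm (neg i) (pos i)
  else (tperm (neg (ord_pred i)) (neg i) * tperm (pos (ord_pred i)) (pos i))%g.

Definition is_word_length (w : 'S_N) (l : nat) : bool :=
  [exists s : l.-tuple 'I_n, w == (\prod_(i <- s) tgen i)%g].

(* Coxeter length; the value 0 outside Wn is irrelevant. *)
Definition len (w : 'S_N) : nat :=
  if pselect (exists l, is_word_length w l) is left e then ex_minn e else 0.

Definition negp : 'S_N := perm (@rev_ord_inj N).
Definition opp_perm (w : 'S_N) : 'S_N := pcomp negp w.

Definition is_demazure (op : 'S_N -> 'S_N -> 'S_N) : Prop :=
  [/\ {in Wn &, forall u v, op u v \in Wn},
      {in Wn & &, associative op},
      forall i, op (tgen i) (tgen i) = tgen i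
    & {in Wn &, forall u v,
        len (pcomp u v) = len u + len v -> op u v = pcomp u v}].

(* The set A(y, z), relative to a Demazure product op. *)
Definition atoms (op : 'S_N -> 'S_N -> 'S_N) (y z : 'S_N) : set 'S_N :=
  let ok w := w \in Wn /\ op (op (w^-1)%g y) w = z in
  [set w | ok w /\ forall v, ok v -> len w <= len v].

Definition one_line (w : 'S_N) : seq 'I_N := [seq w (pos i) | i <- enum 'I_n].

(* Deletion of consecutive descents, always at the leftmost one: st is the
   increasing prefix already scanned, read backwards.  The result consists of
   the list of deleted pairs (b, a) and of the remaining increasing word. *)
Fixpoint delete_descents (st s : seq 'I_N) : seq ('I_N * 'I_N) * seq 'I_N :=
  match s with
  | [::] => ([::], rev st)
  | a :: s' =>
      if st is b :: st' then
        if a < b then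
          let r := delete_descents st' s' in ((b, a) :: r.1, r.2)
        else delete_descents (a :: st) s'
      else delete_descents [:: a] s'
  end.

Definition NDes (w : 'S_N) := (delete_descents [::] (one_line w)).1.
Definition xi (w : 'S_N) := (delete_descents [::] (one_line w)).2.

(* A pair (a, -b) of NDes(w) with 0 < a < b is a deleted pair d with
   a = d.1 and b = rev_ord d.2. *)
Definition sh_pair (d : 'I_N * 'I_N) : bool :=
  [&& is_pos d.1, is_neg d.2 & d.1 < rev_ord d.2].

Definition sh (w : 'S_N) : {set {set 'I_N}} :=
  ([set [set d.1; rev_ord d.2] | d in [pred d in NDes w | sh_pair d]]
   :|: [set [set rev_ord d.1; d.2] | d in [pred d in NDes w | sh_pair d]]
   :|: [set [set e; rev_ord e] | e in [pred e in xi w | is_neg e]])%SET.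

Definition perfect_matching (X : {set 'I_N}) (M : {set {set 'I_N}}) : bool :=
  finset.partition M X && [forall B in M, #|B| == 2].

Definition symmetric_matching (M : {set {set 'I_N}}) : bool :=
  [forall B in M, ([set rev_ord x | x in B]%SET) \in M].

Definition noncrossing (M : {set {set 'I_N}}) : Prop :=
  forall i j k l : 'I_N, ([set i; k]%SET) \in M -> ([set j; l]%SET) \in M ->
    ~ (i < j /\ j < k /\ k < l).

Definition trivial_blocks (M : {set {set 'I_N}}) : {set {set 'I_N}} :=
  [set B in M | [exists i, B == [set i; rev_ord i]]]%SET.

(* The factors of each product below have disjoint supports, so the order of
   multiplication does not matter. *)
Definition t_alt (k : nat) : 'S_N :=
  (\prod_(i < n | (k < i) && odd (i - k)) tgen i)%g.

Definition yFPF (k : nat) : 'S_N :=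
  pcomp (\prod_(i < n | i < k) tperm (neg i) (pos i))%g (t_alt k).

(* In one-line form, -k ... -2 -1 (k+1) ... n. *)
Definition g_one (k : nat) : 'S_N :=
  (\prod_(i < n) \prod_(j < n | (i + j).+1 == k) tperm (pos i) (neg j))%g.

Definition gFPF (k : nat) : 'S_N := pcomp (g_one k) (t_alt k).

Definition shFPF (k : nat) (w : 'S_N) : {set {set 'I_N}} :=
  sh (pcomp w (gFPF k)).

Definition atoms_k (op : 'S_N -> 'S_N -> 'S_N) (k : nat) (z : 'S_N) :
  set 'S_N := atoms op (yFPF k) z.

Definition atoms_kM (op : 'S_N -> 'S_N -> 'S_N) (k : nat) (z : 'S_N)
    (M : {set {set 'I_N}}) : set 'S_N :=
  [set w | atoms_k op k z w /\ shFPF k (w^-1)%g = M].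

Definition atoms_FPF (op : 'S_N -> 'S_N -> 'S_N) (z : 'S_N) : set 'S_N :=
  if odd n then atoms_k op 1 z else atoms_k op 0 z.

End SignedPermutations.

(* inl true is +, inl false is -, and inr m is the integer m. *)
Definition symbol := (bool + int)%type.
Definition is_int (x : symbol) : bool := if x is inr _ then true else false.
Definition is_sign (x : symbol) : bool := ~~ is_int x.

Definition matched N (c : {ffun 'I_N -> symbol}) (i j : 'I_N) : bool :=
  [&& i != j, is_int (c i) & c i == c j].

Definition is_clan (a b N : nat) (c : {ffun 'I_N -> symbol}) : Prop :=
  [/\ N = a + b,
      forall i, is_int (c i) -> #|[set j | c j == c i]%SET| = 2
    & #|[set j | c j == inl true]%SET| + b
      = #|[set j | c j == inl false]%SET| + a].

(* Equality of clans: the integer labels themselves are irrelevant. *)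
Definition same_clan N (c c' : {ffun 'I_N -> symbol}) : Prop :=
  (forall i s, c i = inl s <-> c' i = inl s) /\
  (forall i j, matched c i j = matched c' i j).

Definition symmetric_clan N (c : {ffun 'I_N -> symbol}) : Prop :=
  same_clan c [ffun i => c (rev_ord i)].

Definition signs N (c : {ffun 'I_N -> symbol}) : seq bool :=
  pmap (fun i => if c i is inl s then Some s else None) (enum 'I_N).

Definition alternating (s : seq bool) : bool := sorted (fun a b => a != b) s.

Definition semi_alternating N (c : {ffun 'I_N -> symbol}) : bool :=
  alternating (take (size (signs c))./2 (signs c)) &&
  alternating (drop (size (signs c))./2 (signs c)).

Section SymmetricClans.
Variable n : nat.
Local Notation N := (n + n).

Definition iota_clan (c : {ffun 'I_N -> symbol}) : 'S_N :=
  odflt 1%g [pick w : 'S_N | (w == w^-1)%g &&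
    [forall i, forall j, (i != j) ==> ((w i == j) == matched c i j)]].

Definition Neg (c : {ffun 'I_N -> symbol}) : {set 'I_n} :=
  [set i | is_int (c (pos i)) && (c (neg i) == c (pos i))]%SET.

Definition NCSP (k : nat) (c : {ffun 'I_N -> symbol}) :
  set {set {set 'I_N}} :=
  [set M | [/\ perfect_matching [set i | is_sign (c i)]%SET M,
               symmetric_matching M, noncrossing M,
               #|trivial_blocks M| = k
             & forall i j, ([set i; j]%SET) \in M -> j != rev_ord i ->
                 exists s, c i = inl s /\ c j = inl (~~ s)]].

Section Action.
Variables (p q : nat) (op : 'S_N -> 'S_N -> 'S_N).

(* The clans indexing K-orbits. *)
Definition orbit_clan (c : {ffun 'I_N -> symbol}) : Prop :=
  [/\ is_clan p.*2 q.*2 c, symmetric_clan c & Neg c = finset.set0].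

Definition rule_i (i : 'I_n) (c c' : {ffun 'I_N -> symbol}) : Prop :=
  [/\ is_clan p.*2 q.*2 c', symmetric_clan c',
      iota_clan c' = op (op (tgen i) (iota_clan c)) (tgen i)
    & signs c' = signs c].

Definition rule_ii (i : 'I_n) (c c' : {ffun 'I_N -> symbol}) : Prop :=
  let j := ord_pred i in
  exists m m' : int,
    [/\ m != m', forall x, c x != inr m, forall x, c x != inr m'
      & c' = [ffun x => if x \in [:: pos j; pos i] then inr m
                        else if x \in [:: neg j; neg i] then inr m'
                        else c x]].

Definition clan_rule (i : 'I_n) (c c' : {ffun 'I_N -> symbol}) : Prop :=
  let j := ord_pred i in
  if val i == 0 then
    if is_sign (c (pos i)) then c' = c else rule_i i c c'
  else if is_sign (c (pos j)) && is_sign (c (pos i)) then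
    if c (pos j) == c (pos i) then c' = c else rule_ii i c c'
  else rule_i i c c'.

(* c' represents the clan t_i . c; clans are determined up to same_clan. *)
Definition clan_act (i : 'I_n) (c c' : {ffun 'I_N -> symbol}) : Prop :=
  exists2 c1, clan_rule i c c1 &
    c' = if Neg c1 == finset.set0 then c1 else c.

End Action.
End SymmetricClans.

Local Open Scope ring_scope.

Section Geometry.
Variables (F : fieldType) (n : nat).
Local Notation N := (n + n)%N.
Local Notation mat := 'M[F]_N.

(* The coordinates of F^N are indexed by [±n], with e_i and e_j orthogonal
   for the symplectic form unless j = -i. *)
Definition Jform : mat :=
  \matrix_(i, j) (if j == rev_ord i then (if is_neg i then 1 else -1) else 0).

Definition Sp : set mat := [set g | g^T *m Jform *m g = Jform].

(* V_+ is spanned by the e_i with |i| <= p, and V_- by the other e_i. *)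
Definition in_Vplus (p : nat) (i : 'I_N) : bool := (n - p <= i < n + p)%N.

Definition Pplus (p : nat) : mat := \matrix_(i, j) ((i == j) && in_Vplus p i)%:R.
Definition Pminus (p : nat) : mat := 1%:M - Pplus p.

(* Fixed points in Sp of conjugation by the involution Pplus p - Pminus p, that
   is, the stabilizer of V_+ and V_-, isomorphic to Sp(2p) x Sp(2n-2p).  The
   involution is diagonal, so it preserves Borel and the diagonal torus. *)
Definition Kgrp (p : nat) : set mat :=
  [set g | Sp g /\ g *m (Pplus p - Pminus p) = (Pplus p - Pminus p) *m g].

Definition Borel : set mat :=
  [set g | Sp g /\ forall i j : 'I_N, (j < i)%N -> g i j = 0].

(* Representatives of w in the normalizer of the diagonal torus. *)
Definition weyl_rep (w : 'S_N) : set mat :=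
  [set g | Sp g /\ forall i j, g i j != 0 -> i = w j].

(* The minimal parabolic B u BsB for s = tgen i. *)
Definition parabolic (i : 'I_n) : set mat :=
  Borel `|` [set g | exists b1 s b2,
    [/\ Borel b1, weyl_rep (tgen i) s, Borel b2 & g = b1 *m s *m b2]].

Definition zariski_closed (S : set mat) : Prop :=
  exists I : set (mpoly.mpoly (N * N) F),
    S = [set g | forall f, I f -> mpoly.meval (fun k => mxvec g 0 k) f = 0].

(* Homogeneous spaces Sp/P, with points the cosets gP and the quotient of the
   Zariski topology. *)
Definition lcos (P : set mat) (g : mat) : set mat := [set g *m h | h in P].
Definition quot (P : set mat) : set (set mat) := [set lcos P g | g in Sp].

Definition qclosed (P : set mat) (Z : set (set mat)) : Prop :=
  Z `<=` quot P /\
  exists2 S, zariski_closed S & [set g | Sp g /\ Z (lcos P g)] = Sp `&` S.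

Definition qopen (P : set mat) (U : set (set mat)) : Prop :=
  U `<=` quot P /\ qclosed P (quot P `\` U).

Definition qclosure (P : set mat) (X : set (set mat)) : set (set mat) :=
  [set x | quot P x /\ forall Z, qclosed P Z -> X `<=` Z -> Z x].

(* The projection Sp/B -> Sp/P_i. *)
Definition proj (i : 'I_n) (x : set mat) : set mat :=
  [set g *m h | g in x & h in parabolic i].

Definition is_orbit (p : nat) (O : set (set mat)) : Prop :=
  exists2 x, quot Borel x & O = [set [set k *m h | h in x] | k in Kgrp p].

Definition proj_saturation (i : 'I_n) (O : set (set mat)) : set (set mat) :=
  [set x | quot Borel x /\ exists2 y, O y & proj i x = proj i y].

Definition dense_in (O X : set (set mat)) : Prop :=
  O `<=` X /\ X `<=` qclosure Borel O.

Definition dense_orbit (p : nat) (O : set (set mat)) : Prop :=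
  is_orbit p O /\ dense_in O (quot Borel).

(* O' = t_i . O, the unique dense orbit in the saturation of O. *)
Definition is_dot (p : nat) (i : 'I_n) (O O' : set (set mat)) : Prop :=
  [/\ is_orbit p O', dense_in O' (proj_saturation i O)
    & forall O'', is_orbit p O'' -> dense_in O'' (proj_saturation i O) ->
        O'' = O'].

Definition edge (p : nat) (i : 'I_n) (O O' : set (set mat)) : Prop :=
  is_dot p i O O' /\ O' <> O.

(* The projection restricted to the closure of O has degree two: a nonempty
   open part of its image consists of points with exactly two preimages.  The
   closure of an orbit of K is irreducible, and in characteristic 0 the degree
   is the number of points of a general fibre. *)
Definition doubled (i : 'I_n) (O : set (set mat)) : Prop :=
  let cl := qclosure Borel O in
  exists U, [/\ qopen (parabolic i) U, (U `&` (proj i @` cl) !=set0)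
    & forall y, (U `&` (proj i @` cl)) y ->
        exists x1 x2, x1 <> x2 /\ cl `&` [set x | proj i x = y] = [set x1; x2]].

(* A path from O is given by its successive labels and targets. *)
Definition orbit_path := seq ('I_n * set (set mat)).

Fixpoint is_path (p : nat) (O : set (set mat)) (P : orbit_path) : Prop :=
  if P is (i, O') :: P' then edge p i O O' /\ is_path p O' P' else True.

Definition path_end (O : set (set mat)) (P : orbit_path) : set (set mat) :=
  last O (map snd P).

(* w(P) = s_l ... s_2 s_1 *)
Definition path_word (P : orbit_path) : 'S_N :=
  foldl (fun u e => pcomp (tgen e.1) u) 1%g P.

Fixpoint path_doubled (O : set (set mat)) (P : orbit_path) : nat :=
  if P is (i, O') :: P' then (`[< doubled i O >] + path_doubled O' P')%N else 0%N.

Definition brion_path (p : nat) (Od O : set (set mat)) (w : 'S_N) : set orbit_path :=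
  [set P | [/\ is_path p O P, path_end O P = Od & path_word P = w]].

(* Od is the dense orbit. *)
Definition brion (p : nat) (Od O : set (set mat)) : set 'S_N :=
  [set w | brion_path p Od O w !=set0].

(* d_O(w) = m *)
Definition brion_d (p : nat) (Od O : set (set mat)) (w : 'S_N) (m : nat) : Prop :=
  brion_path p Od O w !=set0 /\
  forall P, brion_path p Od O w P -> path_doubled O P = m.

(* The rows of flag_mx g j span the space F_j generated by the first j columns
   of g; the flag (F_j) depends only on the coset gB. *)
Definition flag_mx (g : mat) (j : nat) : mat := pid_mx j *m g^T.

Definition pairs_within (c : {ffun 'I_N -> symbol}) (j : nat) : nat :=
  #|[set st : 'I_N * 'I_N |
      [&& matched c st.1 st.2, (st.1 < st.2)%N & (st.2 < j)%N]]%SET|.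

Definition pairs_across (c : {ffun 'I_N -> symbol}) (i j : nat) : nat :=
  #|[set st : 'I_N * 'I_N |
      [&& matched c st.1 st.2, (st.1 < i)%N & (j <= st.2)%N]]%SET|.

Definition signs_within (c : {ffun 'I_N -> symbol}) (s : bool) (j : nat) : nat :=
  #|[set x : 'I_N | (c x == inl s) && (x < j)%N]%SET|.

(* The orbit of a clan, by the rank conditions of Yamamoto and Wyser on
   dim (F_j :&: V_+), dim (F_j :&: V_-) and dim (pi_+ F_i + F_j). *)
Definition clan_orbit (p : nat) (c : {ffun 'I_N -> symbol}) : set (set mat) :=
  [set x | exists g, [/\ Sp g, x = lcos Borel g,
    forall j, (j <= N)%N ->
      \rank (flag_mx g j :&: Pplus p)%MS
        = (signs_within c true j + pairs_within c j)%N,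
    forall j, (j <= N)%N ->
      \rank (flag_mx g j :&: Pminus p)%MS
        = (signs_within c false j + pairs_within c j)%N
    & forall i j, (i < j)%N -> (j <= N)%N ->
      \rank (flag_mx g i *m Pplus p + flag_mx g j)%MS
        = (j + pairs_across c i j)%N]].

(* The Matsuki-Oshima-Wyser theorem: clans up to equality index the orbits. *)
Definition clans_index_orbits (p q : nat) : Prop :=
  [/\ forall c, orbit_clan p q c -> is_orbit p (clan_orbit p c),
      forall c c', orbit_clan p q c -> orbit_clan p q c' ->
        clan_orbit p c = clan_orbit p c' -> same_clan c c'
    & forall O, is_orbit p O ->
        exists2 c, orbit_clan p q c & O = clan_orbit p c].

(* t_i . O_c = O_(t_i . c) *)
Definition clan_act_orbits (p q : nat) (op : 'S_N -> 'S_N -> 'S_N) : Prop :=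
  forall c i c', orbit_clan p q c -> clan_act p q op i c c' ->
    is_dot p i (clan_orbit p c) (clan_orbit p c').

End Geometry.

(* Main.v *)
(** Put z = - iota(gamma).  An edge gamma -> t_i . gamma turns z into z' with
    z = t_i o z' o t_i and z <> z', so the word of a path to the dense orbit is a
    reduced word of a relative atom w of z.  Conversely, a reduced word of a
    relative atom gives a chain of involutions from z to y_FPF.  A step of this
    chain either conjugates by t_i, which moves the signs of the clan and keeps
    their order, or commutes with t_i, which matches two adjacent signs; the
    latter is possible for clans exactly if the signs are opposite.  Followed back
    to gamma, the matched pairs are the pairs of letters (v(m), v(m+1)) of
    v = w^-1, with m - k odd, that v * g_FPF exchanges and whose letters have
    opposite signs and v(m+1) < - v(m); deleting descents in v * g_FPF finds the
    same pairs, so they are the nontrivial blocks of the shape.  Hence w comes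
    from a path iff its shape matches only opposite signs.  Up to relabelling
    there is only one clan without outgoing edges, that of the dense orbit.  In a
    semi-alternating clan a block of a noncrossing matching encloses an even
    number of signs and therefore always joins opposite signs.

    No edge is doubled.  In a fibre of the projection, a projective line, each
    rank condition defining the orbits is linear in the moving vector of the flag,
    so it jumps everywhere, nowhere, or at a single point.  (The only quadratic
    condition is determined by the others, as no clan matches a position to its
    negative.)  If the closure of an orbit O contains two points of a fibre through
    a point of O, then no condition jumps at the latter point only, and all but
    finitely many points of the fibre are in O. *)

Require Import Defs.
From HB Require Import structures.
From mathcomp Require Import all_boot all_order all_fingroup all_algebra.
From mathcomp Require Import zify.

Set Implicit Arguments.
Unset Strict Implicit.
Unset Printing Implicit Defensive.

(** * Length and descents of signed permutations *)

(** The link between strict chains and minimal length is numerical: [height] grows by exactly 8 at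
    every step that changes a fixed-point-free involution, so the number of steps depends only on
    the two ends. The shape, defined by deleting descents in the word of a whole atom, is not
    visible one letter at a time; hence [chain_inv], a description of the word of v = w^-1 that
    survives both kinds of step and is explicit enough for the deletion to be carried out in closed
    form. What keeps it alive is that z reverses the order of the points it negates: an ascent of z
    never has both places among them, so t_i respects their order, and these points are the sign
    positions of the clan. On the geometric side, closures enter only through lower semicontinuity
    of ranks; neither the closure order nor dimensions of orbits occur. Ranks of intersections are
    first traded for ranks of projections, which are linear in the flag. *)

Section Generators.
Variable n : nat.
Local Notation N := (n + n).
Implicit Types (i : 'I_n) (x y : 'I_N) (w u v : 'S_N).

(* The adjacent places n + i - 1 and n + i exchanged by tgen i, which are -1 and
   1 for i = 0; tgen i also exchanges their negatives. *)
Definition hi i : 'I_N := pos i.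
Definition lo i : 'I_N := if val i == 0 then neg i else pos (ord_pred i).

Arguments hi : simpl never.
Arguments lo : simpl never.

Lemma val_rev x : rev_ord x = n + n - x.+1 :> nat. Proof. by []. Qed.

Lemma rev_neq x : rev_ord x != x.
Proof.
apply/eqP => /(congr1 (@nat_of_ord _)); rewrite val_rev.
by have := ltn_ord x; lia.
Qed.

Lemma val_pos i : pos i = n + i :> nat. Proof. by []. Qed.

Lemma val_hi i : hi i = n + i :> nat. Proof. by []. Qed.

Lemma val_lo i : lo i = n + i - 1 :> nat.
Proof.
rewrite /lo; case: i => [[|i] Hi] /=; first by lia.
suff -> : (i + n) %% n = i by lia.
by rewrite modnDr modn_small //; lia.
Qed.

Lemma tgenE i x : tgen i x =
  if x == hi i then lo i else if x == lo i then hi i else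
  if x == rev_ord (hi i) then rev_ord (lo i) else
  if x == rev_ord (lo i) then rev_ord (hi i) else x.
Proof.
have Hl := val_lo i; have Hh := val_hi i; have Hi := ltn_ord i.
rewrite /tgen; move: Hl; rewrite /lo; case: ifP => Hi0 Hl.
  have Hlo : neg i = rev_ord (hi i) by [].
  rewrite -/(hi i) Hlo rev_ordK.
  case: tpermP => [->|->|/eqP/negPf H1 /eqP/negPf H2].
  - rewrite eqxx; case: eqP => // E; move: (congr1 val E) => /=; lia.
  - by rewrite eqxx.
  - by rewrite H1 H2.
rewrite permM -/(hi i) /neg -/(hi i).
have D1 : rev_ord (hi i) != hi i by apply/eqP => /(congr1 val) /=; lia.
have D2 : rev_ord (pos (ord_pred i)) != hi i.
  by apply/eqP => /(congr1 val) /=; move: Hl => /=; lia.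
have D3 : rev_ord (hi i) != pos (ord_pred i).
  by apply/eqP => /(congr1 val) /=; move: Hl => /=; lia.
have D4 : rev_ord (pos (ord_pred i)) != pos (ord_pred i).
  by apply/eqP => /(congr1 val) /=; move: Hl => /=; lia.
have D5 : pos (ord_pred i) != hi i.
  by apply/eqP => /(congr1 val) /=; move: Hl => /=; lia.
move: D1 D2 D3 D4 D5; set a := pos _; set b := hi i => D1 D2 D3 D4 D5.
have D6 : rev_ord a != rev_ord b.
  by apply: contra D5 => /eqP/rev_ord_inj ->.
have [->|x1] := eqVneq x b.
  by rewrite (tpermD D2 D1) tpermR.
have [->|x2] := eqVneq x a.
  by rewrite (tpermD D4 D3) tpermL.
have [->|x3] := eqVneq x (rev_ord b).
  by rewrite tpermR tpermD // eq_sym.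
have [->|x4] := eqVneq x (rev_ord a).
  by rewrite tpermL tpermD // eq_sym.
by rewrite !tpermD // eq_sym.
Qed.

Lemma tgen_hi i : tgen i (hi i) = lo i. Proof. by rewrite tgenE eqxx. Qed.

Lemma lo_neq_hi i : lo i != hi i.
Proof.
by apply/eqP => /(congr1 (@nat_of_ord _)); rewrite val_lo val_hi; have := ltn_ord i; lia.
Qed.

Lemma tgen_lo i : tgen i (lo i) = hi i.
Proof. by rewrite tgenE (negPf (lo_neq_hi i)) eqxx. Qed.

Lemma inWnP w : reflect (forall x, w (rev_ord x) = rev_ord (w x)) (w \in Wn n).
Proof.
rewrite inE; apply: (iffP forallP) => H x; first exact/eqP.
by rewrite H.
Qed.

Lemma tgen_val i x : tgen i x =
  (if x == n + i :> nat then n + i - 1 else if x == n + i - 1 :> nat then n + i else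
  if x == n - i.+1 :> nat then n - i else if x == n - i :> nat then n - i.+1 else x)
  :> nat.
Proof.
have Hl := val_lo i; have Hi := ltn_ord i.
have Hrl : rev_ord (lo i) = n - i :> nat by rewrite val_rev Hl; lia.
have Hrh : rev_ord (hi i) = n - i.+1 :> nat by rewrite val_rev val_hi; lia.
rewrite tgenE -!(inj_eq (@ord_inj _)) Hrl Hrh Hl val_hi.
by do 4 (case: ifP => _ //).
Qed.

Lemma tgen_Wn i : tgen i \in Wn n.
Proof.
apply/inWnP => x; apply: ord_inj.
rewrite tgen_val !val_rev tgen_val.
have := ltn_ord i; have := ltn_ord x.
by do 8?case: eqP; lia.
Qed.

Lemma tgen_rev i x : tgen i (rev_ord x) = rev_ord (tgen i x).
Proof. exact/inWnP/tgen_Wn. Qed.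

Lemma tgenK i : involutive (tgen i).
Proof.
move=> x; apply: ord_inj; rewrite !tgen_val.
have := ltn_ord i; have := ltn_ord x.
by do 8?case: eqP; lia.
Qed.

Lemma tgen2 i : (tgen i * tgen i)%g = 1%g.
Proof. by apply/permP => x; rewrite permM perm1 tgenK. Qed.

Lemma tgenV i : ((tgen i)^-1)%g = tgen i.
Proof. by rewrite -[RHS](mulKg (tgen i)) tgen2 mulg1. Qed.

(** [tgen i] only exchanges neighbours, so the sole pairs it reverses are the pair it moves and the
    negative of that pair; for i = 0 the two coincide. The order arguments below come down to this
    case distinction. *)
Lemma tgen_lt i x y : x < y -> ~~ (tgen i x < tgen i y) ->
  x = lo i /\ y = hi i \/ x = rev_ord (hi i) /\ y = rev_ord (lo i).
Proof.
have Hl := val_lo i; have Hi := ltn_ord i.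
have Hrl : rev_ord (lo i) = n - i :> nat by rewrite val_rev Hl; lia.
have Hrh : rev_ord (hi i) = n - i.+1 :> nat by rewrite val_rev val_hi; lia.
have Hx := ltn_ord x; have Hy := ltn_ord y.
move=> xy; rewrite !tgen_val => H.
have [[E1 E2]|[E1 E2]] : (x = n + i - 1 :> nat /\ y = n + i :> nat) \/
     (x = n - i.+1 :> nat /\ y = n - i :> nat).
- by move: H xy; do 8?case: eqP; lia.
- by left; split; apply: ord_inj; rewrite ?Hl.
- by right; split; apply: ord_inj; rewrite ?Hrl ?Hrh.
Qed.

Lemma Wn_mul u v : u \in Wn n -> v \in Wn n -> (u * v)%g \in Wn n.
Proof. by move=> /inWnP Hu /inWnP Hv; apply/inWnP => x; rewrite !permM Hu Hv. Qed.

Lemma Wn1 : 1%g \in Wn n. Proof. by apply/inWnP => x; rewrite !perm1. Qed.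

Lemma Wn_inv u : u \in Wn n -> (u^-1)%g \in Wn n.
Proof.
by move=> /inWnP Hu; apply/inWnP => x; apply: (@perm_inj _ u); rewrite Hu !permKV.
Qed.

Lemma pos_or_neg x : exists m, x = pos m \/ x = rev_ord (pos m).
Proof.
have Hx := ltn_ord x; case: (leqP n x) => nx.
  have H : x - n < n by lia.
  by exists (Ordinal H); left; apply: ord_inj; rewrite val_pos /=; lia.
have H : n - x.+1 < n by lia.
by exists (Ordinal H); right; apply: ord_inj; rewrite val_rev val_pos /=; lia.
Qed.

(** As [(tgen i * w)%g] is the function w after t_i, this says that right multiplication by t_i, in
    the usual notation, makes w longer. *)
Definition asc i w : bool := w (lo i) < w (hi i).

Lemma asc_tgen i w : asc i (tgen i * w)%g = ~~ asc i w.
Proof.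
rewrite /asc !permM tgen_lo tgen_hi -leqNgt [RHS]leq_eqVlt; case: eqP => //.
by move=> /val_inj /perm_inj E; have := lo_neq_hi i; rewrite E eqxx.
Qed.

Definition ninv w := #|[set t : 'I_N * 'I_N | (t.1 < t.2) && (w t.2 < w t.1)]|.
Definition nneg w := #|[set x : 'I_N | (n <= x) && (w x < n)]|.
(* Twice the Coxeter length: t_i with i > 0 creates two inversions, and t_0 one
   inversion and one sign. *)
Definition dlen w := ninv w + nneg w.

(** Relabelling places by the transposition carries the old inversions bijectively to the new ones
    other than (x, y), because adjacent places are reversed only against each other. *)
Lemma ninv_tperm w x y : y = x.+1 :> nat -> w x < w y ->
  ninv (tperm x y * w)%g = (ninv w).+1.
Proof.
move=> Exy wxy; rewrite /ninv.
set f := fun t : 'I_N * 'I_N => (tperm x y t.1, tperm x y t.2).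
have fK : involutive f by move=> [a b]; rewrite /f /= !tpermK.
set A := [set t | _]; set B := [set t | _].
suff -> : A = (x, y) |: f @: B.
  rewrite cardsU1 card_imset; last exact: inv_inj.
  case: imsetP => // -[[a b]]; rewrite inE /= => /andP[ab _] [E1 E2].
  have Ea : a = y by rewrite -(tpermK x y a) -E1 tpermL.
  have Eb : b = x by rewrite -(tpermK x y b) -E2 tpermR.
  by move: ab; rewrite Ea Eb; lia.
have swap (a b : 'I_N) : a < b -> (a, b) != (x, y) -> tperm x y a < tperm x y b.
  move=> ab; rewrite xpair_eqE -!(inj_eq (@ord_inj _)).
  have tv (c : 'I_N) : tperm x y c = (if c == x :> nat then y else
      if c == y :> nat then x else c) :> nat.
    case: tpermP => [->|->|/eqP H1 /eqP H2]; rewrite ?eqxx //.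
      by case: eqP => // ->.
    by rewrite !(inj_eq (@ord_inj _)) (negPf H1) (negPf H2).
  by rewrite !tv; do 6?case: eqP => //=; lia.
have inj (a b : 'I_N) : a < b -> w (tperm x y b) < w (tperm x y a) ->
    (a, b) != (x, y) -> (a, b) \in f @: B.
  move=> ab wab Nab; apply/imsetP; exists (f (a, b)); last by rewrite fK.
  by rewrite inE /= swap.
apply/setP => -[a b]; rewrite !inE /= !permM.
have [[-> ->]|Nab] := @eqP _ (a, b) (x, y).
  by rewrite tpermL tpermR wxy Exy ltnSn.
rewrite /=; apply/andP/idP => [[ab wab]|/imsetP[[a' b']]].
  by apply: inj => //; apply/eqP.
rewrite inE /= => /andP[ab wab] [-> ->]; rewrite !tpermK wab; split=> //.
by apply: swap => //; apply/eqP => -[Ea Eb]; subst; lia.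
Qed.

Lemma val_neg i : neg i = n - i.+1 :> nat.
Proof. by rewrite /neg val_rev /=; lia. Qed.

Lemma dlen_tgen i w : w \in Wn n -> asc i w -> dlen (tgen i * w)%g = (dlen w).+2.
Proof.
move=> /inWnP Ww; rewrite /asc => Ha; rewrite /dlen.
have Hl := val_lo i; have Hi := ltn_ord i; have Hh := val_hi i.
case: (posnP i) => Hi0.
  have Et : tgen i = tperm (lo i) (hi i) by rewrite /tgen /lo (_ : val i == 0 = true) //; apply/eqP.
  have Elo : lo i = rev_ord (hi i) by apply: ord_inj; rewrite Hl val_rev Hh; lia.
  rewrite Et ninv_tperm //; last by rewrite Hl Hh; lia.
  suff : nneg (tperm (lo i) (hi i) * w)%g = (nneg w).+1
    by move=> ->; rewrite addSn addnS.
  rewrite /nneg; set A := [set x | _]; set B := [set x | _].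
  (* Antisymmetry turns the ascent at the places -1, 1 into w(1) > 0, so exactly one new sign
     appears. *)
  have Hw : n <= w (hi i).
    move: Ha; rewrite Elo Ww val_rev /=; have := ltn_ord (w (hi i)); lia.
  suff -> : A = hi i |: B.
    by rewrite cardsU1 inE; case: andP => // -[_]; move: Hw => /=; lia.
  apply/setP => x; rewrite !inE permM -(inj_eq (@ord_inj _)) Hh Hi0 addn0.
  have [E|Ne] := eqVneq (x : nat) n.
    have -> : x = hi i by apply: ord_inj; rewrite E Hh; lia.
    rewrite tpermR Elo Ww val_rev; have := ltn_ord (w (hi i)).
    by rewrite Hh; lia.
  case: (leqP n x) => //= nx; rewrite tpermD //; apply/eqP => E; subst x;
    move: nx Ne; rewrite ?Hh ?Hl; lia.
have Hj : ord_pred i = i - 1 :> nat by move: Hl; rewrite /lo; case: eqP => /=; lia.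
have Elo : lo i = pos (ord_pred i) by apply: ord_inj; rewrite Hl val_pos Hj; lia.
have -> : tgen i = (tperm (neg i) (neg (ord_pred i)) * tperm (lo i) (hi i))%g.
  by rewrite /tgen; case: eqP => [/=|_]; [lia|rewrite Elo tpermC].
(* The two transpositions are mirror images, and the ascent needed for one follows from that of the
   other through w(-x) = -w(x). *)
rewrite -mulgA ninv_tperm.
- rewrite ninv_tperm //; last by rewrite Hl Hh; lia.
  suff : nneg (tperm (neg i) (neg (ord_pred i)) * (tperm (lo i) (hi i) * w))%g
         = nneg w by move=> ->; rewrite !addSn.
  rewrite /nneg mulgA; set A := [set x | _]; set B := [set x | _].
  have -> : A = tperm (lo i) (hi i) @: B.
    apply/setP => x; rewrite !inE !permM; apply/andP/imsetP.
      move=> [nx wx]; exists (tperm (lo i) (hi i) x); last by rewrite tpermK.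
      rewrite !inE; move: wx; rewrite (@tpermD _ (neg i) (neg (ord_pred i)) x).
      - move=> ->; rewrite andbT; case: tpermP => // _; rewrite ?Hh ?Hl; lia.
      - by apply/eqP => E; move: nx; rewrite -E val_neg; lia.
      - by apply/eqP => E; move: nx; rewrite -E val_neg Hj; lia.
    move=> [x']; rewrite inE => /andP[nx wx] ->.
    have -> : n <= tperm (lo i) (hi i) x'.
      by case: tpermP => // _; rewrite ?Hh ?Hl; lia.
    split=> //; rewrite (@tpermD _ (neg i)) ?tpermK //.
      apply/eqP => E; suff: n <= neg i by rewrite val_neg; lia.
      by rewrite E; case: tpermP => // _; rewrite ?Hh ?Hl; lia.
    apply/eqP => E; suff: n <= neg (ord_pred i) by rewrite val_neg Hj; lia.
    by rewrite E; case: tpermP => // _; rewrite ?Hh ?Hl; lia.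
  by rewrite card_imset //; apply: perm_inj.
- by rewrite !val_neg Hj; lia.
- rewrite !permM !tpermD; first 1 last.
  + by apply/eqP => /(congr1 (@nat_of_ord _)); rewrite Hl val_neg Hj; lia.
  + by apply/eqP => /(congr1 (@nat_of_ord _)); rewrite Hh val_neg Hj; lia.
  + by apply/eqP => /(congr1 (@nat_of_ord _)); rewrite Hl val_neg; lia.
  + by apply/eqP => /(congr1 (@nat_of_ord _)); rewrite Hh val_neg; lia.
  rewrite /neg -Elo -/(hi i) !Ww !val_rev; have := ltn_ord (w (hi i)).
  have := ltn_ord (w (lo i)); lia.
Qed.

(** A strictly increasing self-map of a finite chain satisfies x <= w x; the same bound at -x gives
    the reverse inequality. *)
Lemma asc_all w : w \in Wn n -> (forall i, asc i w) -> w = 1%g.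
Proof.
move=> /inWnP Ww Ha.
have adj x y : y = x.+1 :> nat -> w x < w y.
  have up (a b : 'I_N) : n <= b -> b = a.+1 :> nat -> w a < w b.
    move=> nb Eab; have Hb : b - n < n by have := ltn_ord b; lia.
    have := Ha (Ordinal Hb); rewrite /asc.
    have -> : lo (Ordinal Hb) = a by apply: ord_inj; rewrite val_lo /=; lia.
    have -> : hi (Ordinal Hb) = b by apply: ord_inj; rewrite val_hi /=; lia.
    by [].
  move=> Exy; case: (leqP n y) => ny; first exact: up.
  have := up (rev_ord y) (rev_ord x); rewrite !Ww !val_rev => /(_ _ _).
  have := ltn_ord x; have := ltn_ord (w x); have := ltn_ord (w y); lia.
have ge x : x <= w x.
  case: x => m; elim: m => [|m IH] Hm //=.
  have Hm' : m < N by lia.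
  have /= := adj (Ordinal Hm') (Ordinal Hm) erefl.
  by have /= := IH Hm'; lia.
apply/permP => x; rewrite perm1; apply: val_inj.
have := ge x; have := ge (rev_ord x); rewrite Ww !val_rev.
by have := ltn_ord x; have := ltn_ord (w x); move=> /=; lia.
Qed.

Lemma wprod_Wn (s : seq 'I_n) : (\prod_(i <- s) tgen i)%g \in Wn n.
Proof.
elim: s => [|i s IH]; first by rewrite big_nil Wn1.
by rewrite big_cons Wn_mul ?tgen_Wn.
Qed.

Lemma dlen_tgen' i w : w \in Wn n -> ~~ asc i w ->
  dlen w = (dlen (tgen i * w)%g).+2.
Proof.
move=> Ww Ha; have := @dlen_tgen i (tgen i * w)%g.
by rewrite mulgA tgen2 mul1g asc_tgen Wn_mul ?tgen_Wn // => /(_ isT Ha).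
Qed.

Lemma dlen_1 : dlen 1%g = 0.
Proof.
rewrite /dlen /ninv /nneg !eq_card0 // => x; rewrite !inE ?perm1; apply/negP => /andP[].
  by rewrite ltnNge => ->.
by move=> H1 H2; have := ltn_trans H1 H2; rewrite ltnn.
Qed.

Lemma dlen_wprod (s : seq 'I_n) : dlen (\prod_(i <- s) tgen i)%g <= (size s).*2.
Proof.
elim: s => [|i s IH]; first by rewrite big_nil dlen_1.
rewrite big_cons /=; set w := (\prod_(j <- s) tgen j)%g.
have Ww : w \in Wn n by exact: wprod_Wn.
have [Ha|Ha] := boolP (asc i w); first by rewrite dlen_tgen //; lia.
by move: IH; rewrite (dlen_tgen' Ww Ha) => /ltnW/ltnW/leq_trans -> //; lia.
Qed.

Lemma Wn_word w : w \in Wn n ->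
  exists2 s : seq 'I_n, w = (\prod_(i <- s) tgen i)%g & dlen w = (size s).*2.
Proof.
have [m] := ubnP (dlen w); elim: m w => // m IH w Hm Ww.
case: (pickP (fun i => ~~ asc i w)) => [i Hi|Hall].
  have HL := dlen_tgen' Ww Hi.
  have [||s Es Ls] := IH (tgen i * w)%g; rewrite ?Wn_mul ?tgen_Wn //; first by lia.
  exists (i :: s); last by rewrite HL Ls.
  by rewrite big_cons -Es mulgA tgen2 mul1g.
exists [::]; last by rewrite (asc_all Ww) ?dlen_1 // => i; apply: negbFE; exact: Hall.
by rewrite big_nil; apply: asc_all => // i; apply: negbFE; exact: Hall.
Qed.

Lemma is_word_lengthP w l :
  reflect (exists2 s : seq 'I_n, w = (\prod_(i <- s) tgen i)%g & size s = l)
    (is_word_length w l).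
Proof.
apply: (iffP existsP) => [[s /eqP ->]|[s -> Hs]].
  by exists s => //; rewrite size_tuple.
have Hs' : size s == l by rewrite Hs.
by exists (Tuple Hs').
Qed.

(** Each letter of a word changes [dlen] by 2, up or down, which bounds lengths from below; sorting
    away descents attains the bound. *)
Lemma lenE w : w \in Wn n -> (len w).*2 = dlen w.
Proof.
move=> Ww; rewrite /len; case: boolp.pselect => [e|[]]; last first.
  by have [s Es _] := Wn_word Ww; exists (size s); apply/is_word_lengthP; exists s.
case: ex_minnP => m /is_word_lengthP[s Es <-] Hmin.
have [s' Es' Hs'] := Wn_word Ww.
have /Hmin : is_word_length w (size s') by apply/is_word_lengthP; exists s'.
have := dlen_wprod s; rewrite -Es Hs'; lia.
Qed.

Lemma len_wprod (s : seq 'I_n) : len (\prod_(i <- s) tgen i)%g <= size s.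
Proof. by have := dlen_wprod s; rewrite -lenE ?wprod_Wn //; lia. Qed.

Lemma reduced_word w : w \in Wn n ->
  exists2 s : seq 'I_n, w = (\prod_(i <- s) tgen i)%g & size s = len w.
Proof.
move=> Ww; have [s Es Hs] := Wn_word Ww; exists s => //.
by move: Hs; rewrite -lenE //; lia.
Qed.

Lemma len_tgen i w : w \in Wn n -> asc i w -> len (tgen i * w)%g = (len w).+1.
Proof.
move=> Ww Ha; have := dlen_tgen Ww Ha; rewrite -!lenE ?Wn_mul ?tgen_Wn //; lia.
Qed.

Lemma len1 : len (1%g : 'S_N) = 0.
Proof. by have := lenE Wn1; rewrite dlen_1; lia. Qed.

Lemma wprodV (s : seq 'I_n) :
  ((\prod_(i <- s) tgen i)^-1)%g = (\prod_(i <- rev s) tgen i)%g.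
Proof.
elim: s => [|i s IH]; first by rewrite !big_nil invg1.
by rewrite rev_cons -cats1 big_cat /= big_cons big_seq1 invMg IH tgenV.
Qed.

Lemma lenV w : w \in Wn n -> len (w^-1)%g = len w.
Proof.
have half u : u \in Wn n -> len (u^-1)%g <= len u.
  move=> Wu; have [s -> <-] := reduced_word Wu.
  by rewrite wprodV (leq_trans (len_wprod _)) // size_rev.
move=> Ww; apply/eqP; rewrite eqn_leq half //=.
by rewrite -{1}[w]invgK half // Wn_inv.
Qed.

Lemma asc1 i : asc i 1%g.
Proof. by rewrite /asc !perm1 val_lo val_hi; have := ltn_ord i; lia. Qed.

Lemma len_gen i : len (tgen i) = 1.
Proof. by rewrite -[tgen i]mulg1 len_tgen ?Wn1 ?asc1 // len1. Qed.

End Generators.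

(** * Demazure products and atoms *)

Section Demazure.
Variable n : nat.
Local Notation N := (n + n).
Implicit Types (i : 'I_n) (x y : 'I_N) (w u v z : 'S_N) (s : seq 'I_n).
Variable op : 'S_N -> 'S_N -> 'S_N.
Hypothesis Hop : is_demazure op.

Let opW u v : u \in Wn n -> v \in Wn n -> op u v \in Wn n.
Proof. by case: Hop => H _ _ _; exact: H. Qed.

Let opA u v w : u \in Wn n -> v \in Wn n -> w \in Wn n ->
  op u (op v w) = op (op u v) w.
Proof. by case: Hop => _ H _ _; exact: H. Qed.

(** At a descent, w is a reduced product ending in t_i, so associativity and idempotency of t_i
    absorb the extra factor. *)
Lemma dem_r i w : w \in Wn n ->
  op w (tgen i) = if asc i w then (tgen i * w)%g else w.
Proof.
case: Hop => _ _ Hid Hlen Ww.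
have up u : u \in Wn n -> asc i u -> op u (tgen i) = (tgen i * u)%g.
  move=> Wu Ha; apply: Hlen => //; first exact: tgen_Wn.
  by rewrite /Defs.pcomp len_tgen // len_gen addn1.
case: ifP => [|/negbT] Ha; first exact: up.
have Wu : (tgen i * w)%g \in Wn n by rewrite Wn_mul ?tgen_Wn.
have Ew : w = op (tgen i * w)%g (tgen i).
  by rewrite up ?asc_tgen // mulgA tgen2 mul1g.
by rewrite [in LHS]Ew -opA ?tgen_Wn // Hid -Ew.
Qed.

Lemma dem_l i w : w \in Wn n ->
  op (tgen i) w = if asc i (w^-1)%g then (w * tgen i)%g else w.
Proof.
case: Hop => _ _ Hid Hlen Ww.
have up u : u \in Wn n -> asc i (u^-1)%g -> op (tgen i) u = (u * tgen i)%g.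
  move=> Wu Ha; apply: Hlen => //; first exact: tgen_Wn.
  rewrite /Defs.pcomp -lenV ?Wn_mul ?tgen_Wn // invMg tgenV len_tgen ?Wn_inv //.
  by rewrite len_gen lenV.
case: ifP => [|/negbT] Ha; first exact: up.
have Wu : (w * tgen i)%g \in Wn n by rewrite Wn_mul ?tgen_Wn.
have Ew : w = op (tgen i) (w * tgen i)%g.
  by rewrite up ?invMg ?tgenV ?asc_tgen // -mulgA tgen2 mulg1.
by rewrite [in LHS]Ew opA ?tgen_Wn // Hid -Ew.
Qed.

Definition act i z := op (op (tgen i) z) (tgen i).

Definition fpf_inv z := [/\ z \in Wn n, involutive z & forall x, z x != x].

Definition negated z : {set 'I_N} := [set x | z x == rev_ord x].

Lemma invol_invg z : involutive z -> (z^-1)%g = z.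
Proof. by move=> H; apply/permP => x; apply: (@perm_inj _ z); rewrite permKV H. Qed.

(** When z ascends at t = t_i, either both factors t lengthen it, or the second one meets a descent.
    By [tgen_lt] the latter forces (z(lo), z(hi)) to be one of the two pairs that t reverses, and
    then t commutes with z. *)
Lemma actP i z : z \in Wn n -> involutive z ->
  [\/ ~~ asc i z /\ act i z = z,
      [/\ asc i z, z (lo i) = lo i, z (hi i) = hi i & act i z = (tgen i * z)%g],
      [/\ asc i z, z (lo i) = rev_ord (hi i), z (hi i) = rev_ord (lo i)
        & act i z = (tgen i * z)%g]
    | [/\ asc i z, z (lo i) != rev_ord (hi i), z (lo i) != lo i \/ z (hi i) != hi i,
          asc i (z * tgen i)%g & act i z = (tgen i * (z * tgen i))%g]].
Proof.
move=> Wz Iz; rewrite /act dem_l // invol_invg //.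
case: ifP => [|/negbT] Ha; last by rewrite dem_r // (negPf Ha); constructor 1.
rewrite dem_r ?Wn_mul ?tgen_Wn //.
have Rz : z (rev_ord (hi i)) = rev_ord (z (hi i)) by apply/inWnP.
have Rz' : z (rev_ord (lo i)) = rev_ord (z (lo i)) by apply/inWnP.
have comm (E : [\/ z (lo i) = lo i /\ z (hi i) = hi i
      | z (lo i) = rev_ord (hi i) /\ z (hi i) = rev_ord (lo i)]) :
    (z * tgen i)%g = (tgen i * z)%g.
  apply/permP => x; rewrite !permM [tgen i x]tgenE.
  case: eqP => [->|/eqP x1]; first by case: E => -[-> ->]; rewrite ?tgen_hi ?tgen_rev ?tgen_lo.
  case: eqP => [->|/eqP x2]; first by case: E => -[-> ->]; rewrite ?tgen_lo ?tgen_rev ?tgen_hi.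
  case: eqP => [->|/eqP x3].
    by rewrite Rz Rz' tgen_rev; case: E => -[-> ->]; rewrite ?tgen_rev ?tgen_lo ?tgen_hi.
  case: eqP => [->|/eqP x4].
    by rewrite Rz Rz' tgen_rev; case: E => -[-> ->]; rewrite ?tgen_rev ?tgen_lo ?tgen_hi.
  have nz y : x != y -> z x != z y by rewrite (inj_eq perm_inj).
  move: (nz _ x1) (nz _ x2) (nz _ x3) (nz _ x4); rewrite Rz Rz'.
  by rewrite tgenE; case: E => -[-> ->]; rewrite ?rev_ordK;
     move=> /negPf -> /negPf -> /negPf -> /negPf ->.
have down : ~~ asc i (z * tgen i)%g ->
    [\/ z (lo i) = lo i /\ z (hi i) = hi i
      | z (lo i) = rev_ord (hi i) /\ z (hi i) = rev_ord (lo i)].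
  by rewrite /asc !permM => H; case: (tgen_lt Ha H) => [[-> ->]|[-> ->]]; [left|right].
have up (E : [\/ z (lo i) = lo i /\ z (hi i) = hi i
      | z (lo i) = rev_ord (hi i) /\ z (hi i) = rev_ord (lo i)]) :
    asc i (z * tgen i)%g = false.
  rewrite /asc !permM; apply/negbTE; rewrite -leqNgt.
  move: Ha; rewrite /asc; case: E => -[-> ->];
  rewrite ?tgen_rev tgen_lo tgen_hi; lia.
have [E|E] := boolP ((z (lo i) == lo i) && (z (hi i) == hi i)).
  case/andP: E => /eqP E1 /eqP E2; rewrite up; last by left.
  by constructor 2; split=> //; apply: comm; left.
have [E'|E'] := boolP ((z (lo i) == rev_ord (hi i))).
  have E1 := eqP E'.
  have E2 : z (hi i) = rev_ord (lo i).
    by rewrite -[hi i]rev_ordK -E1 (inWnP _ Wz) Iz.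
  rewrite up; last by right.
  by constructor 3; split=> //; apply: comm; right.
have Hup : asc i (z * tgen i)%g.
  apply: contraT => /down [[/eqP E1 /eqP E2]|[/eqP E1 _]].
    by rewrite E1 E2 in E.
  by rewrite E1 in E'.
rewrite Hup; constructor 4; split=> //; move: E; rewrite negb_and => /orP[->|->]; auto.
Qed.

Lemma act_Wn i z : z \in Wn n -> act i z \in Wn n.
Proof. by move=> Wz; rewrite /act !opW ?tgen_Wn. Qed.

(** Without fixed points the first commuting case is void; in the second, i = 0 would make lo = -hi
    a fixed point. *)
Lemma act_fpf_cases i z : fpf_inv z ->
  [\/ ~~ asc i z /\ act i z = z,
      [/\ asc i z, z (lo i) = rev_ord (hi i), z (hi i) = rev_ord (lo i)
        & n <= lo i /\ act i z = (tgen i * z)%g]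
    | [/\ asc i z, z (lo i) != rev_ord (hi i), 
          asc i (z * tgen i)%g & act i z = (tgen i * (z * tgen i))%g]].
Proof.
case=> Wz Iz Fz; case: (actP i Wz Iz) => [[]|[_ /eqP]|[Ha E1 E2 E3]|[]].
- by constructor 1.
- by rewrite (negPf (Fz _)).
- constructor 2; split=> //; split=> //; rewrite val_lo leqNgt; apply/negP => Hlt.
  have /eqP := Fz (lo i); rewrite E1; apply; apply: ord_inj.
  by rewrite val_rev val_lo val_hi; have := ltn_ord i; lia.
- by constructor 3.
Qed.

Lemma card4 (a b c d : 'I_N) : a < b -> b < c -> c < d ->
  #|[set a; b; c; d]| = 4.
Proof.
move=> ab bc cd; rewrite -!setUA !cardsU1 cards1 !inE.
by do 6![case: eqP => [E|_]; first by subst; lia].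
Qed.

Lemma fpf_act i z : fpf_inv z -> fpf_inv (act i z).
Proof.
move=> Hz; have [Wz Iz Fz] := Hz; split; first exact: act_Wn.
  case: (act_fpf_cases i Hz) => [[_ ->] //|[_ E1 E2 [_ ->]] x|[_ _ _ ->] x].
    have Rz : z (rev_ord (hi i)) = rev_ord (z (hi i)) by apply/inWnP.
    have Rz' : z (rev_ord (lo i)) = rev_ord (z (lo i)) by apply/inWnP.
    rewrite !permM [tgen i x]tgenE.
    case: eqP => [->|/eqP x1]; first by rewrite E1 tgen_rev tgen_hi Rz' E1 rev_ordK.
    case: eqP => [->|/eqP x2]; first by rewrite E2 tgen_rev tgen_lo Rz E2 rev_ordK.
    case: eqP => [->|/eqP x3]; first by rewrite Rz' E1 rev_ordK tgen_hi E1.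
    case: eqP => [->|/eqP x4]; first by rewrite Rz E2 rev_ordK tgen_lo E2.
    have nz y : x != y -> z x != z y by rewrite (inj_eq perm_inj).
    move: (nz _ x1) (nz _ x2) (nz _ x3) (nz _ x4); rewrite Rz Rz' E1 E2 !rev_ordK.
    by rewrite tgenE => /negPf -> /negPf -> /negPf -> /negPf ->; rewrite Iz.
  by rewrite !permM tgenK Iz tgenK.
case: (act_fpf_cases i Hz) => [[_ ->] //|[_ E1 E2 [Hl ->]] x|[_ _ _ ->] x].
  rewrite permM tgenE.
  have NL := rev_neq (lo i).
  have NH := rev_neq (hi i).
  have Rz : z (rev_ord (hi i)) = rev_ord (z (hi i)) by apply/inWnP.
  have Rz' : z (rev_ord (lo i)) = rev_ord (z (lo i)) by apply/inWnP.
  have [->|x1] := eqVneq x (hi i); first by rewrite E1.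
  have [->|x2] := eqVneq x (lo i); first by rewrite E2.
  have [->|x3] := eqVneq x (rev_ord (hi i)); first by rewrite Rz' E1 rev_ordK eq_sym.
  have [->|x4] := eqVneq x (rev_ord (lo i)); first by rewrite Rz E2 rev_ordK eq_sym.
  exact: Fz.
rewrite !permM; apply: contra (Fz (tgen i x)) => /eqP E.
by rewrite -{2}E tgenK.
Qed.

(* Weighted so that conjugation (4 units of dlen) and commuting steps (2 units of
   dlen and 4 negated points) both raise it by 8. *)
Definition height z := (dlen z).*2 + #|negated z|.

Lemma negated_comm i z : z \in Wn n ->
  z (lo i) = rev_ord (hi i) -> z (hi i) = rev_ord (lo i) ->
  negated (tgen i * z)%g =
    [set rev_ord (hi i); rev_ord (lo i); lo i; hi i] :|: negated z.
Proof.
move=> /inWnP HzW E1 E2; apply/setP => x; rewrite !inE permM [tgen i x]tgenE.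
have [->|x1] := eqVneq x (hi i); first by rewrite E1 eqxx !orbT.
have [->|x2] := eqVneq x (lo i); first by rewrite E2 eqxx !orbT.
have [->|x3] := eqVneq x (rev_ord (hi i)); first by rewrite HzW E1 eqxx.
have [->|x4] //= := eqVneq x (rev_ord (lo i)).
by rewrite HzW E2 eqxx.
Qed.

Lemma act_height i z : fpf_inv z -> act i z != z ->
  height (act i z) = height z + 8.
Proof.
move=> Hz; have [Wz Iz Fz] := Hz.
case: (act_fpf_cases i Hz) => [[_ ->]|[Ha E1 E2 [Hl ->]] _|[Ha _ Ha' ->] _].
- by rewrite eqxx.
- rewrite /height dlen_tgen //.
  have Rz : z (rev_ord (hi i)) = rev_ord (z (hi i)) by apply/inWnP.
  have Rz' : z (rev_ord (lo i)) = rev_ord (z (lo i)) by apply/inWnP.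
  rewrite negated_comm //; set A := [set _; _; _; _].
  rewrite cardsU (_ : A :&: _ = set0).
    rewrite cards0 card4 ?val_rev ?val_hi ?val_lo; move: Hl; rewrite ?val_lo;
    have := ltn_ord i; move=> *; lia.
  apply/setP => x; rewrite !inE; apply/negP => /andP[].
  have NE : lo i != hi i by exact: lo_neq_hi.
  move=> /orP[/orP[/orP[]|]|] /eqP ->; rewrite ?Rz ?Rz' ?E1 ?E2 ?(inj_eq rev_ord_inj).
  + by rewrite (negPf NE).
  + by rewrite eq_sym (negPf NE).
  + by rewrite eq_sym (negPf NE).
  + by rewrite (negPf NE).
- have L1 : dlen (z * tgen i)%g = (dlen z).+2.
    rewrite -lenE ?Wn_mul ?tgen_Wn // -lenV ?Wn_mul ?tgen_Wn // invMg tgenV.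
    by rewrite invol_invg // lenE ?Wn_mul ?tgen_Wn // dlen_tgen.
  rewrite /height dlen_tgen ?Wn_mul ?tgen_Wn // L1.
  suff -> : negated (tgen i * (z * tgen i))%g = tgen i @: negated z.
    by rewrite card_imset; [lia|exact: perm_inj].
  apply/setP => x; rewrite !inE !permM; apply/eqP/imsetP => [E|[y]].
    exists (tgen i x); last by rewrite tgenK.
    by rewrite inE -tgen_rev -E tgenK.
  by rewrite inE => /eqP Hy ->; rewrite !tgenK Hy tgen_rev.
Qed.

Lemma act_height_le i z : fpf_inv z -> height (act i z) <= height z + 8.
Proof.
move=> Hz; have [->|E] := eqVneq (act i z) z; first by rewrite leq_addr.
by rewrite act_height.
Qed.

Lemma fpf_foldr s z : fpf_inv z -> fpf_inv (foldr act z s).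
Proof. by move=> Hz; elim: s => //= i s; exact: fpf_act. Qed.

Lemma height_foldr s z : fpf_inv z -> height (foldr act z s) <= height z + 8 * size s.
Proof.
move=> Hz; elim: s => [|i s IH] /=; first by rewrite addn0.
by have := act_height_le i (fpf_foldr s Hz); lia.
Qed.

(** As in [foldr], the last letter acts first, so the head of the word is the step nearest to the
    target. This is the order in which a path of orbits is read from its source. *)
Fixpoint strict s z :=
  if s is i :: s' then strict s' z && (act i (foldr act z s') != foldr act z s')
  else true.

Lemma height_strict s z : fpf_inv z -> strict s z ->
  height (foldr act z s) = height z + 8 * size s.
Proof.
move=> Hz; elim: s => [|i s IH] /=; first by rewrite addn0.
by case/andP => /IH E H; rewrite act_height ?E //; [lia|exact: fpf_foldr].
Qed.

Definition conj_ok w u z := w \in Wn n /\ op (op (w^-1)%g u) w = z.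

Lemma conj_ok1 z : z \in Wn n -> op (op (1^-1)%g z) 1%g = z.
Proof.
move=> Wz; have [_ _ _ Hlen] := Hop.
rewrite invg1.
have -> : op 1%g z = z.
  have E : Defs.pcomp 1%g z = z by apply/permP => x; rewrite permM perm1.
  by rewrite -[RHS]E; apply: Hlen; rewrite ?Wn1 // E len1.
have E : Defs.pcomp z 1%g = z by apply/permP => x; rewrite permM perm1.
by rewrite -[RHS]E; apply: Hlen; rewrite ?Wn1 // E len1 addn0.
Qed.

(** v is the Demazure product of the word: it can only be shorter than the word, and it is the
    ordinary product when no letter is absorbed. *)
Lemma demazure_word s z : z \in Wn n ->
  exists2 v, conj_ok v z (foldr act z s) &
    len v <= size s /\ (len v = size s -> v = (\prod_(i <- s) tgen i)%g).
Proof.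
move=> Wz; elim: s => [|i s [v [Wv Ev] [Lv Pv]]] /=.
  exists 1%g; last by rewrite len1 big_nil.
  by split; [exact: Wn1|exact: conj_ok1].
pose v' := if asc i v then (tgen i * v)%g else v.
have Wv' : v' \in Wn n by rewrite /v'; case: ifP; rewrite ?Wn_mul ?tgen_Wn.
have Evr : op v (tgen i) = v' by rewrite dem_r.
have Evl : op (tgen i) (v^-1)%g = (v'^-1)%g.
  rewrite dem_l ?Wn_inv // invgK /v'; case: ifP => // _.
  by rewrite invMg tgenV.
exists v'.
  split=> //; rewrite -Ev /act -Evl -Evr.
  by rewrite -!opA ?opW ?Wn_inv ?tgen_Wn.
rewrite /v'; case: ifP => Ha.
  by rewrite len_tgen // ltnS; split=> // -[/Pv ->]; rewrite big_cons.
by split; [exact: leqW|move=> E; move: Lv; rewrite E ltnn].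
Qed.

Lemma conj_word w z : z \in Wn n -> w \in Wn n ->
  exists2 s, w = (\prod_(i <- s) tgen i)%g /\ size s = len w
    & op (op (w^-1)%g z) w = foldr act z s.
Proof.
move=> Wz; have [m] := ubnP (len w); elim: m w => // m IH w Hm Ww.
case: (pickP (fun i => ~~ asc i w)) => [i Hi|Hall]; last first.
  have -> : w = 1%g by apply: asc_all => // i; apply: negbFE; exact: Hall.
  exists [::]; first by rewrite big_nil len1.
  exact: conj_ok1.
pose u := (tgen i * w)%g.
have Wu : u \in Wn n by rewrite Wn_mul ?tgen_Wn.
have Hu : asc i u by rewrite asc_tgen.
have Ew : w = (tgen i * u)%g by rewrite mulgA tgen2 mul1g.
have Lw : len w = (len u).+1 by rewrite Ew len_tgen.
have [|s [Es Hs] E] := IH u _ Wu; first by rewrite -Lw.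
exists (i :: s); first by rewrite big_cons -Es -Ew /= Hs Lw.
rewrite /= -E /act.
have -> : w = op u (tgen i) by rewrite dem_r // Hu.
have -> : (op u (tgen i))^-1%g = op (tgen i) (u^-1)%g.
  by rewrite dem_r // Hu dem_l ?Wn_inv // invgK Hu invMg tgenV.
by rewrite -!opA ?opW ?Wn_inv ?tgen_Wn.
Qed.

(** A letter that leaves the involution unchanged could be dropped, contradicting minimality. *)
Lemma atoms_word (y : 'S_N) z w : fpf_inv y -> atoms op y z w ->
  exists2 s, w = (\prod_(i <- s) tgen i)%g & strict s y /\ foldr act y s = z.
Proof.
move=> Hy [[Ww Ew] Hmin]; have [Wy _ _] := Hy.
have [s [Es Hs] E] := conj_word Wy Ww.
exists s => //; split; last by rewrite -E.
have shorter s' : foldr act y s' = z -> size s <= size s'.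
  move=> E'; have [v [Wv Hv] [Lv _]] := demazure_word s' Wy.
  by rewrite Hs (leq_trans _ Lv) //; apply: Hmin; rewrite Hv.
have : foldr act y s = z by rewrite -E.
(* Minimality passes to every suffix, as a shorter replacement of the suffix would shorten the whole
   word. *)
clear - shorter; elim: s z shorter => //= i s IH z shorter E.
have Ne : act i (foldr act y s) != foldr act y s.
  by apply/eqP => E'; have := shorter s; rewrite -E E' => /(_ erefl); rewrite ltnn.
rewrite Ne andbT; apply: (IH (foldr act y s)) => // s' E'.
by have := shorter (i :: s'); rewrite /= E' E ltnS; apply.
Qed.

(** The word climbs 8 units of [height] per letter and no word climbs faster, so every competitor
    has at least as many letters. *)
Lemma word_atoms (y : 'S_N) s : fpf_inv y -> strict s y ->
  atoms op y (foldr act y s) (\prod_(i <- s) tgen i)%g.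
Proof.
move=> Hy Hs; have [Wy _ _] := Hy.
have Hh := height_strict Hy Hs.
have low u : conj_ok u y (foldr act y s) -> size s <= len u.
  move=> [Wu Eu]; have [s' [_ <-] E] := conj_word Wy Wu.
  by have := height_foldr s' Hy; rewrite -E Eu Hh; lia.
have [v Hv [Lv Pv]] := demazure_word s Wy.
have E : len v = size s by apply/eqP; rewrite eqn_leq Lv low.
rewrite -Pv // ; split=> // u /low; rewrite E; exact.
Qed.

End Demazure.

Section Negated.
Variables (n : nat) (z : 'S_(n + n)).
Hypothesis Hz : fpf_inv z.
Implicit Types (i : 'I_n) (x y : 'I_(n + n)).

Lemma negated_rev y : (rev_ord y \in negated z) = (y \in negated z).
Proof. by case: Hz => /inWnP HzW _ _; rewrite !inE HzW (inj_eq rev_ord_inj). Qed.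

Lemma asc_negated i : asc i z -> ~ (lo i \in negated z /\ hi i \in negated z).
Proof.
rewrite /asc !inE => Ha [/eqP E1 /eqP E2]; move: Ha; rewrite E1 E2 !val_rev.
by rewrite val_lo val_hi; have := ltn_ord i; lia.
Qed.

(** z reverses the order of the points that it negates, so no ascent of z has both places negated,
    and these are the only pairs that t_i could reverse. *)
Lemma tgen_lt_negated i x y : asc i z -> x \in negated z -> y \in negated z ->
  x < y -> tgen i x < tgen i y.
Proof.
move=> Ha Nx Ny xy; apply: contraT => /(tgen_lt xy) [[Ex Ey]|[Ex Ey]].
  by case: (asc_negated Ha); rewrite -Ex -Ey.
by case: (asc_negated Ha); rewrite -negated_rev -Ey -(negated_rev (hi i)) -Ex.
Qed.

End Negated.

(** * Chains descending from the fixed-point-free base point *)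

Section DisjointProducts.
Variables (T I : finType).

Lemma prod_perm_fix (P : pred I) (f : I -> {perm T}) x :
  (forall i, P i -> f i x = x) -> (\prod_(i | P i) f i)%g x = x.
Proof.
move=> H; elim/big_rec: _ => [|i u Pi IH]; first by rewrite perm1.
by rewrite permM H.
Qed.

Lemma prod_perm_one (P : pred I) (f : I -> {perm T}) i0 x : P i0 ->
  (forall i, P i -> i != i0 -> f i x = x) ->
  (forall i, P i -> i != i0 -> f i (f i0 x) = f i0 x) ->
  (\prod_(i | P i) f i)%g x = f i0 x.
Proof.
move=> P0 H1 H2; rewrite -[RHS]/(if true then f i0 x else x).
rewrite -(mem_index_enum i0).
elim: (index_enum I) (index_enum_uniq I) => [|i r IH] /=.
  by rewrite big_nil perm1.
case/andP=> ir Ur; rewrite big_cons in_cons.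
have [Ei|Ne] := eqVneq i0 i; last first.
  case: ifP => [Pi|_] /=; last exact: IH.
  by rewrite permM H1 ?IH // eq_sym.
subst i; rewrite P0 permM /=.
rewrite big_seq_cond; elim/big_rec: _ => [|j u /andP[Hj Pj] E]; first by rewrite perm1.
by rewrite permM H2 //; apply: contra ir => /eqP <-.
Qed.

End DisjointProducts.

Section FixedPointFree.
Variables (n k : nat).
Local Notation N := (n + n).
Hypotheses (kn : k <= n) (nk : ~~ odd (n - k)).
Implicit Types (i m : 'I_n) (x y : 'I_N) (u v w z : 'S_N).

(** The index that [t_alt] exchanges with m; indices start at 0, so the pairs begin at k. It is a
    natural number because it is sure to lie below n only for k <= m and n - k even. *)
Definition twin m := if odd (m - k) then m.-1 else m.+1.

Lemma twin_lt m : k <= m -> twin m < n.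
Proof. by rewrite /twin; have := ltn_ord m; case: ifP; lia. Qed.

Lemma twin_ge m : k <= m -> k <= twin m.
Proof. by rewrite /twin; case: ifP; lia. Qed.

Lemma t_alt_lt m : m < k -> t_alt n k (pos m) = pos m.
Proof.
move=> mk; apply: prod_perm_fix => i /andP[ki _]; apply: ord_inj.
by rewrite tgen_val val_pos; have := ltn_ord i; do 4?case: eqP; lia.
Qed.

Lemma t_alt_ge m : k <= m -> t_alt n k (pos m) = n + twin m :> nat.
Proof.
move=> mk; have Hm := ltn_ord m.
have [m0 [Hm0 Pm0 Em0]] : exists m0 : 'I_n, [/\ (k < m0) && odd (m0 - k),
    tgen m0 (pos m) = n + twin m :> nat & m0 = m :> nat \/ m0 = twin m :> nat].
  rewrite /twin; case: (boolP (odd (m - k))) => Ho.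
    exists m; split; [by lia| |by left].
    by rewrite tgen_val val_pos; do 4?case: eqP; lia.
  have Hm1 : m.+1 < n by lia.
  exists (Ordinal Hm1); split; [by rewrite /=; lia| |by right].
  by rewrite tgen_val val_pos /=; do 4?case: eqP; lia.
rewrite /t_alt (@prod_perm_one _ _ (fun i : 'I_n => (k < i) && odd (i - k)) (@tgen n) m0) //
  => i /andP[ki oi] /eqP Ni; apply: ord_inj.
  have Ni' : i <> m0 :> nat by move/ord_inj.
  rewrite tgen_val val_pos; move: Em0; rewrite /twin; have := ltn_ord i.
  by move/andP: Hm0 => [? ?]; case: ifP => ?; do 4?case: eqP; lia.
have Ni' : i <> m0 :> nat by move/ord_inj.
rewrite tgen_val Pm0; move: Em0; rewrite /twin; have := ltn_ord i.
by move/andP: Hm0 => [? ?]; case: ifP => ?; do 4?case: eqP; lia.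
Qed.

Lemma prod_Wn (I : finType) (P : pred I) (f : I -> 'S_N) :
  (forall j, P j -> f j \in Wn n) -> (\prod_(i | P i) f i)%g \in Wn n.
Proof.
by move=> H; elim/big_rec: _ => [|j u Pj IH]; [exact: Wn1|rewrite Wn_mul ?H].
Qed.

Lemma tperm_rev_Wn i : tperm (neg i) (pos i) \in Wn n.
Proof.
apply/inWnP => x; rewrite -[in RHS](rev_ordK x).
have E : tperm (neg i) (pos i) = tperm (rev_ord (neg i)) (rev_ord (pos i)).
  by rewrite /neg rev_ordK tpermC.
by rewrite [in LHS]E inj_tperm ?rev_ordK //; exact: rev_ord_inj.
Qed.

Lemma yFPF_Wn : yFPF n k \in Wn n.
Proof.
rewrite Wn_mul //; first by apply: prod_Wn => i _; exact: tgen_Wn.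
by apply: prod_Wn => i _; exact: tperm_rev_Wn.
Qed.

Lemma yFPF_lt m : m < k -> yFPF n k (pos m) = neg m.
Proof.
move=> mk; rewrite permM t_alt_lt //.
rewrite (@prod_perm_one _ _ _ (fun i => tperm (neg i) (pos i)) m) ?tpermR //.
- move=> i _ im; rewrite tpermD //; apply/eqP => /(congr1 (@nat_of_ord _)).
    by rewrite val_neg val_pos; have := ltn_ord i; lia.
  by rewrite !val_pos => /addnI/ord_inj E; rewrite E eqxx in im.
- move=> i _ im; rewrite tpermD //; apply/eqP => /(congr1 (@nat_of_ord _)).
    rewrite !val_neg => E; case/eqP: im; apply: ord_inj.
    by have := ltn_ord i; have := ltn_ord m; lia.
  by rewrite val_neg val_pos; have := ltn_ord m; lia.
Qed.

Lemma yFPF_ge m : k <= m -> yFPF n k (pos m) = n + twin m :> nat.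
Proof.
move=> mk; rewrite permM prod_perm_fix ?t_alt_ge // => i ik.
have Ht := t_alt_ge mk; have Hk := twin_ge mk.
rewrite tpermD //; apply/eqP => /(congr1 (@nat_of_ord _)); rewrite Ht.
  by rewrite val_neg; have := ltn_ord i; lia.
by rewrite val_pos; lia.
Qed.

Lemma yFPF_fpf : fpf_inv (yFPF n k).
Proof.
have HW := inWnP _ yFPF_Wn.
have inv m : yFPF n k (yFPF n k (pos m)) = pos m.
  case: (ltnP m k) => mk; first by rewrite yFPF_lt // HW yFPF_lt // /neg rev_ordK.
  have -> : yFPF n k (pos m) = pos (Ordinal (twin_lt mk)).
    by apply: ord_inj; rewrite yFPF_ge.
  apply: ord_inj; rewrite yFPF_ge ?twin_ge // val_pos.
  by rewrite /twin /=; case: (boolP (odd (m - k))) => Ho; case: ifP => Ho'; lia.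
have nofix m : yFPF n k (pos m) != pos m.
  case: (ltnP m k) => mk; first by rewrite yFPF_lt // rev_neq.
  apply/eqP => /(congr1 (@nat_of_ord _)); rewrite yFPF_ge // val_pos /twin.
  by case: ifP; lia.
split; first exact: yFPF_Wn.
  by move=> x; have [m [->|->]] := pos_or_neg x; rewrite ?HW inv.
by move=> x; have [m [->|->]] := pos_or_neg x; rewrite ?HW ?(inj_eq rev_ord_inj).
Qed.

(* v x and v (mate x) are to form a block of the shape of v * g_FPF, provided
   that z negates them. *)
Definition mate x := if yFPF n k x == rev_ord x then rev_ord x else rev_ord (yFPF n k x).

(** State of v = w^-1 when the chain from [yFPF] has reached z. The letters at indices below k give
    the trivial blocks ([ci_triv], [ci_mono]). Each later pair of letters is either still exchanged
    by z, or has been split into two negated letters, each forming a block with the negative of the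
    other ([ci_pair]). The inequalities decide which pairs the deletion of descents finds and which
    of these the shape keeps; [ci_nc] says that blocks do not cross. *)
Record chain_inv z v : Prop := ChainInv {
  ci_W : v \in Wn n;
  ci_triv : forall m, m < k -> n <= v (pos m) /\ z (v (pos m)) = rev_ord (v (pos m));
  ci_mono : forall m m', m < m' -> m' < k -> v (pos m) < v (pos m');
  ci_pair : forall m m', k <= m -> ~~ odd (m - k) -> m' = m.+1 :> nat ->
    n <= v (pos m') /\
    (([/\ z (v (pos m)) = v (pos m'), v (pos m) < v (pos m')
       & rev_ord (v (pos m)) < v (pos m')]) \/
     [/\ z (v (pos m)) = rev_ord (v (pos m)), z (v (pos m')) = rev_ord (v (pos m'))
       & v (pos m') < rev_ord (v (pos m))]);
  ci_nc : forall x y, v x \in negated z -> v y \in negated z ->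
    ~ [/\ v x < v y, v y < v (mate x) & v (mate x) < v (mate y)] }.

Lemma chain_inv1 : chain_inv (yFPF n k) 1%g.
Proof.
split; first exact: Wn1.
- by move=> m mk; rewrite !perm1 yFPF_lt // val_pos leq_addr.
- by move=> m m' mm' _; rewrite !perm1 !val_pos ltn_add2l.
- move=> m m' km om Em'; rewrite !perm1 !val_rev !val_pos leq_addr; split=> //.
  left; split; [|by lia|by have := ltn_ord m; lia].
  by apply: ord_inj; rewrite yFPF_ge // val_pos /twin (negPf om) Em'.
(* At the start all blocks have the form {x, -x}, and these are nested. *)
- move=> x y; rewrite !inE !perm1 /mate => /eqP -> /eqP ->; rewrite !eqxx !val_rev.
  by have := ltn_ord x; have := ltn_ord y; move=> ? ? []; lia.
Qed.

Section Consequences.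
Variables z v : 'S_N.
Hypotheses (Hz : fpf_inv z) (Hv : chain_inv z v).

Let HvW := inWnP _ (ci_W Hv).
Let HzW : forall x, z (rev_ord x) = rev_ord (z x).
Proof. by case: Hz => /inWnP. Qed.
Let HyW := inWnP _ yFPF_Wn.

Lemma mate_rev x : mate (rev_ord x) = rev_ord (mate x).
Proof. by rewrite /mate HyW (inj_eq rev_ord_inj); case: ifP. Qed.

Lemma mateK : involutive mate.
Proof.
have [_ Iy _] := yFPF_fpf.
move=> x; rewrite {2}/mate; case: ifP => [/eqP E|E].
  by rewrite mate_rev /mate E eqxx rev_ordK.
rewrite mate_rev /mate Iy -[x == _](inj_eq rev_ord_inj) rev_ordK eq_sym E.
by rewrite rev_ordK.
Qed.

(* Along a chain, each orbit of yFPF either follows z or has been split by a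
   commuting step. *)
Lemma chain_split x :
  (v x \notin negated z /\ z (v x) = v (yFPF n k x)) \/
  (v x \in negated z /\ v (mate x) \in negated z).
Proof.
have neg_rev y : (rev_ord y \in negated z) = (y \in negated z).
  by rewrite !inE HzW (inj_eq rev_ord_inj).
have [_ Iz _] := Hz; have [_ Iy _] := yFPF_fpf.
wlog [m ->] : x / exists m, x = pos m.
  move=> H; have [m [->|->]] := pos_or_neg x; first by apply: H; exists m.
  rewrite mate_rev !HvW !neg_rev HzW HyW HvW.
  by case: (H (pos m)) => [|[H1 ->]|H1]; [exists m|left|right].
case: (ltnP m k) => mk.
  right; have [_ H] := ci_triv Hv mk; rewrite inE H eqxx.
  by rewrite /mate yFPF_lt // eqxx HvW neg_rev inE H eqxx.
have main m1 m2 : k <= m1 -> ~~ odd (m1 - k) -> m2 = m1.+1 :> nat ->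
  [/\ yFPF n k (pos m1) = pos m2, yFPF n k (pos m2) = pos m1,
      mate (pos m1) = rev_ord (pos m2), mate (pos m2) = rev_ord (pos m1) &
     [/\ v (pos m1) \notin negated z, v (pos m2) \notin negated z,
          z (v (pos m1)) = v (pos m2) & z (v (pos m2)) = v (pos m1)] \/
    (v (pos m1) \in negated z /\ v (pos m2) \in negated z)].
  move=> km1 om1 Em2.
  have E1 : yFPF n k (pos m1) = pos m2.
    by apply: ord_inj; rewrite yFPF_ge // /twin (negPf om1) val_pos Em2.
  have E2 : yFPF n k (pos m2) = pos m1 by rewrite -E1 Iy.
  have Ne m3 m4 : (pos m3 == rev_ord (pos m4)) = false.
    apply/eqP => /(congr1 (@nat_of_ord _)); rewrite val_rev !val_pos.
    by have := ltn_ord m4; lia.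
  split=> //; rewrite ?/mate ?E1 ?E2 ?Ne //.
  have [_ [[H1 H2 H3]|[H1 H2 H3]]] := ci_pair Hv km1 om1 Em2; last first.
    by right; rewrite !inE H1 H2 !eqxx.
  have H4 : z (v (pos m2)) = v (pos m1) by rewrite -H1 Iz.
  left; rewrite !inE H1 H4; split=> //; apply/eqP => /(congr1 (@nat_of_ord _)); 
    move: H3; rewrite !val_rev; have := ltn_ord (v (pos m1)); have := ltn_ord (v (pos m2)); lia.
case: (boolP (odd (m - k))) => om.
  have Hm1 : m.-1 < n by have := ltn_ord m; lia.
  have [||| E1 E2 E3 E4] := main (Ordinal Hm1) m; rewrite /=; try lia.
  by rewrite E2 E4 HvW neg_rev => -[[H1 H2 H3 H4]|[H1 H2]]; [left|right].
have Hm1 : m.+1 < n by have := ltn_ord m; lia.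
have [||| E1 E2 E3 E4] := main m (Ordinal Hm1); rewrite /=; try lia.
by rewrite E1 E3 HvW neg_rev => -[[H1 H2 H3 H4]|[H1 H2]]; [left|right].
Qed.

Lemma mate_negated x : v x \in negated z -> v (mate x) \in negated z.
Proof. by case: (chain_split x) => [[/negPf -> //]|[]]. Qed.

End Consequences.

End FixedPointFree.

(** * One step of a chain *)

Section ChainSteps.
Variables (n k : nat).
Local Notation N := (n + n).
Hypotheses (kn : k <= n) (nk : ~~ odd (n - k)).
Variable i : 'I_n.
Variables z v : 'S_N.
Hypotheses (Hz : fpf_inv z) (Hv : chain_inv k z v) (Ha : asc i z).

Let HvW := inWnP _ (ci_W Hv).
Let Wz : z \in Wn n. Proof. by case: Hz. Qed.
Let Iz : involutive z. Proof. by case: Hz. Qed.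
Let Fz x : z x != x. Proof. by case: Hz. Qed.
Let HzW := inWnP _ Wz.
Local Notation t := (tgen i).

(** Every letter is relabelled by t. On negated letters t is monotone, so their inequalities
    persist. For a pair exchanged by z, a reversed inequality would place its letters at lo and hi
    up to sign, against the ascent of z, the other inequality or the assumption on z(lo). *)
Lemma chain_inv_conj : z (lo i) != rev_ord (hi i) ->
  chain_inv k (t * (z * t))%g (v * t)%g.
Proof.
move=> Hlo.
have zt x : (t * (z * t))%g (t x) = t (z x) by rewrite !permM tgenK.
have vt x : (v * t)%g x = t (v x) by rewrite permM.
have neg_t x : (t x \in negated (t * (z * t))%g) = (x \in negated z).
  by rewrite !inE zt -tgen_rev (inj_eq perm_inj).
have mono := tgen_lt_negated Hz Ha.
have Hll := val_lo i; have Hlh := val_hi i; have Hi := ltn_ord i.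
have pos_t x : x \in negated z -> n <= x -> n <= t x.
  move=> Nx nx; have Nr : rev_ord x \in negated z by rewrite negated_rev.
  have := mono _ _ Nr Nx; rewrite tgen_rev !val_rev.
  by have := ltn_ord x; have := ltn_ord (t x); lia.
split.
- by rewrite Wn_mul ?tgen_Wn ?(ci_W Hv).
- move=> m mk; have [H1 H2] := ci_triv Hv mk; rewrite !vt zt H2 tgen_rev.
  by split=> //; apply: pos_t => //; rewrite inE H2.
- move=> m m' mm' mk; rewrite !vt; apply: mono; last exact: (ci_mono Hv).
    by rewrite inE; case: (ci_triv Hv (ltn_trans mm' mk)) => _ ->.
  by rewrite inE; case: (ci_triv Hv mk) => _ ->.
- move=> m m' km om Em; rewrite !vt !zt -tgen_rev.
  have [Hb] := ci_pair Hv km om Em; set a := v (pos m); set b := v (pos m') in Hb *.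
  have Wb : rev_ord b < b by have := ltn_ord b; rewrite val_rev; lia.
  case=> [[Hab ab rab]|[Xa Xb ba]]; last first.
    have Na : a \in negated z by rewrite inE Xa.
    have Nb : b \in negated z by rewrite inE Xb.
    split; first exact: pos_t.
    right; rewrite Xa Xb; split; rewrite ?tgen_rev //.
    by rewrite -tgen_rev; apply: mono; rewrite ?negated_rev.
  have Hba : z b = a by rewrite -Hab Iz.
  (* A positive letter can become negative only for i = 0 and b = 1. *)
  have nb : n <= t b.
    case: (leqP n (t b)) => // tb; exfalso.
    have Eb : b = hi i /\ rev_ord b = lo i.
      have : ~~ (t (rev_ord b) < t b).
        by rewrite tgen_rev val_rev; have := ltn_ord (t b); lia.
      case/(tgen_lt Wb) => -[E1 E2]; first by rewrite E1 E2.
      by rewrite {2}E2 rev_ordK; split=> //; apply: rev_ord_inj.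
    case: Eb => E1 E2; have E1' := congr1 (@nat_of_ord _) E1.
    have E2' := congr1 (@nat_of_ord _) E2; rewrite val_rev Hll in E2'.
    rewrite Hlh in E1'; move: Ha; rewrite /asc -E1 -E2 HzW Hba val_rev.
    by move: ab rab; rewrite val_rev; have := ltn_ord a; lia.
  split=> //; left; split; first by rewrite Hab.
    apply: contraT => /(tgen_lt ab); case=> -[E1 E2].
      by move: Ha; rewrite /asc -E1 -E2 Hba Hab; lia.
    by move: rab; rewrite E1 rev_ordK E2 val_rev Hlh Hll; lia.
  apply: contraT => /(tgen_lt rab); case=> -[E1 E2].
    by case/eqP: Hlo; rewrite -E1 HzW Hab E2.
  case/eqP: Hlo; rewrite -[lo i]rev_ordK -E2 HzW Hba; congr rev_ord.
  by rewrite -[hi i]rev_ordK -E1 rev_ordK.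
- move=> x y; rewrite !vt !neg_t => Nx Ny.
  have Mx := mate_negated kn nk Hz Hv Nx; have My := mate_negated kn nk Hz Hv Ny.
  have refl a b : a \in negated z -> b \in negated z -> t a < t b -> a < b.
    move=> Na Nb ab; rewrite ltnNge leq_eqVlt; apply/negP => /orP[/eqP/ord_inj E|ba].
      by rewrite E ltnn in ab.
    by have := mono _ _ Nb Na ba; lia.
  case=> /(refl _ _ Nx Ny) H1 /(refl _ _ Ny Mx) H2 /(refl _ _ Mx My) H3.
  by case: (ci_nc Hv Nx Ny).
Qed.

Section Commuting.
Hypotheses (E1 : z (lo i) = rev_ord (hi i)) (E2 : z (hi i) = rev_ord (lo i)).
Hypothesis nlo : n <= lo i.

Let t_fix x : x != lo i -> x != hi i -> x != rev_ord (lo i) -> x != rev_ord (hi i) ->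
  t x = x.
Proof. by rewrite tgenE => /negPf -> /negPf -> /negPf -> /negPf ->. Qed.

(** z pairs the four points that t moves as lo with -hi and hi with -lo, so none of them is negated
    before the step. *)
Lemma tgen_negated_comm x : x \in negated z -> t x = x.
Proof.
have Nlo : lo i \notin negated z.
  by rewrite inE E1 (inj_eq rev_ord_inj) eq_sym lo_neq_hi.
have Nhi : hi i \notin negated z by rewrite inE E2 (inj_eq rev_ord_inj) lo_neq_hi.
by move=> Nx; apply: t_fix; apply: contraTneq Nx => -> //; rewrite negated_rev.
Qed.

(** t z negates the old points and the four places that t moves. The latter carry letters that z
    exchanged in pairs before the step, and these become the new blocks {lo, hi} and {-lo, -hi}. *)
Lemma mate_comm x : (v * t)%g x \in negated (t * z)%g ->
  [/\ v x \in negated z, (v * t)%g x = v x & (v * t)%g (mate k x) = v (mate k x)] \/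
  [\/ (v * t)%g x = lo i /\ (v * t)%g (mate k x) = hi i,
      (v * t)%g x = hi i /\ (v * t)%g (mate k x) = lo i,
      (v * t)%g x = rev_ord (lo i) /\ (v * t)%g (mate k x) = rev_ord (hi i) |
      (v * t)%g x = rev_ord (hi i) /\ (v * t)%g (mate k x) = rev_ord (lo i)].
Proof.
rewrite !permM (negated_comm Wz) // in_setU => Hx.
have [[Ns Es]|[Nx Nm]] := chain_split kn nk Hz Hv x; last first.
  by left; rewrite !tgen_negated_comm.
have Em : v (mate k x) = rev_ord (z (v x)).
  rewrite /mate; case: eqP => E; last by rewrite HvW Es.
  by case/negP: Ns; rewrite inE Es E HvW.
rewrite Em; right; case/orP: Hx => [|Nx]; last first.
  by case/negP: Ns; rewrite -(tgenK i (v x)) tgen_negated_comm.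
rewrite !inE => /orP[/orP[/orP[]|]|] /eqP E; rewrite E; move: (congr1 t E);
  rewrite tgenK ?tgen_rev ?tgen_lo ?tgen_hi => ->.
- by constructor 4; rewrite HzW E1 rev_ordK tgen_hi.
- by constructor 3; rewrite HzW E2 rev_ordK tgen_lo.
- by constructor 1; rewrite E2 tgen_rev rev_ordK tgen_lo.
- by constructor 2; rewrite E1 tgen_rev rev_ordK tgen_hi.
Qed.

(** The two letters of a new block are adjacent values: nothing lies between them, so they cannot
    cross another block. *)
Lemma chain_inv_comm : chain_inv k (t * z)%g (v * t)%g.
Proof.
have Hll := val_lo i; have Hlh := val_hi i; have Hi := ltn_ord i.
have vt x : (v * t)%g x = t (v x) by rewrite permM.
have zE x : (t * z)%g x = z (t x) by rewrite permM.
have t_neg := tgen_negated_comm.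
split.
- by rewrite Wn_mul ?tgen_Wn ?(ci_W Hv).
- move=> m mk; have [H1 H2] := ci_triv Hv mk.
  have Nm : v (pos m) \in negated z by rewrite inE H2.
  by rewrite !vt zE !t_neg.
- move=> m m' mm' mk; rewrite !vt !t_neg ?(ci_mono Hv) //.
    by rewrite inE; case: (ci_triv Hv mk) => _ ->.
  by rewrite inE; case: (ci_triv Hv (ltn_trans mm' mk)) => _ ->.
- move=> m m' km om Em; rewrite !vt !zE !tgenK.
  have [Hb] := ci_pair Hv km om Em; set a := v (pos m); set b := v (pos m') in Hb *.
  case=> [[Hab ab rab]|[Xa Xb ba]]; last first.
    have Na : a \in negated z by rewrite inE Xa.
    have Nb : b \in negated z by rewrite inE Xb.
    by rewrite !t_neg //; split=> //; right.
  have Hba : z b = a by rewrite -Hab Iz.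
  (* The pair being split is a = -lo, b = hi, which t turns into -hi, lo; with b = lo the inequality
     -a < b would read hi < lo. *)
  have [Eb|bl] := eqVneq b (lo i).
    by exfalso; move: rab; rewrite -Hba Eb E1 rev_ordK; lia.
  have [Eb|bh] := eqVneq b (hi i).
    have Ea : a = rev_ord (lo i) by rewrite -Hba Eb E2.
    rewrite Ea Eb tgen_rev tgen_lo tgen_hi HzW E1 E2 !rev_ordK; split=> //.
    by right; split=> //; rewrite Hll Hlh; lia.
  have Fb : t b = b.
    apply: t_fix => //; apply/eqP => E; move: Hb; rewrite E val_rev; lia.
  have Fa : t a = a.
    have Ez y : a = y -> b = z y by move=> <-; rewrite Hab.
    apply: t_fix; apply/eqP => /Ez; rewrite ?HzW ?E1 ?E2 ?rev_ordK => E.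
    - by move: Hb; rewrite E val_rev Hlh; lia.
    - by move: Hb; rewrite E val_rev; lia.
    - by rewrite E eqxx in bh.
    - by rewrite E eqxx in bl.
  by rewrite Fa Fb; split=> //; left.
- move=> x y Nx Ny.
  have other u : (v * t)%g u \in negated (t * z)%g -> v u \notin negated z ->
    (v * t)%g u = ((v * t)%g (mate k u)).+1 :> nat \/
    ((v * t)%g u).+1 = (v * t)%g (mate k u) :> nat.
    move=> /mate_comm [[-> //]|H] _.
    by case: H => -[-> ->]; rewrite ?val_rev ?Hll ?Hlh; lia.
  have fix_pair u : (v * t)%g u \in negated (t * z)%g -> v u \in negated z ->
      (v * t)%g u = v u /\ (v * t)%g (mate k u) = v (mate k u).
    by move=> _ Nu; rewrite !vt !t_neg //; apply: (mate_negated kn nk Hz Hv).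
  case: (boolP (v x \in negated z)) => Hx; last first.
    by case: (other x Nx Hx) => ? []; lia.
  case: (boolP (v y \in negated z)) => Hy; last first.
    by case: (other y Ny Hy) => ? []; lia.
  have [-> ->] := fix_pair x Nx Hx; have [-> ->] := fix_pair y Ny Hy.
  exact: (ci_nc Hv Hx Hy).
Qed.

End Commuting.

End ChainSteps.

Section Chains.
Variables (n k : nat).
Local Notation N := (n + n).
Hypotheses (kn : k <= n) (nk : ~~ odd (n - k)).
Variable op : 'S_N -> 'S_N -> 'S_N.
Hypothesis Hop : is_demazure op.

Lemma strict_chain_inv s : strict op s (yFPF n k) ->
  chain_inv k (foldr (act op) (yFPF n k) s) (\prod_(i <- s) tgen i)^-1%g.
Proof.
elim: s => [|i s IH] /=; first by rewrite big_nil invg1 => _; exact: chain_inv1.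
case/andP=> /IH Hv.
have Hz := fpf_foldr Hop s (yFPF_fpf kn nk).
rewrite big_cons invMg tgenV.
case: (act_fpf_cases Hop i Hz) => [[_ ->]|[Ha E1 E2 [E3 ->]] _|[Ha E1 _ ->] _].
- by rewrite eqxx.
- exact: chain_inv_comm.
- exact: chain_inv_conj.
Qed.

End Chains.

(** * Shapes *)

Section Deletion.
Variable n : nat.
Local Notation N := (n + n).
Implicit Types (s R st : seq 'I_N).

Fixpoint adjacent_pairs s : seq ('I_N * 'I_N) :=
  if s is b :: a :: s' then (b, a) :: adjacent_pairs s' else [::].

Lemma delete_increasing st R s :
  sorted (fun x y : 'I_N => x < y) (rev st ++ R) ->
  delete_descents st (R ++ s) = delete_descents (rev R ++ st) s.
Proof.
elim: R st => [|a R IH] st //; rewrite -cat_rcons -rev_cons => H.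
rewrite rev_cons cat_rcons -IH //.
case: st H => [|b st] //= H.
suff ba : b < a by rewrite ltnNge (ltnW ba).
move: H; rewrite !rev_cons -!cats1 -!catA /= => /(drop_sorted (size st)).
by rewrite drop_size_cat ?size_rev //= => /andP[].
Qed.

(** Each b exceeds the top of the stack, so it is pushed and removed at once by the a that follows;
    the stack is restored after every pair. *)
Lemma delete_pairs st s m : size s = m.*2 ->
  (forall d, d \in adjacent_pairs s -> d.2 < d.1 /\
     (forall x, ohead st = Some x -> x < d.1)) ->
  delete_descents st s = (adjacent_pairs s, rev st).
Proof.
elim: m s => [|m IH] [|b [|a s]] //= [Hs] H.
have [/= ab Hb] := H (b, a) (mem_head _ _).
have E : delete_descents st s = (adjacent_pairs s, rev st).
  by apply: IH => // d Hd; apply: H; rewrite in_cons Hd orbT.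
case: st Hb E {H IH} => [|c st] Hb E /=; rewrite ?ab ?E //.
by have /ltnW := Hb c erefl; rewrite leqNgt => /negPf ->.
Qed.

Lemma adjacent_pairsP x0 s m d : size s = m.*2 ->
  reflect (exists2 j, j < m & d = (nth x0 s j.*2, nth x0 s j.*2.+1))
    (d \in adjacent_pairs s).
Proof.
move=> Hs; apply: (iffP idP).
  elim: m s Hs => [|m IH] [|b [|a s]] //= [Hs]; rewrite in_cons.
  case/orP => [/eqP ->|/(IH _ Hs) [j jm ->]]; first by exists 0.
  by exists j.+1.
case=> j; elim: m s j Hs => [|m IH] [|b [|a s]] [|j] //= [Hs] jm Ed.
  by rewrite Ed mem_head.
by rewrite in_cons (IH s j) ?orbT.
Qed.

End Deletion.

Section Shapes.
Variables (n k : nat).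
Local Notation N := (n + n).
Hypotheses (kn : k <= n) (nk : ~~ odd (n - k)).
Implicit Types (i m : 'I_n) (x y : 'I_N) (u v w z : 'S_N).

Definition blocks z v : {set {set 'I_N}} :=
  [set [set v x; v (mate k x)] | x in [set x | v x \in negated z]].

(** With indices from 0, the factor g sends the place of m to the negative of the place of j = k - m
    - 1, whose ordinal is n - j - 1. *)
Lemma gFPF_lt m : m < k -> gFPF n k (pos m) = n - (k - m) :> nat.
Proof.
move=> mk; rewrite permM t_alt_lt //.
have Hj : k - m.+1 < n by lia.
have [j Ej] : exists j : 'I_n, j = k - m.+1 :> nat by exists (Ordinal Hj).
have inner i : (\prod_(j < n | (i + j).+1 == k) tperm (pos i) (neg j))%g (pos m) =
    if i == m then neg j else pos m.
  case: eqP => [->|/eqP im].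
    rewrite (@prod_perm_one _ _ _ (fun j : 'I_n => tperm (pos m) (neg j)) j) ?tpermL //=.
    - by apply/eqP; lia.
    - move=> i' H1 /eqP H2; case: H2; apply: ord_inj; lia.
    - move=> i' H1 /eqP H2; case: H2; apply: ord_inj; lia.
  rewrite prod_perm_fix // => j' _; rewrite tpermD //.
    by apply: contraNneq im => /(congr1 (@nat_of_ord _)); rewrite !val_pos => /addnI/ord_inj ->.
  by apply/eqP => /(congr1 (@nat_of_ord _)); rewrite val_neg val_pos; have := ltn_ord m; lia.
have innerj i : i != m ->
   (\prod_(j < n | (i + j).+1 == k) tperm (pos i) (neg j))%g (neg j) = neg j.
  move=> im; apply: prod_perm_fix => j' Hj'; rewrite tpermD //.
    by apply/eqP => /(congr1 (@nat_of_ord _)); rewrite val_neg val_pos; have := ltn_ord j; lia.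
  apply/eqP => /(congr1 (@nat_of_ord _)); rewrite !val_neg => E.
  case/eqP: im; apply: ord_inj.
  by move: E; have := ltn_ord m; have := ltn_ord j'; lia.
rewrite /g_one (@prod_perm_one _ _ predT _ m) //.
- by rewrite inner eqxx val_neg; have := ltn_ord m; lia.
- by move=> i _ im; rewrite inner (negPf im).
- by move=> i _ im; rewrite inner eqxx innerj.
Qed.

Lemma gFPF_ge m : k <= m -> gFPF n k (pos m) = n + twin k m :> nat.
Proof.
move=> mk; rewrite permM prod_perm_fix ?t_alt_ge // => i _.
rewrite prod_perm_fix // => j /eqP ij.
have Ht := t_alt_ge kn nk mk; have Hk := twin_ge kn nk mk.
rewrite tpermD //; apply/eqP => /(congr1 (@nat_of_ord _)); rewrite Ht.
  by rewrite val_pos; lia.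
by rewrite val_neg; have := ltn_ord j; lia.
Qed.

(** With indices from 1, the word of v g_FPF is -v(k), ..., -v(1) followed by v(k+2), v(k+1),
    v(k+4), v(k+3), and so on. The first stretch is negative and increasing; in each later pair the
    first letter is positive and exceeds the second. So exactly these pairs are deleted, and
    [sh_pair] keeps the split ones. *)
Lemma shFPF_blocks z v : 0 < n -> fpf_inv z -> chain_inv k z v ->
  shFPF k v = blocks z v.
Proof.
move=> n0 Hz Hv; have HvW := inWnP _ (ci_W Hv); have [/inWnP HzW Iz Fz] := Hz.
rewrite /shFPF; set w := Defs.pcomp v (gFPF n k).
have wE x : w x = v (gFPF n k x) by rewrite permM.
pose x0 := pos (Ordinal n0).
have sw : size (one_line w) = n by rewrite size_map size_enum_ord.
have nthw m : nth x0 (one_line w) m = w (pos m).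
  by rewrite (nth_map m) ?size_enum_ord // nth_ord_enum.
have nthlt j (H : j < k) (m : 'I_n) : m = k - j.+1 :> nat ->
    nth x0 (one_line w) j = rev_ord (v (pos m)).
  move=> Em; have jn : j < n by lia.
  rewrite -[j]/(nat_of_ord (Ordinal jn)) nthw wE -HvW; congr (v _).
  by apply: ord_inj; rewrite gFPF_lt // val_rev val_pos /=; lia.
have nthge (j : nat) (m : 'I_n) : k <= j -> m = (if odd (j - k) then j.-1 else j.+1) :> nat ->
    j < n -> nth x0 (one_line w) j = v (pos m).
  move=> kj Em jn.
  rewrite -[j]/(nat_of_ord (Ordinal jn)) nthw wE; congr (v _).
  by apply: ord_inj; rewrite gFPF_ge // val_pos /twin /= Em.
pose R := take k (one_line w); pose s := drop k (one_line w).
have Rs : one_line w = R ++ s by rewrite cat_take_drop.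
have sR : size R = k by rewrite size_take sw; case: ltngtP kn.
have ss : size s = (n - k)./2.*2 by rewrite size_drop sw even_halfK.
have nthR j (m : 'I_n) : j < k -> m = k - j.+1 :> nat -> nth x0 R j = rev_ord (v (pos m)).
  by move=> jk Em; rewrite nth_take //; apply: nthlt.
have nths j (m m' : 'I_n) : j < (n - k)./2 -> m = k + j.*2 :> nat -> m' = m.+1 :> nat ->
    nth x0 s j.*2 = v (pos m') /\ nth x0 s j.*2.+1 = v (pos m).
  move=> jn Em Em'; rewrite !nth_drop; have := ltn_ord m'; have := ltn_ord m => H1 H2.
  split; apply: nthge; try lia.
    by rewrite (_ : k + j.*2 - k = j.*2) ?odd_double; lia.
  by rewrite (_ : k + j.*2.+1 - k = j.*2.+1) /= ?odd_double /=; lia.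
have Rpos e : e \in R -> exists2 m : 'I_n, m < k & e = rev_ord (v (pos m)).
  move=> /(nthP x0) [j]; rewrite sR => jk <-.
  have Hm : k - j.+1 < n by lia.
  by exists (Ordinal Hm); rewrite /=; [lia|apply: nthR].
have Hpairs d : d \in adjacent_pairs s -> exists m m' : 'I_n, [/\ k <= m, ~~ odd (m - k),
    m' = m.+1 :> nat & d = (v (pos m'), v (pos m))].
  move=> /(adjacent_pairsP x0 d ss) [j jn ->].
  have H1 : k + j.*2 < n by lia.
  have H2 : (k + j.*2).+1 < n by lia.
  have [E1 E2] := nths j (Ordinal H1) (Ordinal H2) jn erefl erefl.
  exists (Ordinal H1), (Ordinal H2); rewrite E1 E2; split=> //=; first by lia.
  by rewrite (_ : k + j.*2 - k = j.*2) ?odd_double; lia.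
have Hdel : delete_descents [::] (one_line w) = (adjacent_pairs s, R).
  rewrite Rs delete_increasing ?cats0; last first.
    apply/(sortedP x0) => j; rewrite sR => jk.
    have H1 : k - j.+1 < n by lia.
    have H2 : k - j.+2 < n by lia.
    rewrite (nthR j (Ordinal H1)) ?(nthR j.+1 (Ordinal H2)) //; last by lia.
    have /= := ci_mono Hv (m := Ordinal H2) (m' := Ordinal H1).
    have := ltn_ord (v (pos (Ordinal H1))); have := ltn_ord (v (pos (Ordinal H2))).
    by move=> ? ? /(_ _ _); lia.
  rewrite (delete_pairs ss) ?revK // => d /Hpairs [m [m' [km om Em ->]]] /=.
  have [Hb Hc] := ci_pair Hv km om Em; split.
    by case: Hc => [[_ ? _]|[_ _]] // H; move: Hb H; rewrite val_rev; lia.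
  move=> e; case: (rev R) (revK R) => //= a R' ER [<-].
  have /Rpos [m1 m1k ->] : a \in R by rewrite -ER mem_rev mem_head.
  by have [H _] := ci_triv Hv m1k; rewrite val_rev; lia.
have HR e : (e \in xi w) = (e \in R) by rewrite /xi Hdel.
have HN d : (d \in NDes w) = (d \in adjacent_pairs s) by rewrite /NDes Hdel.
have memR (m : 'I_n) : m < k -> rev_ord (v (pos m)) \in R.
  move=> mk; have jk : k - m.+1 < k by lia.
  by rewrite -(nthR _ m jk) ?mem_nth ?sR //; lia.
have memN (m m' : 'I_n) : k <= m -> ~~ odd (m - k) -> m' = m.+1 :> nat ->
    (v (pos m'), v (pos m)) \in adjacent_pairs s.
  move=> km om Em; apply/(adjacent_pairsP x0 _ ss).
  have := ltn_ord m'; have E : (m - k)./2.*2 = m - k by rewrite even_halfK.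
  move=> H; exists (m - k)./2; first by lia.
  have [||-> ->] // := nths (m - k)./2 m m' _ _ Em; first by lia.
  by rewrite E; lia.
have matepair (m m' : 'I_n) : k <= m -> ~~ odd (m - k) -> m' = m.+1 :> nat ->
    mate k (pos m) = rev_ord (pos m') /\ mate k (pos m') = rev_ord (pos m).
  move=> km om Em.
  have E1 : yFPF n k (pos m) = pos m'.
    by apply: ord_inj; rewrite yFPF_ge // /twin (negPf om) val_pos Em.
  have E2 : yFPF n k (pos m') = pos m.
    by apply: ord_inj; rewrite yFPF_ge ?val_pos /twin //= Em; [case: ifP; lia|lia].
  have Ne m3 m4 : (pos m3 == rev_ord (pos m4)) = false.
    apply/eqP => /(congr1 (@nat_of_ord _)); rewrite val_rev !val_pos.
    by have := ltn_ord m4; lia.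
  by rewrite /mate E1 E2 !Ne.
have matelt (m : 'I_n) : m < k -> mate k (pos m) = rev_ord (pos m).
  by move=> mk; rewrite /mate yFPF_lt // eqxx.
apply/setP => B; rewrite !inE; apply/idP/imsetP.
  case/orP => [/orP[]|] /imsetP[d].
  - rewrite inE HN => /andP[/Hpairs [m [m' [km om Em ->]]]] /= /and3P[/= _ _ H] ->.
    have [_ [[_ _ H']|[Xa Xb H']]] := ci_pair Hv km om Em.
      by move: H H'; rewrite !val_rev; lia.
    exists (pos m'); first by rewrite !inE Xb.
    by have [_ ->] := matepair _ _ km om Em; rewrite HvW.
  - rewrite inE HN => /andP[/Hpairs [m [m' [km om Em ->]]]] /= /and3P[/= _ _ H] ->.
    have [_ [[_ _ H']|[Xa Xb H']]] := ci_pair Hv km om Em.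
      by move: H H'; rewrite !val_rev; lia.
    exists (rev_ord (pos m')); first by rewrite inE HvW negated_rev // inE Xb.
    by have [_ E] := matepair _ _ km om Em; rewrite mate_rev E rev_ordK HvW.
  - rewrite inE HR => /andP[/Rpos [m mk ->]] _ ->.
    have [_ Hm] := ci_triv Hv mk.
    exists (rev_ord (pos m)); first by rewrite inE HvW negated_rev // inE Hm.
    by rewrite mate_rev matelt // rev_ordK HvW rev_ordK.
case=> x; rewrite inE => Nx ->.
have triv (m : 'I_n) : m < k -> [exists e in [pred e in xi w | is_neg e],
    [set v (pos m); rev_ord (v (pos m))] == [set e; rev_ord e]].
  move=> mk; apply/existsP; exists (rev_ord (v (pos m))).
  rewrite inE HR memR //= rev_ordK setUC eqxx andbT /is_neg val_rev.
  by have [] := ci_triv Hv mk; lia.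
(* A pair still exchanged by z contains no negated letter, so this pair has been split and passes
   [sh_pair]. *)
have pairX (m m' : 'I_n) : k <= m -> ~~ odd (m - k) -> m' = m.+1 :> nat ->
   (v (pos m) \in negated z) || (v (pos m') \in negated z) ->
   (v (pos m'), v (pos m)) \in [pred d in NDes w | sh_pair d].
  move=> km om Em; rewrite !inE HN memN //= => H.
  have [Hb [[Hab H1 H2]|[Xa Xb H']]] := ci_pair Hv km om Em.
    case/orP: H => /eqP E; exfalso.
      by move: H2; rewrite -E Hab ltnn.
    have E' : z (v (pos m')) = v (pos m) by rewrite -Hab Iz.
    by move: H2; rewrite -E' E rev_ordK ltnn.
  rewrite /sh_pair /is_pos /is_neg /= Hb H' andbT.
  by move: H'; rewrite val_rev; lia.
have neg_pos m : v (rev_ord (pos m)) \in negated z -> v (pos m) \in negated z.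
  by rewrite HvW negated_rev.
have [m Hm] := pos_or_neg x.
have Nm : v (pos m) \in negated z by case: Hm Nx => ->; rewrite ?HvW ?negated_rev.
case: (ltnP m k) => mk.
  apply/orP; right; have /existsP[e /andP[He /eqP E]] := triv m mk.
  apply/imsetP; exists e => //; rewrite -E.
  by case: Hm => ->; rewrite ?mate_rev matelt // ?HvW ?rev_ordK // setUC.
have fin (m1 m2 : 'I_n) : k <= m1 -> ~~ odd (m1 - k) -> m2 = m1.+1 :> nat -> m = m1 \/ m = m2 ->
  [set v x; v (mate k x)] = [set v (pos m2); rev_ord (v (pos m1))] \/
  [set v x; v (mate k x)] = [set rev_ord (v (pos m2)); v (pos m1)].
  move=> km om Em2 Em; have [E1 E2] := matepair _ _ km om Em2.
  case: Em Hm => -> [->|->]; rewrite ?mate_rev ?E1 ?E2 ?HvW ?rev_ordK.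
  - by right; rewrite setUC.
  - by left; rewrite setUC.
  - by left.
  - by right.
have [p1 [p2 [km1 om1 Ep2 Ep]]] : exists p1 p2 : 'I_n, [/\ k <= p1, ~~ odd (p1 - k),
    p2 = p1.+1 :> nat & m = p1 \/ m = p2].
  case: (boolP (odd (m - k))) => om.
    have Hm1 : m.-1 < n by have := ltn_ord m; lia.
    by exists (Ordinal Hm1), m; split=> /=; try lia; right.
  have Hm1 : m.+1 < n by have := ltn_ord m; lia.
  by exists m, (Ordinal Hm1); split=> //; left.
have Hd := pairX _ _ km1 om1 Ep2.
have {}Hd : (v (pos p2), v (pos p1)) \in [pred d in NDes w | sh_pair d].
  by apply: Hd; case: Ep => <-; rewrite Nm ?orbT.
apply/orP; left; apply/orP.
case: (fin _ _ km1 om1 Ep2 Ep) => ->; [left|right]; apply/imsetP;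
  by exists (v (pos p2), v (pos p1)).
Qed.

End Shapes.

(** * Clans *)

Lemma is_signP (x : symbol) : reflect (exists s, x = inl s) (is_sign x).
Proof. by case: x => [s|m]; constructor; [exists s|case]. Qed.

Section ClanInvolutions.
Variable N : nat.
Implicit Types (c : {ffun 'I_N -> symbol}) (y : 'S_N).

(** The relation through which [iota_clan], defined by [pick], is handled; [iota_invol] identifies
    the two. *)
Record clan_invol c y : Prop := ClanInvol {
  cl_inv : involutive y;
  cl_sign : forall x, is_sign (c x) = (y x == x);
  cl_eq : forall x x', is_int (c x) -> (c x' == c x) = (x' == x) || (x' == y x) }.

Lemma cl_fix c y x : clan_invol c y -> c (y x) = c x.
Proof.
move=> H; case Hx : (is_int (c x)).
  by apply/eqP; rewrite (cl_eq H) // eqxx orbT.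
by have := cl_sign H x; rewrite /is_sign Hx => /esym/eqP ->.
Qed.

Lemma matched_invol c y x x' : clan_invol c y ->
  matched c x x' = (x != x') && (y x == x').
Proof.
move=> H; rewrite /matched; have [//|Ne /=] := eqVneq x x'.
case Hx : (is_int (c x)) => /=.
  by rewrite eq_sym (cl_eq H) // eq_sym (negPf Ne) eq_sym.
by have := cl_sign H x; rewrite /is_sign Hx => /esym/eqP ->; rewrite (negPf Ne).
Qed.

Lemma matched_invol_card c y x : clan_invol c y -> is_int (c x) ->
  #|[set x' | c x' == c x]%SET| = 2.
Proof.
move=> H Hx; have -> : [set x' | c x' == c x]%SET = [set x; y x]%SET.
  by apply/setP => x'; rewrite !inE (cl_eq H).
rewrite cards2 eq_sym -(cl_sign H) /is_sign Hx //.
Qed.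

(** An integer occurs at exactly two positions, so sending each position to the other one is an
    involution. *)
Lemma exists_invol c :
  (forall i, is_int (c i) -> #|[set j | c j == c i]%SET| = 2) ->
  exists y, clan_invol c y.
Proof.
move=> Hc; pose f x := odflt x [pick x' | matched c x x'].
have uniq x x1 x2 : matched c x x1 -> matched c x x2 -> x1 = x2.
  move=> /and3P[n1 Ix /eqP e1] /and3P[n2 _ /eqP e2]; apply/eqP; apply: contraT => n12.
  have := Hc x Ix; suff /subset_leq_card : [set x; x1; x2]%SET \subset [set j | c j == c x]%SET.
    by rewrite -setUA !cardsU1 cards1 !inE (negPf n1) (negPf n2) (negPf n12) => H1 H2; rewrite H2 in H1.
  by apply/subsetP => u; rewrite !inE => /orP[/orP[]|] /eqP ->; rewrite -?e1 -?e2 eqxx.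
have msym x x' : matched c x x' -> matched c x' x.
  by case/and3P=> n1 Ix /eqP E; rewrite /matched eq_sym n1 -E Ix eqxx.
have fm x : is_int (c x) -> matched c x (f x).
  move=> Ix; rewrite /f; case: pickP => [//|H]; exfalso.
  have := Hc x Ix; suff -> : [set j | c j == c x]%SET = [set x]%SET by rewrite cards1.
  apply/setP => u; rewrite !inE; apply/eqP/eqP => [E|-> //].
  by apply/eqP; have := H u; rewrite /matched Ix E eqxx !andbT eq_sym => /negbFE.
have fs x : is_sign (c x) -> f x = x.
  by move=> Ix; rewrite /f; case: pickP => // x' /and3P[_ H]; rewrite /is_sign H in Ix.
have fK : involutive f.
  move=> x; case Ix : (is_int (c x)); last by rewrite !fs // /is_sign Ix.
  have M := fm x Ix; have M' := msym _ _ M.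
  apply: (uniq (f x)) => //; apply: fm; by case/and3P: M'.
exists (perm (inv_inj fK)); split.
- by move=> x; rewrite !permE fK.
- move=> x; rewrite permE; case Ix : (is_int (c x)); last by rewrite /is_sign Ix fs ?eqxx // /is_sign Ix.
  by have /and3P[/negPf H _ _] := fm x Ix; rewrite eq_sym H /is_sign Ix.
- move=> x x' Ix; rewrite permE; have M := fm x Ix.
  have [->|Ne] := eqVneq x' x; first by rewrite eqxx.
  apply/eqP/eqP => [E|->]; last by case/and3P: M => _ _ /eqP.
  by apply: (uniq x) => //; rewrite /matched eq_sym Ne Ix E eqxx.
Qed.

Lemma signs_filter c : signs c =
  pmap (fun x => if c x is inl s then Some s else None)
    [seq x <- enum 'I_N | is_sign (c x)].
Proof.
rewrite /signs; elim: (enum _) => //= x s IH.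
by case E : (c x) => [b|m] /=; rewrite ?E IH.
Qed.

(** The reason why rule (i) keeps the sign sequence: symbols move, but the sign positions keep their
    relative order. *)
Lemma signs_transport c c' (f : 'I_N -> 'I_N) :
  (forall x, c' x = c (f x)) -> bijective f ->
  (forall x x', is_sign (c' x) -> is_sign (c' x') -> x < x' -> f x < f x') ->
  signs c' = signs c.
Proof.
move=> E [g fK gK] mono; rewrite !signs_filter.
set l' := [seq x <- _ | is_sign (c' x)]; set l := [seq x <- _ | is_sign (c x)].
have srt (a : pred 'I_N) : sorted (fun x x' : 'I_N => x < x') [seq x <- enum 'I_N | a x].
  apply: sorted_filter; first by move=> x1 x2 x3; apply: ltn_trans.
  have := iota_ltn_sorted 0 N; rewrite -val_enum_ord sorted_map //.
have -> : l = map f l'.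
  apply: (@irr_sorted_eq _ (fun x x' : 'I_N => x < x')).
  - by move=> x1 x2 x3; apply: ltn_trans.
  - by move=> x; rewrite ltnn.
  - exact: srt.
  - rewrite sorted_map; have := srt (fun x => is_sign (c' x)); rewrite -/l'.
    apply: (@sub_in_sorted _ [pred x | is_sign (c' x)]).
      by move=> x x' /=; rewrite !inE; apply: mono.
    by apply/allP => x; rewrite mem_filter => /andP[].
  - move=> x; rewrite mem_filter mem_enum andbT; apply/idP/mapP => [Hx|[x' ]].
      by exists (g x); rewrite ?gK // mem_filter mem_enum E gK Hx.
    by rewrite mem_filter E => /andP[Hx _] ->.
elim: l' => //= x s IH; by rewrite -E IH.
Qed.

End ClanInvolutions.

Section SymmetricClanActions.
Variables (n p q : nat).
Local Notation N := (n + n).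
Implicit Types (c : {ffun 'I_N -> symbol}) (y : 'S_N) (i : 'I_n) (x : 'I_N).

Definition sign_counts c : Prop :=
  #|[set x | c x == inl true]%SET| + q.*2 = #|[set x | c x == inl false]%SET| + p.*2.

Record sym_clan c y : Prop := SymClan {
  sy_invol : clan_invol c y;
  sy_Wn : y \in Wn n;
  sy_sign : forall x s, (c (rev_ord x) == inl s) = (c x == inl s);
  sy_Neg : forall x, y x != rev_ord x }.

Lemma iota_invol c y : clan_invol c y -> iota_clan c = y.
Proof.
move=> H; rewrite /iota_clan; case: pickP => [y' /andP[/eqP E /forallP Hy']|].
  have M x x' : x != x' -> (y' x == x') = (y x == x').
    move=> Ne; have /forallP /(_ x') := Hy' x.
    by rewrite Ne (matched_invol _ _ H) Ne => /eqP.
  suff -> : y' = y by [].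
  apply/permP => x; have [Ex|Ne] := eqVneq (y x) x; last first.
    by apply/eqP; rewrite M ?eqxx // eq_sym.
  rewrite Ex; apply/eqP; apply: contraT => Ny.
  by have := M x (y' x); rewrite eq_sym Ny eqxx Ex eq_sym (negPf Ny) => /(_ isT).
move=> /(_ y) /negP[]; rewrite (invol_invg (cl_inv H)) eqxx /=.
apply/forallP => x; apply/forallP => x'; apply/implyP => Nx.
by rewrite (matched_invol _ _ H) Nx.
Qed.

Lemma sym_clan_rev c y x : sym_clan c y -> is_sign (c (rev_ord x)) = is_sign (c x).
Proof.
by case=> H /inWnP W _ _; rewrite !(cl_sign H) W (inj_eq rev_ord_inj).
Qed.

(** Replaces equality of clans up to relabelling by pointwise conditions: symmetry puts the
    involution in W_n and makes mirror signs agree, and an empty [Neg] means that the involution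
    negates no point. *)
Lemma orbit_clanP c : orbit_clan p q c <->
  [/\ N = p.*2 + q.*2, sign_counts c & sym_clan c (iota_clan c)].
Proof.
split=> [[[H1 /exists_invol[y Hy] H3] [S1 S2] Hneg]|[HN Hs [Hi W Hsig Hn]]].
  have Ey := iota_invol Hy; split=> //; rewrite Ey; split=> //.
  - apply/inWnP => x; have [Ex|Ne] := eqVneq (y x) x.
      apply/eqP; rewrite Ex -(cl_sign Hy).
      have : is_sign (c x) by rewrite (cl_sign Hy) Ex.
      by case/is_signP => s /S1; rewrite ffunE => ->.
    have := S2 (rev_ord x) (rev_ord (y x)).
    have M : matched c x (y x) by rewrite (matched_invol _ _ Hy) eq_sym Ne eqxx.
    have -> : matched [ffun i => c (rev_ord i)] (rev_ord x) (rev_ord (y x)) = true.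
      by move: M; rewrite /matched !ffunE !rev_ordK (inj_eq rev_ord_inj).
    by rewrite (matched_invol _ _ Hy) => /andP[_ /eqP].
  - move=> x s; apply/eqP/eqP => E.
      by apply/S1; rewrite ffunE.
    by move: E => /S1; rewrite ffunE.
  - have HH m : y (pos m) != rev_ord (pos m).
      apply/eqP => E; have : m \in Neg c.
        rewrite inE -/(neg m) /neg -E (cl_fix _ Hy) eqxx andbT.
        by apply: contraT => Hm; have := cl_sign Hy (pos m); rewrite /is_sign Hm E (negPf (rev_neq _)).
      by rewrite Hneg inE.
    move=> x; have [m [->|->]] := pos_or_neg x; first exact: HH.
    rewrite rev_ordK; apply/eqP => /(congr1 y); rewrite (cl_inv Hy) => /esym/eqP.
    by rewrite (negPf (HH m)).
split.
- by split=> // i Ii; rewrite (matched_invol_card Hi).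
- split=> [x s|x x']; first by rewrite ffunE; split=> /eqP H;
    apply/eqP; rewrite ?Hsig // -Hsig.
  have -> : matched [ffun i0 => c (rev_ord i0)] x x' = matched c (rev_ord x) (rev_ord x').
    by rewrite /matched !ffunE (inj_eq rev_ord_inj).
  by rewrite !(matched_invol _ _ Hi) (inWnP _ W) !(inj_eq rev_ord_inj).
- apply/setP => m; rewrite !inE; apply/negP => /andP[Im /eqP E].
  have /eqP := E; rewrite (cl_eq Hi) // /neg (negPf (rev_neq _)) /= eq_sym.
  by rewrite (negPf (Hn _)).
Qed.

Lemma same_clan_iota c c' y y' : clan_invol c y -> clan_invol c' y' ->
  same_clan c c' -> y = y'.
Proof.
move=> H H' [_ S2]; have key c1 c2 y1 y2 : clan_invol c1 y1 -> clan_invol c2 y2 ->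
    (forall x x', matched c1 x x' = matched c2 x x') -> forall x, y1 x != x -> y2 x = y1 x.
  move=> H1 H2 E x Ne; have := E x (y1 x).
  by rewrite (matched_invol _ _ H1) (matched_invol _ _ H2) eqxx eq_sym Ne => /esym/eqP.
apply/permP => x; have [E|Ne] := eqVneq (y x) x; last by rewrite (key _ _ _ _ H H').
rewrite E; apply/esym/eqP; apply: contraT => Ne.
have := key _ _ _ _ H' H (fun x x' => esym (S2 x x')) x Ne.
by rewrite E => E'; rewrite -E' eqxx in Ne.
Qed.

Lemma same_clanI c c' y : clan_invol c y -> clan_invol c' y ->
  (forall x s, (c x == inl s) = (c' x == inl s)) -> same_clan c c'.
Proof.
move=> H H' E; split=> [x s|x x']; last by rewrite (matched_invol _ _ H) (matched_invol _ _ H').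
by split=> /eqP H1; apply/eqP; move: H1; rewrite E.
Qed.

End SymmetricClanActions.

(** * Moves of symmetric clans *)

Section ClanSteps.
Variables (n p q : nat).
Local Notation N := (n + n).
Implicit Types (c : {ffun 'I_N -> symbol}) (y : 'S_N) (i : 'I_n) (x : 'I_N).
Variable op : 'S_N -> 'S_N -> 'S_N.
Hypothesis Hop : is_demazure op.

Definition comp_clan c (f : 'S_N) : {ffun 'I_N -> symbol} := [ffun x => c (f x)].

Lemma clan_invol_comp c y (f : 'S_N) : involutive f -> clan_invol c y ->
  clan_invol (comp_clan c f) (f * (y * f))%g.
Proof.
move=> fK [Iy Sy Ey]; split.
- by move=> x; rewrite !permM fK Iy fK.
- by move=> x; rewrite ffunE Sy !permM -[X in _ = (_ == X)](fK x) (inj_eq perm_inj).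
- move=> x x'; rewrite !ffunE => Ix; rewrite Ey // !permM.
  by rewrite (inj_eq perm_inj) -[X in _ = _ || (X == _)](fK x') (inj_eq perm_inj).
Qed.

Lemma sign_counts_comp c (f : 'S_N) :
  sign_counts p q c -> sign_counts p q (comp_clan c f).
Proof.
have H s : #|[set x | comp_clan c f x == inl s]%SET| = #|[set x | c x == inl s]%SET|.
  rewrite -[RHS](card_preimset _ (@perm_inj _ f)).
  by apply: eq_card => x; rewrite !inE ffunE.
by rewrite /sign_counts !H.
Qed.

Lemma sym_clan_conj c y i : sym_clan c y ->
  sym_clan (comp_clan c (tgen i)) (tgen i * (y * tgen i))%g.
Proof.
case=> Hi W Hs Hn; split.
- exact/clan_invol_comp/Hi/tgenK.
- by rewrite !Wn_mul ?tgen_Wn.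
- by move=> x s; rewrite !ffunE tgen_rev Hs.
- move=> x; rewrite !permM; apply: contra (Hn (tgen i x)) => /eqP E.
  by rewrite -tgen_rev -E tgenK.
Qed.

Definition flip_clan c i (m m' : int) : {ffun 'I_N -> symbol} :=
  [ffun x => if x \in [:: lo i; hi i] then inr m
             else if x \in [:: rev_ord (lo i); rev_ord (hi i)] then inr m' else c x].

Definition opposite_signs (a b : symbol) : Prop := exists s, a = inl s /\ b = inl (~~ s).

Definition flip_step i c c' := exists m m' : int,
  [/\ m != m', forall x, c x != inr m, forall x, c x != inr m' & c' = flip_clan c i m m'].

(** The moves that really change the clan: a conjugation, or the matching of two adjacent opposite
    signs. Rule (i) has one more ascending case, y(lo) = -hi, but its result matches positions to
    their negatives, and the exception to the rules turns it into a loop. *)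
Definition clan_step i c c' : Prop :=
  let y := iota_clan c in
  ([/\ asc i y, y (lo i) != rev_ord (hi i), y (lo i) != lo i \/ y (hi i) != hi i &
      c' = comp_clan c (tgen i)]) \/
  [/\ n <= lo i, opposite_signs (c (lo i)) (c (hi i)) & flip_step i c c'].

Lemma fresh_labels c : exists m m' : int,
  [/\ m != m', forall x, c x != inr m & forall x, c x != inr m'].
Proof.
pose g x := if c x is inr m then absz m else 0.
pose b := \sum_x g x.
have fresh k : b < k -> forall x, c x != inr (Posz k).
  move=> bk x; apply/eqP => E; suff : g x <= b by rewrite /g E /=; lia.
  by rewrite /b (bigD1 x) //= leq_addr.
exists (Posz b.+1), (Posz b.+2); split; [by lia| |]; apply: fresh; lia.
Qed.

Lemma lo_hi_disjoint i : n <= lo i ->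
  [/\ lo i != rev_ord (lo i), lo i != rev_ord (hi i), hi i != rev_ord (lo i) &
      hi i != rev_ord (hi i)].
Proof.
move=> nlo; have Hl := val_lo i; have Hh := val_hi i; have Hi := ltn_ord i.
split; apply/eqP => /(congr1 (@nat_of_ord _)); rewrite val_rev; lia.
Qed.

Lemma flip_clan_sym c y i c' : sym_clan c y -> n <= lo i ->
  is_sign (c (lo i)) -> is_sign (c (hi i)) -> flip_step i c c' ->
  sym_clan c' (tgen i * y)%g.
Proof.
move=> [Hi W Hs Hn] nlo Sl Sh [m [m' [mm' fm fm' ->]]].
have [D1 D2 D3 D4] := lo_hi_disjoint nlo.
have Yl : y (lo i) = lo i by apply/eqP; rewrite -(cl_sign Hi).
have Yh : y (hi i) = hi i by apply/eqP; rewrite -(cl_sign Hi).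
have Wy := inWnP _ W.
have Yrl : y (rev_ord (lo i)) = rev_ord (lo i) by rewrite Wy Yl.
have Yrh : y (rev_ord (hi i)) = rev_ord (hi i) by rewrite Wy Yh.
pose F := [:: lo i; hi i; rev_ord (lo i); rev_ord (hi i)].
have yF x : x \in F -> (tgen i * y)%g x = tgen i x.
  rewrite /F !inE permM => /or4P[] /eqP ->;
  by rewrite ?tgen_rev ?tgen_lo ?tgen_hi ?Yl ?Yh ?Yrl ?Yrh.
have tF x : x \in F -> tgen i x \in F.
  rewrite /F !inE => /or4P[] /eqP ->; rewrite ?tgen_rev ?tgen_lo ?tgen_hi !eqxx ?orbT //.
have tN x : x \notin F -> tgen i x = x.
  by rewrite /F !inE !negb_or tgenE => /and4P[/negPf -> /negPf -> /negPf -> /negPf ->].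
have yN x : x \notin F -> (tgen i * y)%g x = y x by move=> H; rewrite permM tN.
have yNF x : x \notin F -> y x \notin F.
  apply: contra; rewrite /F !inE => /or4P[] /eqP E;
  move: (congr1 y E); rewrite (cl_inv Hi) => ->; rewrite ?Yl ?Yh ?Yrl ?Yrh eqxx ?orbT //.
have lh := lo_neq_hi i.
have cE x : flip_clan c i m m' x = if x \in F then
    (if x \in [:: lo i; hi i] then inr m else inr m') else c x.
  by rewrite ffunE /F !inE; do 4 case: (x == _).
have I' : involutive (tgen i * y)%g.
  move=> x; case: (boolP (x \in F)) => Hx; first by rewrite yF // yF ?tF // tgenK.
  by rewrite yN // yN ?yNF // (cl_inv Hi).
have tne x : x \in F -> tgen i x != x.
  by rewrite /F !inE => /or4P[] /eqP ->; rewrite ?tgen_rev ?tgen_lo ?tgen_hi ?(inj_eq rev_ord_inj) // eq_sym.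
split.
- split=> //.
  + move=> x; rewrite cE; case: (boolP (x \in F)) => Hx.
      by rewrite yF // (negPf (tne x Hx)); case: ifP.
    by rewrite yN // (cl_sign Hi).
  + move=> x x'; rewrite !cE; case: (boolP (x \in F)) => Hx.
      rewrite yF // => _; case: (boolP (x' \in F)) => Hx'; last first.
        have -> : (x' == x) = false by apply/eqP => E; rewrite E Hx in Hx'.
        have -> : (x' == tgen i x) = false by apply/eqP => E; rewrite E tF in Hx'.
        by apply/eqP; case: ifP => _ E; [move: (fm x')|move: (fm' x')]; rewrite E eqxx.
      have mm2 : (inr m == inr m' :> symbol) = false by apply/eqP => -[E]; rewrite E eqxx in mm'.
      have mm3 : (inr m' == inr m :> symbol) = false by rewrite eq_sym.
      have Drl : (rev_ord (lo i) == rev_ord (hi i)) = false.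
        by rewrite (inj_eq rev_ord_inj) (negPf lh).
      have Drh : (rev_ord (hi i) == rev_ord (lo i)) = false by rewrite eq_sym.
      have hl : (hi i == lo i) = false by rewrite eq_sym (negPf lh).
      have D1' := D1; have D2' := D2; have D3' := D3; have D4' := D4.
      rewrite eq_sym in D1'; rewrite eq_sym in D2'; rewrite eq_sym in D3'; rewrite eq_sym in D4'.
      move: Hx Hx'; rewrite /F !inE => /or4P[] /eqP -> /or4P[] /eqP ->;
      rewrite ?tgen_rev ?tgen_lo ?tgen_hi ?eqxx ?(negPf lh) ?hl ?Drl ?Drh
        ?(negPf D1) ?(negPf D2) ?(negPf D3) ?(negPf D4) ?(negPf D1') ?(negPf D2')
        ?(negPf D3') ?(negPf D4') /= ?eqxx ?mm2 ?mm3 //.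
    rewrite yN // => Ix; case: (boolP (x' \in F)) => Hx'; last by rewrite (cl_eq Hi).
    have -> : (x' == x) = false by apply/eqP => E; rewrite E (negPf Hx) in Hx'.
    have -> : (x' == y x) = false by apply/eqP => E; rewrite E (negPf (yNF _ Hx)) in Hx'.
    by apply/eqP; case: ifP => _ E; [move: (fm x)|move: (fm' x)]; rewrite -E eqxx.
- by rewrite Wn_mul ?tgen_Wn.
- move=> x s; rewrite !cE.
  have -> : (rev_ord x \in F) = (x \in F).
    rewrite /F !inE -{1}(rev_ordK (lo i)) -{1}(rev_ordK (hi i)) !(inj_eq rev_ord_inj).
    by do 4 case: (x == _).
  by case: ifP => _; [do 2 case: ifP => _|rewrite Hs].
- move=> x; case: (boolP (x \in F)) => Hx; last by rewrite yN.
  rewrite yF //; move: Hx; rewrite /F !inE => /or4P[] /eqP ->;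
  rewrite ?tgen_rev ?tgen_lo ?tgen_hi ?(inj_eq rev_ord_inj) // ?rev_ordK //; by rewrite eq_sym.
Qed.

(** One + and one - disappear at lo and hi, and again at their negatives, so each sign loses two
    positions. *)
Lemma flip_clan_counts c i c' : (forall x s, (c (rev_ord x) == inl s) = (c x == inl s)) ->
  n <= lo i -> opposite_signs (c (lo i)) (c (hi i)) -> flip_step i c c' ->
  sign_counts p q c -> sign_counts p q c'.
Proof.
move=> Hs nlo [s0 [El Eh]] [m [m' [_ _ _ ->]]].
have [D1 D2 D3 D4] := lo_hi_disjoint nlo.
pose e s := if s == s0 then lo i else hi i.
have lh := lo_neq_hi i.
have H s : #|[set x | c x == inl s]%SET| = #|[set x | flip_clan c i m m' x == inl s]%SET| + 2.
  have -> : [set x | c x == inl s]%SET =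
      [set e s; rev_ord (e s)]%SET :|: [set x | flip_clan c i m m' x == inl s]%SET.
    have Hc : (c (lo i) == inl s) = (s == s0) /\ (c (hi i) == inl s) = (s != s0).
      by rewrite El Eh; case: s s0 {El Eh e} => [] [].
    case: Hc => H1 H2; apply/setP => x; rewrite !inE ffunE !inE.
    have [->|x1] := eqVneq x (lo i).
      by rewrite H1 /e; case: ifP => _; rewrite ?eqxx // (negPf lh) (negPf D2).
    have [->|x2] := eqVneq x (hi i).
      by rewrite H2 /e; case: ifP => _; rewrite ?eqxx //= (negPf D3) eq_sym (negPf lh).
    have [->|x3] := eqVneq x (rev_ord (lo i)).
      rewrite Hs H1 /e; case: ifP => _; rewrite ?eqxx ?orbT //= orbF.
      by rewrite (inj_eq rev_ord_inj) (negPf lh) eq_sym (negPf D3).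
    have [->|x4] := eqVneq x (rev_ord (hi i)).
      rewrite Hs H2 /e; case: ifP => _; rewrite ?eqxx ?orbT //= orbF.
      by rewrite (inj_eq rev_ord_inj) [hi i == _]eq_sym (negPf lh) eq_sym (negPf D2).
    by rewrite /e; case: ifP => _; rewrite ?(negPf x1) ?(negPf x2) ?(negPf x3) ?(negPf x4).
  rewrite cardsU cards2 (_ : _ :&: _ = set0).
    by rewrite cards0 subn0 addnC; congr (_ + _); rewrite /e; case: ifP => _; rewrite ?D1 ?D4.
  apply/setP => x; rewrite !inE ffunE !inE /e.
  by case: ifP => _; apply/negP => /andP[/orP[] /eqP ->]; rewrite !eqxx ?orbT //;
    case: ifP.
rewrite /sign_counts !H; set a := #|_|; set b := #|_|; clear; lia.
Qed.

Lemma clan_step_orbit c c' i : orbit_clan p q c -> clan_step i c c' ->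
  orbit_clan p q c' /\
  iota_clan c' = (if n <= lo i then if is_sign (c (lo i)) && is_sign (c (hi i)) then
     tgen i * iota_clan c else tgen i * (iota_clan c * tgen i)
     else tgen i * (iota_clan c * tgen i))%g.
Proof.
move=> /orbit_clanP[HN Hc Hy]; set y := iota_clan c in Hy *.
case=> [[Ha H1 H2 ->]|[nlo Hop' Hf]].
  have Hy' := sym_clan_conj i Hy; have Ei := iota_invol (sy_invol Hy').
  have -> : is_sign (c (lo i)) && is_sign (c (hi i)) = false.
    rewrite !(cl_sign (sy_invol Hy)); apply/negP => /andP[/eqP E1 /eqP E2].
    by case: H2; rewrite ?E1 ?E2 eqxx.
  rewrite Ei; split; last by case: ifP.
  by apply/orbit_clanP; rewrite Ei; split=> //; apply: sign_counts_comp.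
have [s [El Eh]] := Hop'.
have Sl : is_sign (c (lo i)) by rewrite El.
have Sh : is_sign (c (hi i)) by rewrite Eh.
have Hy' := flip_clan_sym Hy nlo Sl Sh Hf.
have Ei := iota_invol (sy_invol Hy').
rewrite nlo Sl Sh Ei; split=> //; apply/orbit_clanP; rewrite Ei; split=> //.
by apply: (flip_clan_counts (sy_sign Hy) nlo Hop' Hf).
Qed.

Lemma val0_lo i : (val i == 0) = ~~ (n <= lo i).
Proof. by rewrite val_lo; have := ltn_ord i; case: i => [[|m] Hm] /=; lia. Qed.

Lemma lo_pos i : val i != 0 -> pos (ord_pred i) = lo i.
Proof. by rewrite /lo => /negPf ->. Qed.

Lemma rev_lo_hi i : ~~ (n <= lo i) -> lo i = rev_ord (hi i).
Proof.
move=> H; apply: ord_inj; move: H; rewrite val_rev val_lo val_hi.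
by have := ltn_ord i; lia.
Qed.

Lemma clan_rule_i c c' i : (val i == 0 -> ~~ is_sign (c (hi i))) ->
  ~~ (is_sign (c (lo i)) && is_sign (c (hi i))) ->
  rule_i p q op i c c' -> clan_rule p q op i c c'.
Proof.
move=> H0 H1 H2; rewrite /clan_rule; case: ifP => Hi0; first by rewrite (negPf (H0 Hi0)).
by rewrite lo_pos ?Hi0 // (negPf H1).
Qed.

Lemma sign_lo_hi c y i : sym_clan c y -> val i == 0 ->
  is_sign (c (lo i)) = is_sign (c (hi i)).
Proof. by move=> Hy; rewrite val0_lo => /rev_lo_hi ->; rewrite (sym_clan_rev _ Hy). Qed.

Lemma clan_step_act c c' i : orbit_clan p q c -> clan_step i c c' ->
  clan_act p q op i c c'.
Proof.
move=> Hc Hst; have /orbit_clanP[HN Hs Hy] := Hc; set y := iota_clan c in Hy.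
have [Hi Wy Hsig Hn] := Hy; have [Hc' Ei] := clan_step_orbit Hc Hst.
exists c'; last by case: Hc' => _ _ ->; rewrite eqxx.
case: Hst => [[Ha H1 H2 Ec']|[nlo [s [El Eh]] [m [m' [mm' fm fm' Ec']]]]]; last first.
  have Hi0 : val i != 0 by rewrite val0_lo negbK.
  rewrite /clan_rule (negPf Hi0) lo_pos // -/(hi i) El Eh /= ifN; last by case: s {El Eh}.
  exists m, m'; split=> //; rewrite Ec'; apply/ffunP => x; rewrite !ffunE lo_pos //.
  by rewrite /neg -/(hi i) lo_pos.
have Hsg : ~~ (is_sign (c (lo i)) && is_sign (c (hi i))).
  by rewrite !(cl_sign Hi) negb_and; apply/orP.
apply: clan_rule_i => //; first by move=> /(sign_lo_hi Hy) E; move: Hsg; rewrite E andbb.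
case: Hc' => K1 K2 K3; split=> //.
  rewrite Ei (negPf Hsg) if_same.
  case: (actP Hop i Wy (cl_inv Hi)) => [[/negP[]]|[_ E1 E2 _]|[_ E1 _ _]|[_ _ _ _ E3]] //.
  - by case: H2; rewrite ?E1 ?E2 eqxx.
  - by rewrite -/y E1 eqxx in H1.
rewrite Ec'; apply: (signs_transport (f := tgen i)); first by move=> x; rewrite ffunE.
  by exists (tgen i); exact: tgenK.
(* t reverses only the pair lo, hi and its negative, and lo and hi do not both carry signs. *)
move=> x x'; rewrite !ffunE => Sx Sx' xx'; rewrite ltnNge; apply/negP => Hle.
have := tgen_lt (i := i) (x := tgen i x') (y := tgen i x).
have Hlt : tgen i x' < tgen i x.
  by rewrite ltn_neqAle Hle andbT; apply/eqP => /ord_inj/perm_inj E; rewrite E ltnn in xx'.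
rewrite !tgenK -leqNgt (ltnW xx') => /(_ Hlt isT).
case=> -[Ex' Ex]; move: Sx Sx'; rewrite Ex Ex'.
  by move=> S1 S2; move: Hsg; rewrite S1 S2.
by rewrite !(sym_clan_rev _ Hy) => S1 S2; move: Hsg; rewrite S1 S2.
Qed.

(** Needed to turn edges of the orbit graph into moves: since the dense orbit in a saturation is
    unique, one representative of t_i . c for each i is enough. *)
Lemma clan_act_step c i : orbit_clan p q c -> exists c',
  clan_act p q op i c c' /\ (c' = c \/ clan_step i c c').
Proof.
move=> Hc; have /orbit_clanP[HN Hs Hy] := Hc; set y := iota_clan c in Hy.
have [Hi Wy Hsig Hn] := Hy.
have WyE := inWnP _ Wy.
have Nc : Neg c = set0 by case: Hc.
have [C1 C2 _] := Hc.
have self : clan_rule p q op i c c -> exists c',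
    clan_act p q op i c c' /\ (c' = c \/ clan_step i c c').
  by move=> H; exists c; split; [exists c => //; rewrite Nc eqxx|left].
have sign0 := sign_lo_hi (i := i) Hy.
case: (boolP (is_sign (c (lo i)) && is_sign (c (hi i)))) => Hsg.
  have [Sl Sh] := andP Hsg.
  have [Hi0|Hi0] := boolP (val i == 0).
    by apply: self; rewrite /clan_rule Hi0 Sh.
  have [E|E] := eqVneq (c (lo i)) (c (hi i)).
    by apply: self; rewrite /clan_rule (negPf Hi0) lo_pos // Hsg E eqxx.
  have nlo : n <= lo i by rewrite val0_lo negbK in Hi0.
  have [m [m' [mm' fm fm']]] := fresh_labels c.
  exists (flip_clan c i m m').
  have Hf : flip_step i c (flip_clan c i m m') by exists m, m'.
  have Hst : clan_step i c (flip_clan c i m m').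
    right; split=> //; move/is_signP: Sl => [s1 E1]; move/is_signP: Sh => [s2 E2].
    by exists s1; rewrite E1 E2; split=> //; move: E; rewrite E1 E2; case: s1 s2 {E1 E2} => [] [].
  by split; [exact: clan_step_act|right].
have H0 : val i == 0 -> ~~ is_sign (c (hi i)).
  by move=> /sign0 E; move: Hsg; rewrite E andbb.
have Hboth : y (lo i) != lo i \/ y (hi i) != hi i.
  by apply/orP; rewrite -negb_and -!(cl_sign Hi).
case: (actP Hop i Wy (cl_inv Hi)) => [[_ Ea]|[_ E1 E2 _]|[Ha E1 E2 E3]|[Ha E1 _ Ha' E3]].
- by apply: self; apply: clan_rule_i => //; split.
- by case: Hboth; rewrite ?E1 ?E2 eqxx.
- have nlo : n <= lo i.
    apply: contraT => /rev_lo_hi E; case: Hboth; last by rewrite E2 E rev_ordK eqxx.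
    by rewrite E1 E eqxx.
  have [D1 D2 D3 D4] := lo_hi_disjoint nlo.
  (* Conjugation by this single transposition, without its mirror image, realises t y: it matches lo
     with -lo and hi with -hi. Hence [Neg] is nonempty and the action keeps c. *)
  pose f := tperm (lo i) (hi i).
  have fK : involutive f by move=> x; rewrite tpermK.
  have Ef : (f * (y * f))%g = (tgen i * y)%g.
    have nz x x' : x != x' -> y x != y x' by rewrite (inj_eq perm_inj).
    apply/permP => x; rewrite !permM /f.
    have [->|x1] := eqVneq x (hi i).
      by rewrite tpermR tgen_hi E1 tpermD.
    have [->|x2] := eqVneq x (lo i).
      by rewrite tpermL tgen_lo E2 tpermD.
    rewrite (tpermD (z := x)) 1?eq_sym //.
    have [->|x3] := eqVneq x (rev_ord (hi i)).
      by rewrite WyE E2 rev_ordK tpermL tgen_rev tgen_hi WyE E1 rev_ordK.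
    have [->|x4] := eqVneq x (rev_ord (lo i)).
      by rewrite WyE E1 rev_ordK tpermR tgen_rev tgen_lo WyE E2 rev_ordK.
    rewrite tgenE (negPf x1) (negPf x2) (negPf x3) (negPf x4) tpermD //.
      by rewrite -[lo i]rev_ordK -E2 -WyE eq_sym nz.
    by rewrite -[hi i]rev_ordK -E1 -WyE eq_sym nz.
  have Hc' := clan_invol_comp fK Hi; rewrite Ef in Hc'.
  have Ei := iota_invol Hc'.
  have Il : ~~ is_sign (c (lo i)) by rewrite (cl_sign Hi) E1 eq_sym.
  have Ih : ~~ is_sign (c (hi i)) by rewrite (cl_sign Hi) E2 eq_sym.
  have Ff x : is_sign (c (f x)) -> f x = x.
    rewrite /f; case: tpermP => // ->; first by rewrite (negPf Ih).
    by rewrite (negPf Il).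
  have cf x s : (comp_clan c f x == inl s) = (c x == inl s).
    rewrite ffunE; apply/eqP/eqP => E; last first.
      rewrite /f tpermD // eq_sym; apply/eqP => Ex; [move: Il|move: Ih]; by rewrite -Ex E.
    by rewrite -{1}(@Ff x) ?E.
  exists c; split; last by left.
  exists (comp_clan c f); last first.
    case: eqP => // N'; exfalso.
    have : i \in Neg (comp_clan c f).
      rewrite inE !ffunE -/(hi i) /f tpermR (tpermD (z := neg i) D2 D4).
      rewrite -[c (neg i)](cl_fix _ Hi) -[neg i]/(rev_ord (hi i)) WyE E2 rev_ordK eqxx andbT.
      by move: Il; rewrite /is_sign negbK.
    by rewrite N' inE.
  apply: clan_rule_i => //; split; last first.
  + apply: (signs_transport (f := f)); first by move=> x; rewrite ffunE.
      by exists f.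
    by move=> x x'; rewrite !ffunE => /Ff -> /Ff ->.
  + by rewrite Ei -E3 /y.
  + split=> [x s|x x'].
      rewrite [X in _ <-> X = _]ffunE.
      by split=> /eqP H; apply/eqP; move: H; rewrite !cf Hsig.
    have -> : matched [ffun i0 => comp_clan c f (rev_ord i0)] x x' =
        matched (comp_clan c f) (rev_ord x) (rev_ord x').
      by rewrite /matched !(ffunE _ x, ffunE _ x') (inj_eq rev_ord_inj).
    rewrite !(matched_invol _ _ Hc') (inj_eq rev_ord_inj).
    have /inWnP -> : (tgen i * y)%g \in Wn n by rewrite Wn_mul ?tgen_Wn.
    by rewrite (inj_eq rev_ord_inj).
  + split=> //; first by move=> j Ij; rewrite (matched_invol_card Hc').
    by apply: sign_counts_comp.
- have Hst : clan_step i c (comp_clan c (tgen i)) by left; split.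
  exists (comp_clan c (tgen i)); split; [exact: clan_step_act|by right].
Qed.

End ClanSteps.

(** * Paths of clans *)

Section ClanPaths.
Variables (n p q k : nat).
Local Notation N := (n + n).
Implicit Types (c : {ffun 'I_N -> symbol}) (y z v : 'S_N) (i : 'I_n) (x : 'I_N).
Variable op : 'S_N -> 'S_N -> 'S_N.
Hypothesis Hop : is_demazure op.
Local Notation good := (orbit_clan p q).
Local Notation zc c := (opp_perm (iota_clan c)).

Lemma opp_permE y x : opp_perm y x = rev_ord (y x).
Proof. by rewrite permM permE. Qed.

Lemma opp_perm_inj : injective (@opp_perm n).
Proof.
by move=> y y' E; apply/permP => x; apply: rev_ord_inj; rewrite -!opp_permE E.
Qed.

Lemma opp_perm_fpf c : good c -> fpf_inv (zc c).
Proof.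
move=> /orbit_clanP[_ _ [Hi W _ Hn]]; have HW := inWnP _ W; split.
- by apply/inWnP => x; rewrite !opp_permE HW.
- by move=> x; rewrite !opp_permE HW (cl_inv Hi) rev_ordK.
- by move=> x; rewrite opp_permE -(inj_eq rev_ord_inj) rev_ordK Hn.
Qed.

Lemma negated_opp c x : good c -> (x \in negated (zc c)) = is_sign (c x).
Proof.
move=> /orbit_clanP[_ _ [Hi _ _ _]].
by rewrite inE opp_permE (inj_eq rev_ord_inj) (cl_sign Hi).
Qed.

(** Negation reverses the order, so a move up from c is a step of [act] from the z of the new clan
    back to that of c. Conjugations correspond to conjugations, and matchings of signs to commuting
    steps. *)
Lemma clan_step_opp c c1 i : good c -> clan_step i c c1 ->
  [/\ good c1, act op i (zc c1) = zc c & zc c1 != zc c] /\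
  ((asc i (zc c1) /\ [/\ zc c1 (lo i) != rev_ord (hi i), c1 = comp_clan c (tgen i) &
      zc c = (tgen i * (zc c1 * tgen i))%g]) \/
   [/\ asc i (zc c1), zc c1 (lo i) = rev_ord (hi i), zc c1 (hi i) = rev_ord (lo i), n <= lo i &
     [/\ opposite_signs (c (lo i)) (c (hi i)), flip_step i c c1 & zc c = (tgen i * zc c1)%g]]).
Proof.
move=> Hc Hst; have [Hc1 Ei] := clan_step_orbit Hc Hst.
have Hz1 := opp_perm_fpf Hc1; have [Wz1 Iz1 Fz1] := Hz1.
have /orbit_clanP[_ _ Hy] := Hc; have [Hi W Hsig Hn] := Hy.
have HW := inWnP _ W.
set y := iota_clan c in Ei Hi W HW Hn Hy.
case: (Hst) => [[Ha H1 H2 Ec1]|[nlo Hopp Hf]].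
  have Ey1 : iota_clan c1 = (tgen i * (y * tgen i))%g.
    rewrite Ei; case: ifP => // _; case: ifP => // /andP[S1 S2]; exfalso.
    by case: H2; rewrite -(cl_sign Hi) ?S1 ?S2.
  have Ez1 x : zc c1 x = tgen i (rev_ord (y (tgen i x))).
    by rewrite opp_permE Ey1 !permM tgen_rev.
  have Ezc : zc c = (tgen i * (zc c1 * tgen i))%g.
    by apply/permP => x; rewrite opp_permE permM permM Ez1 !tgenK.
  have Hyy : asc i (y * tgen i)%g.
    apply: contraT; rewrite /asc !permM => /(tgen_lt Ha) [[E1 E2]|[E1 _]].
      by case: H2; rewrite ?E1 ?E2 eqxx.
    by rewrite -/y E1 eqxx in H1.
  have Ha1 : asc i (zc c1).
    move: Hyy; rewrite /asc !Ez1 !permM tgen_lo tgen_hi !tgen_rev !val_rev.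
    by have := ltn_ord (tgen i (y (hi i))); have := ltn_ord (tgen i (y (lo i))); lia.
  have N1 : zc c1 (lo i) != rev_ord (hi i).
    rewrite Ez1 tgen_lo tgen_rev (inj_eq rev_ord_inj); apply/eqP => /(congr1 (tgen i)).
    rewrite tgenK tgen_hi => E; have E' : y (lo i) = hi i by rewrite -E (cl_inv Hi).
    by move: Ha; rewrite /asc -/y E E' val_lo val_hi; lia.
  have Ea : act op i (zc c1) = zc c.
    case: (act_fpf_cases Hop i Hz1) => [[]|[_ E]|[_ _ _ ->]] //; first by rewrite Ha1.
    by rewrite E eqxx in N1.
  split; last by left; split=> //; split.
  split=> //; apply/eqP => E.
  have : asc i (zc c1) by [].
  rewrite E /asc !opp_permE !val_rev -/y; move: Ha; rewrite /asc -/y.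
  by have := ltn_ord (y (hi i)); lia.
have [s [El Eh]] := Hopp.
have Sl : is_sign (c (lo i)) by rewrite El.
have Sh : is_sign (c (hi i)) by rewrite Eh.
have Yl : y (lo i) = lo i by apply/eqP; rewrite -(cl_sign Hi).
have Yh : y (hi i) = hi i by apply/eqP; rewrite -(cl_sign Hi).
have Ey1 : iota_clan c1 = (tgen i * y)%g.
  by rewrite Ei nlo Sl Sh.
have Ez1 x : zc c1 x = rev_ord (y (tgen i x)) by rewrite opp_permE Ey1 permM.
have Ezc : zc c = (tgen i * zc c1)%g.
  by apply/permP => x; rewrite opp_permE permM Ez1 tgenK.
have Z1 : zc c1 (lo i) = rev_ord (hi i) by rewrite Ez1 tgen_lo Yh.
have Z2 : zc c1 (hi i) = rev_ord (lo i) by rewrite Ez1 tgen_hi Yl.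
have Ha1 : asc i (zc c1).
  by rewrite /asc Z1 Z2 !val_rev val_lo val_hi; have := ltn_ord i; lia.
have Ea : act op i (zc c1) = zc c.
  case: (act_fpf_cases Hop i Hz1) => [[]|[_ _ _ [_ ->]]|[_ E]] //; first by rewrite Ha1.
  by rewrite Z1 eqxx in E.
split; last by right; split.
split=> //; apply/eqP => E; move: Z1; rewrite E opp_permE -/y Yl => /rev_ord_inj /eqP.
by rewrite (negPf (lo_neq_hi i)).
Qed.

(** The sign condition of [NCSP], stated on letters instead of blocks so that it can be carried
    along a chain. *)
Definition compat c v := forall x, is_sign (c (v x)) -> v (mate k x) != rev_ord (v x) ->
  opposite_signs (c (v x)) (c (v (mate k x))).

Lemma opposite_sym a b : opposite_signs a b -> opposite_signs b a.
Proof. by case=> s [-> ->]; exists (~~ s); rewrite negbK. Qed.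

Lemma flip_step_sign c c1 i x : flip_step i c c1 -> is_sign (c1 x) -> c1 x = c x.
Proof.
by move=> [m [m' [_ _ _ ->]]]; rewrite ffunE; do 2 case: ifP => // _.
Qed.

Lemma opposite_rev c x x' : good c -> opposite_signs (c x) (c x') ->
  opposite_signs (c (rev_ord x)) (c (rev_ord x')).
Proof.
move=> /orbit_clanP[_ _ [_ _ Hs _]] [s [/eqP E1 /eqP E2]].
by exists s; split; apply/eqP; rewrite Hs.
Qed.

Hypotheses (kn : k <= n) (nk : ~~ odd (n - k)).

(** Old blocks keep their signs, moved along with their positions; the blocks that a commuting step
    creates consist of the opposite signs that the move had matched. *)
Lemma compat_step c c1 i v : good c -> clan_step i c c1 -> chain_inv k (zc c1) v ->
  compat c1 v -> compat c (v * tgen i)%g.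
Proof.
move=> Hc Hst Hv Hcomp; have [[Hc1 _ _] Hcase] := clan_step_opp Hc Hst.
have Hz1 := opp_perm_fpf Hc1.
case: Hcase => [[Ha [H1 Ec1 Ez]]|[Ha E1 E2 nlo [Hopp Hf Ez]]] x.
  rewrite !permM -tgen_rev (inj_eq perm_inj) => Sx Hx.
  have Ec u : c (tgen i u) = c1 u by rewrite Ec1 ffunE.
  by rewrite !Ec in Sx *; apply: Hcomp.
rewrite -(negated_opp _ Hc) Ez => Nx Hx.
case: (mate_comm kn nk Hz1 Hv E1 E2 Nx) => [[Nv Ex Em]|H].
  have Nm := mate_negated kn nk Hz1 Hv Nv.
  have S1 := Nv; have S2 := Nm; rewrite !negated_opp // in S1 S2.
  rewrite Ex Em -(flip_step_sign Hf S1) -(flip_step_sign Hf S2).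
  by apply: Hcomp => //; rewrite -Ex -Em.
case: H => -[-> ->] //; first exact: opposite_sym.
  exact: opposite_rev.
by apply: opposite_rev => //; exact: opposite_sym.
Qed.

(** A clan can follow every conjugating step. A commuting step makes {lo, hi} a block, and
    compatibility at this block supplies the opposite signs that the matching requires. *)
Lemma clan_step_exists c i z1 v : good c -> fpf_inv z1 -> chain_inv k z1 v ->
  act op i z1 = zc c -> act op i z1 != z1 -> compat c (v * tgen i)%g ->
  exists c1, [/\ clan_step i c c1, zc c1 = z1 & compat c1 v].
Proof.
move=> Hc Hz1 Hv Ea Ne Hcomp; have [Wz1 Iz1 Fz1] := Hz1.
have /orbit_clanP[_ _ Hy] := Hc; have [Hi W Hsig Hn] := Hy.
have HW := inWnP _ W.
case: (act_fpf_cases Hop i Hz1) => [[_ E]|[Ha E1 E2 [nlo E]]|[Ha E1 Ha' E]].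
- by rewrite E eqxx in Ne.
- have nE : forall x, x \in negated (tgen i * z1)%g -> is_sign (c x).
    by move=> x; rewrite -E Ea negated_opp.
  have vK u : v (v^-1 u)%g = u by rewrite permKV.
  (* x is the place whose letter becomes hi; its mate then carries lo. *)
  pose x := (v^-1 (lo i))%g.
  have Ex : (v * tgen i)%g x = hi i by rewrite permM vK tgen_lo.
  have Nhi : hi i \in negated (tgen i * z1)%g by rewrite inE permM tgen_hi E1.
  have [D1 D2 D3 D4] := lo_hi_disjoint nlo.
  have Em : (v * tgen i)%g (mate k x) = lo i.
    have Nx : (v * tgen i)%g x \in negated (tgen i * z1)%g by rewrite Ex.
    case: (mate_comm kn nk Hz1 Hv E1 E2 Nx) => [[]|[] [] //].
    + by rewrite vK inE E1 (inj_eq rev_ord_inj) eq_sym (negPf (lo_neq_hi i)).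
    + by rewrite Ex => /eqP; rewrite eq_sym (negPf (lo_neq_hi i)).
    + by rewrite Ex => /eqP; rewrite (negPf D3).
    + by rewrite Ex => /eqP; rewrite (negPf D4).
  have Hopp : opposite_signs (c (lo i)) (c (hi i)).
    apply: opposite_sym; have := Hcomp x; rewrite Ex Em; apply; first exact: nE.
    by [].
  have [m [m' [mm' fm fm']]] := fresh_labels c.
  have Hf : flip_step i c (flip_clan c i m m') by exists m, m'.
  have Hst : clan_step i c (flip_clan c i m m') by right; split.
  have [[Hc1 Ea1 _] _] := clan_step_opp Hc Hst.
  have Ez : zc (flip_clan c i m m') = z1.
    have := clan_step_opp Hc Hst; case=> _ [[_ [_ E3 _]]|[_ _ _ _ [_ _ E3]]].
      have : is_sign (flip_clan c i m m' (hi i)).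
        by rewrite E3 ffunE tgen_hi; case: Hopp => s [-> _].
      by rewrite ffunE !inE eqxx orbT.
    by move: E3; rewrite -Ea E => /mulgI.
  exists (flip_clan c i m m'); split=> // x0 Sx0 Hx0.
  have Nx0 : v x0 \in negated z1 by rewrite -Ez negated_opp.
  have Nm0 := mate_negated kn nk Hz1 Hv Nx0.
  have Sm0 : is_sign (flip_clan c i m m' (v (mate k x0))).
    by rewrite -negated_opp // Ez.
  rewrite (flip_step_sign Hf Sx0) (flip_step_sign Hf Sm0).
  have := Hcomp x0; rewrite !permM !(tgen_negated_comm Hz1 E1 E2) //; apply=> //.
  by rewrite -(flip_step_sign Hf Sx0).
- have Ey x : rev_ord (iota_clan c x) = tgen i (z1 (tgen i x)).
    by rewrite -opp_permE -Ea E !permM.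
  have Hst : clan_step i c (comp_clan c (tgen i)).
    have Yl : iota_clan c (lo i) = rev_ord (tgen i (z1 (hi i))).
      by apply: rev_ord_inj; rewrite Ey tgen_lo rev_ordK.
    have Yh : iota_clan c (hi i) = rev_ord (tgen i (z1 (lo i))).
      by apply: rev_ord_inj; rewrite Ey tgen_hi rev_ordK.
    left; split=> //.
    + move: Ha'; rewrite /asc !permM Yl Yh !val_rev.
      by have := ltn_ord (tgen i (z1 (hi i))); have := ltn_ord (tgen i (z1 (lo i))); lia.
    + rewrite Yl (inj_eq rev_ord_inj); apply/eqP => /(congr1 (tgen i)).
      rewrite tgenK tgen_hi => E3.
      have E4 : z1 (lo i) = hi i by rewrite -E3 Iz1.
      by move: Ha; rewrite /asc E3 E4 val_lo val_hi; lia.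
    + have [El|] := eqVneq (iota_clan c (lo i)) (lo i); last by left.
      right; apply/eqP => Eh; apply: (asc_negated Ha); rewrite !inE.
      have := congr1 (tgen i) (congr1 (@rev_ord _) Yh).
      have := congr1 (tgen i) (congr1 (@rev_ord _) Yl).
      by rewrite !rev_ordK !tgenK El Eh !tgen_rev tgen_lo tgen_hi => <- <-.
  have [_ [[_ [_ _ Ez]]|[_ _ _ _ [_ [m [m' [_ _ _ E3]]] _]]]] := clan_step_opp Hc Hst; last first.
    (* A matching would give c(lo) and c(hi) the same integer, so the involution of c would exchange
       lo and hi, whence z1(lo) = -hi. *)
    exfalso; case: Hst => [[_ _ H _]|[_ [s [Hs1 Hs2]] _]].
      have := congr1 (fun c0 : {ffun 'I_N -> symbol} => c0 (lo i)) E3.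
      rewrite !ffunE !inE eqxx tgen_lo /= => Ehi.
      have := congr1 (fun c0 : {ffun 'I_N -> symbol} => c0 (hi i)) E3.
      rewrite !ffunE !inE eqxx orbT tgen_hi /= => Elo.
      have /eqP := Elo; rewrite -Ehi (cl_eq Hi) ?Ehi // (negPf (lo_neq_hi i)) /=.
      move=> /eqP E4; have E5 : iota_clan c (lo i) = hi i by rewrite E4 (cl_inv Hi).
      have := Ey (lo i); rewrite tgen_lo E5 => /(congr1 (tgen i)).
      rewrite tgenK tgen_rev tgen_hi => E6; case/eqP: E1.
      by apply: (@perm_inj _ z1); rewrite Iz1 (inWnP _ Wz1) -E6 rev_ordK.
    have := congr1 (fun c0 : {ffun 'I_N -> symbol} => c0 (lo i)) E3.
    by rewrite !ffunE !inE eqxx tgen_lo Hs2.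
  exists (comp_clan c (tgen i)); split=> //.
    have : (tgen i * (zc (comp_clan c (tgen i)) * tgen i))%g = (tgen i * (z1 * tgen i))%g.
      by rewrite -Ez -Ea E.
    by move/mulgI/mulIg.
  move=> x; rewrite !ffunE => Sx Hx.
  by have := Hcomp x; rewrite !permM -tgen_rev (inj_eq perm_inj); apply.
Qed.

Fixpoint clan_path c (s : seq 'I_n) c' : Prop :=
  if s is i :: s' then exists2 c1, clan_step i c c1 & clan_path c1 s' c' else c' = c.

Lemma clan_path_chain c s c' : good c -> clan_path c s c' -> zc c' = yFPF n k ->
  [/\ strict op s (yFPF n k), foldr (act op) (yFPF n k) s = zc c &
    compat c (\prod_(i <- s) tgen i)^-1%g].
Proof.
elim: s c => [|i s IH] c Hc /=.
  (* At the end of the path all blocks are trivial, so compatibility is vacuous. *)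
  move=> -> Ez; split=> //; rewrite big_nil invg1 => x; rewrite !perm1.
  by rewrite -negated_opp // Ez inE /mate => /eqP ->; rewrite eqxx eqxx.
move=> [c1 Hst Hp] Ez; have [[Hc1 Ea Ne] _] := clan_step_opp Hc Hst.
have [Hs Ef Hcomp] := IH c1 Hc1 Hp Ez.
have Hv := strict_chain_inv kn nk Hop Hs; rewrite Ef in Hv.
split; first by rewrite Hs Ef Ea eq_sym.
  by rewrite Ef.
rewrite big_cons invMg tgenV; exact: compat_step Hst Hv Hcomp.
Qed.

Lemma chain_clan_path c s : good c -> strict op s (yFPF n k) ->
  foldr (act op) (yFPF n k) s = zc c -> compat c (\prod_(i <- s) tgen i)^-1%g ->
  exists c', [/\ clan_path c s c', good c' & zc c' = yFPF n k].
Proof.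
elim: s c => [|i s IH] c Hc /=; first by move=> _ E _; exists c; split.
case/andP=> Hs Ne Ea; rewrite big_cons invMg tgenV => Hcomp.
have Hv := strict_chain_inv kn nk Hop Hs.
have Hz := fpf_foldr Hop s (yFPF_fpf kn nk).
have [c1 [Hst Ez Hc1]] := clan_step_exists Hc Hz Hv Ea Ne Hcomp.
have [[Gc1 _ _] _] := clan_step_opp Hc Hst.
have [c' [Hp Hc' Ez']] := IH c1 Gc1 Hs (esym Ez) Hc1.
by exists c'; split=> //; exists c1.
Qed.

End ClanPaths.

(** * Noncrossing matchings *)

Lemma set2_inj (T : finType) (a b x y : T) : a != b -> [set a; b] = [set x; y] ->
  (a = x /\ b = y) \/ (a = y /\ b = x).
Proof.
move=> ab E; have := set21 a b; have := set22 a b; rewrite E !inE.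
by move=> /orP[] /eqP Eb /orP[] /eqP Ea; subst; rewrite ?eqxx in ab; auto.
Qed.

Section Matchings.
Variables (n p q k : nat).
Local Notation N := (n + n).
Implicit Types (c : {ffun 'I_N -> symbol}) (y z v : 'S_N) (i : 'I_n) (x : 'I_N).
Hypotheses (kn : k <= n) (nk : ~~ odd (n - k)).
Local Notation good := (orbit_clan p q).
Local Notation zc c := (opp_perm (iota_clan c)).

Lemma negated_yFPF x : (x \in negated (yFPF n k)) = (n - k <= x < n + k).
Proof.
have [Wy _ _] := yFPF_fpf kn nk; rewrite inE.
have H m : (yFPF n k (pos m) == rev_ord (pos m)) = (m < k).
  case: (ltnP m k) => mk; first by rewrite yFPF_lt // eqxx.
  apply/eqP => /(congr1 (@nat_of_ord _)); rewrite yFPF_ge // val_rev val_pos.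
  by have := ltn_ord m; lia.
have [m [->|->]] := pos_or_neg x; rewrite ?(inWnP _ Wy) ?(inj_eq rev_ord_inj) H ?val_rev val_pos;
  have := ltn_ord m; lia.
Qed.

Lemma mate_eq_rev x : (mate k x == rev_ord x) = (x \in negated (yFPF n k)).
Proof.
have [_ _ Fy] := yFPF_fpf kn nk.
by rewrite /mate inE; case: ifP; rewrite ?eqxx // (inj_eq rev_ord_inj) (negPf (Fy x)).
Qed.

Lemma mate_neq x : mate k x != x.
Proof.
rewrite /mate; case: ifP => [_|/negbT H]; first exact: rev_neq.
by rewrite -(inj_eq rev_ord_inj) rev_ordK.
Qed.

Section BlockMatching.
Variables (c : {ffun 'I_N -> symbol}) (v : 'S_N).
Hypotheses (Hc : good c) (Hv : chain_inv k (zc c) v).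
Let Hz := opp_perm_fpf Hc.
Let HvW := inWnP _ (ci_W Hv).
Let M := blocks k (zc c) v.

Let block_of x : [set v x; v (mate k x)] \in M = is_sign (c (v x)).
Proof.
apply/imsetP/idP => [[x']|Hx]; last by exists x => //; rewrite inE (negated_opp _ Hc).
rewrite inE => Nx' E; have Nm := mate_negated kn nk Hz Hv Nx'.
rewrite -(negated_opp _ Hc).
by have := set21 (v x) (v (mate k x)); rewrite E in_set2 => /orP[] /eqP ->.
Qed.

Let block_inv (i j : 'I_N) : [set i; j] \in M -> i != j ->
  exists x, [/\ v x = i, v (mate k x) = j, v x \in negated (zc c) &
    v (mate k x) \in negated (zc c)].
Proof.
move=> /imsetP[x]; rewrite inE => Nx E ij; have Nm := mate_negated kn nk Hz Hv Nx.
case: (set2_inj ij E) => -[-> ->]; first by exists x.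
by exists (mate k x); rewrite mateK.
Qed.

Lemma blocks_NCSP : compat k c v -> NCSP k c (blocks k (zc c) v).
Proof.
move=> Hcomp; rewrite /NCSP /classical_sets.mkset -/M; split.
- apply/andP; split; last first.
    apply/forallP => B; apply/implyP => /imsetP[x _ ->].
    by rewrite cards2 (inj_eq perm_inj) [x == _]eq_sym mate_neq.
  apply/and3P; split.
  + apply/eqP/setP => u; rewrite inE; apply/bigcupP/idP => [[B /imsetP[x]]|Su].
      rewrite inE => Nx ->; have Nm := mate_negated kn nk Hz Hv Nx.
      by rewrite -(negated_opp _ Hc) in_set2 => /orP[] /eqP ->.
    exists [set v (v^-1 u)%g; v (mate k (v^-1 u)%g)]; last by rewrite permKV set21.
    by rewrite block_of permKV.
  + apply/trivIsetP => A B /imsetP[x Nx ->] /imsetP[x' Nx' ->] Ne.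
    rewrite disjoint_subset; apply/subsetP => u; rewrite !inE => Hu.
    apply: contraNN Ne => Hu'; apply/eqP.
    (* A block is determined by any of its elements u: it joins u to the letter at the mate of the
       place of u. *)
    have key x0 : u = v x0 \/ u = v (mate k x0) ->
        [set v x0; v (mate k x0)] = [set u; v (mate k (v^-1 u)%g)].
      case=> ->; rewrite permK ?mateK //; exact: setUC.
    by rewrite !key //; [case/orP: Hu'|case/orP: Hu] => /eqP; auto.
  + apply/imsetP => -[x _ E]; have := set21 (v x) (v (mate k x)).
    by rewrite -E inE.
- apply/forallP => B; apply/implyP => /imsetP[x]; rewrite inE => Nx ->.
  have -> : [set rev_ord x0 | x0 in [set v x; v (mate k x)]] =
      [set v (rev_ord x); v (mate k (rev_ord x))].
    by rewrite imsetU1 imset_set1 mate_rev !HvW.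
  by rewrite block_of HvW -(negated_opp _ Hc) negated_rev.
- move=> i j k' l H1 H2 [ij [jk kl]].
  have [x [E1 E2 Nx _]] := block_inv H1 (ltac:(by apply/eqP => E; move: ij jk; rewrite E; lia)).
  have [x' [E3 E4 Nx' _]] := block_inv H2 (ltac:(by apply/eqP => E; move: jk kl; rewrite E; lia)).
  by apply: (ci_nc Hv Nx Nx'); rewrite E1 E2 E3 E4.
(* A block {u, -u} forces [mate k x] to be -x, so x is up to sign the place of an index below k;
   these k indices give distinct blocks. *)
- pose f (m : 'I_n) := [set v (pos m); rev_ord (v (pos m))].
  have -> : trivial_blocks M = f @: [set m : 'I_n | m < k].
    apply/setP => B; rewrite inE; apply/andP/imsetP => [[/imsetP[x]]|[m]].
      rewrite inE => Nx -> /existsP[u /eqP E].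
      have vne : v x != v (mate k x) by rewrite (inj_eq perm_inj) eq_sym mate_neq.
      have Em : mate k x = rev_ord x.
        apply: (@perm_inj _ v); rewrite HvW.
        by case: (set2_inj vne E) => -[-> ->]; rewrite ?rev_ordK.
      have Hx : x \in negated (yFPF n k) by rewrite -mate_eq_rev Em.
      have [m Hm] := pos_or_neg x; rewrite negated_yFPF in Hx.
      have mk : m < k.
        by move: Hx; case: Hm => ->; rewrite ?val_rev val_pos; have := ltn_ord m; lia.
      exists m; first by rewrite inE.
      by rewrite Em /f; case: Hm => ->; rewrite ?rev_ordK HvW // setUC.
    rewrite inE => mk ->; have [_ Hm] := ci_triv Hv mk.
    have E : mate k (pos m) = rev_ord (pos m).
      by apply/eqP; rewrite mate_eq_rev negated_yFPF val_pos; have := ltn_ord m; lia.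
    split; last by apply/existsP; exists (v (pos m)).
    by rewrite /f -HvW -E block_of -(negated_opp _ Hc) inE Hm.
  rewrite card_in_imset.
    have -> : [set m : 'I_n | m < k] = widen_ord kn @: [set: 'I_k].
      apply/setP => m; rewrite inE; apply/idP/imsetP => [mk|[m' _ ->]]; last by rewrite /= ltn_ord.
      by exists (Ordinal mk) => //; apply: ord_inj.
    rewrite card_imset ?cardsT ?card_ord // => m m' E.
    by apply: ord_inj; exact: (congr1 (@nat_of_ord _) E).
  move=> m m'; rewrite !inE => mk mk' E.
  have [H1 _] := ci_triv Hv mk; have [H2 _] := ci_triv Hv mk'.
  have Ne : v (pos m) != rev_ord (v (pos m)) by rewrite eq_sym rev_neq.
  case: (set2_inj Ne E) => -[E1 E2].
    by move/perm_inj: E1 => /(congr1 (@nat_of_ord _)); rewrite !val_pos => /addnI/ord_inj.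
  by move: H1; rewrite E1 val_rev; lia.
- move=> i j HB ji.
  have ij : i != j.
    apply/eqP => E; move: HB; rewrite E => /imsetP[x _ /setP Ex].
    have := Ex (v x); have := Ex (v (mate k x)); rewrite !inE !eqxx orbT => /orP[] /eqP E1 /orP[] /eqP E2;
    by have := mate_neq x; rewrite -(inj_eq (@perm_inj _ v)) E1 E2 eqxx.
  have [x [E1 E2 Nx _]] := block_inv HB ij.
  by have := Hcomp x; rewrite -(negated_opp _ Hc) E1 E2; apply=> //; rewrite -E1.
Qed.

Lemma NCSP_compat : NCSP k c (blocks k (zc c) v) -> compat k c v.
Proof.
case=> _ _ _ _ H x Sx Hx; have := H (v x) (v (mate k x)).
by rewrite -/M block_of => /(_ Sx Hx).
Qed.

End BlockMatching.

End Matchings.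

(** * The dense clan *)

Lemma card_ord_interval N a b : b <= N -> #|[set x : 'I_N | a <= x < b]| = b - a.
Proof.
move=> bN; have H (j : 'I_(b - a)) : a + j < N by have := ltn_ord j; lia.
have -> : [set x : 'I_N | a <= x < b] = (fun j => Ordinal (H j)) @: [set: 'I_(b - a)].
  apply/setP => x; rewrite inE; apply/idP/imsetP => [Hx|[j _ ->]] /=.
    have Hj : x - a < b - a by lia.
    exists (Ordinal Hj); first by rewrite in_setT.
    by apply: ord_inj => /=; lia.
  by have := ltn_ord j; lia.
rewrite card_imset ?cardsT ?card_ord // => j j' /(congr1 (@nat_of_ord _)) /= E.
by apply: ord_inj; lia.
Qed.

Section Sinks.
Variables (n p q : nat).
Local Notation N := (n + n).
Implicit Types (c : {ffun 'I_N -> symbol}) (y z v : 'S_N) (i m : 'I_n) (x : 'I_N).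
Local Notation good := (orbit_clan p q).
Local Notation zc c := (opp_perm (iota_clan c)).
Let k := maxn p q - minn p q.

Lemma sign_card c s : #|[set x | is_sign (c x)]| =
  #|[set x | c x == inl s]%SET| + #|[set x | c x == inl (~~ s)]%SET|.
Proof.
rewrite -cardsUI; set B := _ :&: _; have -> : B = set0.
  apply/setP => x; rewrite !inE.
  by apply/negP => /andP[/eqP -> /eqP[]]; case: (s).
rewrite cards0 addn0; apply: eq_card => x; rewrite !inE.
by case: (c x) => [b|m] //=; case: b (s) => [] [].
Qed.

(** There are 2k signs in all, and by the clan condition the two counts differ by 2|p - q| = 2k, so
    only the majority sign occurs. *)
Lemma dense_signs c x s : good c -> zc c = yFPF n k -> k <= n -> ~~ odd (n - k) ->
  c x = inl s -> s = (q < p).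
Proof.
move=> Hc Ez kn nk Ex; have /orbit_clanP[_ Hs _] := Hc.
have Hcard : #|[set x | is_sign (c x)]| = k.*2.
  rewrite -(_ : (n + k) - (n - k) = k.*2); last by lia.
  rewrite -(@card_ord_interval N) ?leq_add2l //; apply: eq_card => u.
  by rewrite !inE -(negated_opp _ Hc) Ez negated_yFPF.
have pos_card : 0 < #|[set x | c x == inl s]%SET|.
  by apply/card_gt0P; exists x; rewrite inE Ex.
move: Hs; rewrite /sign_counts; move: Hcard; rewrite (sign_card _ true) /=.
move: pos_card; rewrite {}/k.
by case: s {Ex} => H; set a := #|_| in H *; set b := #|_|; move: a b H; clear;
  move=> a b; case: (ltnP q p); lia.
Qed.

Section Sink.
Variable c : {ffun 'I_N -> symbol}.
Hypotheses (Hc : good c) (Hsink : forall i c', ~ clan_step i c c').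
Let y := iota_clan c.
Let Hy : sym_clan c y. Proof. by case/orbit_clanP: Hc. Qed.
Let Hi := sy_invol Hy.
Let HW := inWnP _ (sy_Wn Hy).

Let no_conj i : y (lo i) < y (hi i) -> y (lo i) != rev_ord (hi i) ->
  y (lo i) != lo i \/ y (hi i) != hi i -> False.
Proof. by move=> H1 H2 H3; apply: (Hsink (i := i) (c' := comp_clan c (tgen i))); left. Qed.

Let same_sign i : n <= lo i -> is_sign (c (lo i)) -> is_sign (c (hi i)) ->
  c (lo i) = c (hi i).
Proof.
move=> nlo /is_signP[s Es] /is_signP[s' Es']; rewrite Es Es'; congr inl.
have [m [m' [mm fm fm']]] := fresh_labels c.
case: (eqVneq s s') => // Ne; exfalso.
apply: (Hsink (i := i) (c' := flip_clan c i m m')); right; split=> //; last by exists m, m'.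
by exists s; rewrite Es Es'; split=> //; move: Ne; case: s s' {Es Es'} => [] [].
Qed.

Let adj m m' : m' = m.+1 :> nat -> lo m' = pos m.
Proof. by move=> E; apply: ord_inj; rewrite val_lo val_pos E; lia. Qed.

(** r is the length of the longest initial run of positive places fixed by y. Were y positive at a
    later place, the first such place would be the upper end of an ascent that allows a
    conjugation. *)
Lemma sink_prefix : exists2 r, r <= n & (forall m, m < r -> y (pos m) = pos m) /\
  (forall m, r <= m -> y (pos m) < n).
Proof.
have ex : exists r, (r <= n) && [forall m : 'I_n, (m < r) ==> (y (pos m) == pos m)].
  by exists 0; apply/forallP.
have bd r : (r <= n) && [forall m : 'I_n, (m < r) ==> (y (pos m) == pos m)] -> r <= n.
  by case/andP.
case: (ex_maxnP ex bd) => r /andP[rn /forallP Hr] Hmax; exists r => //.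
have Hfix m : m < r -> y (pos m) = pos m by move=> mr; apply/eqP; have /implyP := Hr m; apply.
split=> // m.
have Hstart m0 : m0 = r :> nat -> y (pos m0) != pos m0.
  move=> E; apply/eqP => E'; have := Hmax r.+1; rewrite ltnn => H.
  suff: false by []; apply: H; rewrite -{1}E ltn_ord; apply/forallP => m1; apply/implyP.
  rewrite ltnS leq_eqVlt => /orP[/eqP E1|/Hfix -> //].
  by have -> : m1 = m0 by [apply: ord_inj; rewrite E1]; rewrite E'.
case: m => m; elim: m => [|m IH] Hm rm.
  have E0 : Ordinal Hm = 0 :> nat by [].
  move: rm E0; set m0 := Ordinal Hm => rm E0; rewrite ltnNge; apply/negP => Hge.
  have Er : m0 = r :> nat by lia.
  have Elo : lo m0 = rev_ord (hi m0) by apply: rev_lo_hi; rewrite val_lo E0; lia.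
  have Hlt : y (lo m0) < y (hi m0).
    rewrite Elo HW val_rev /hi; move: Hge; have := ltn_ord (y (pos m0)); lia.
  have Ne := Hstart m0 Er.
  apply: (no_conj Hlt); last by right.
  by rewrite Elo HW (inj_eq rev_ord_inj).
have Hm1 : m < n by lia.
have E1 : Ordinal Hm = m.+1 :> nat by [].
move: rm E1; set m1 := Ordinal Hm => rm E1; rewrite ltnNge; apply/negP => Hge.
have Elo : lo m1 = pos (Ordinal Hm1) by apply: adj.
have [Er|Nr] := eqVneq r m.+1.
  have Ylo : y (lo m1) = lo m1 by rewrite Elo Hfix //= Er.
  have Ne := Hstart m1 (esym Er).
  apply: (no_conj (i := m1)); last by right.
    (* A positive value not above lo is one of the places fixed by y, and then injectivity would
       make this place fixed as well. *)
    rewrite Ylo ltnNge; apply/negP => Hle.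
    have Hidx : y (pos m1) - n < n by have := ltn_ord (y (pos m1)); lia.
    have Ep : y (pos m1) = pos (Ordinal Hidx).
      by apply: ord_inj; rewrite val_pos /=; lia.
    have Hr1 : y (pos (Ordinal Hidx)) = pos (Ordinal Hidx).
      apply: Hfix => /=; rewrite Er; move: Hle; rewrite /hi Elo val_pos /=; lia.
    have : y (pos m1) = pos m1.
      by rewrite {2}[pos m1](_ : _ = y (y (pos m1))) ?Ep ?(cl_inv Hi) // -Ep (cl_inv Hi).
    by move/eqP; rewrite (negPf Ne).
  by rewrite Ylo; case: (lo_hi_disjoint (i := m1)) => //; rewrite Elo val_pos leq_addr.
have Hprev : y (pos (Ordinal Hm1)) < n by apply: IH => /=; lia.
apply: (no_conj (i := m1)).
- by rewrite Elo /hi; apply: leq_trans Hge.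
- apply/eqP; rewrite Elo => E; have := congr1 y E; rewrite (cl_inv Hi) HW => E2.
  have := congr1 (@nat_of_ord _) E2; rewrite val_pos val_rev; move: Hge; rewrite /hi; lia.
- left; rewrite Elo; apply/eqP => /(congr1 (@nat_of_ord _)); rewrite val_pos; lia.
Qed.

(** Beyond r, z permutes the positive places, and in the absence of conjugations z(m) = m + 1 or
    z(m) < z(m + 1). This forces z to exchange consecutive places in pairs. Adjacent signs agree, so
    all 2r signs are equal, and counting them gives r = |p - q|. *)
Lemma sink_zc : zc c = yFPF n k /\ [/\ k <= n & ~~ odd (n - k)].
Proof.
have [r rn [Hfix Hneg]] := sink_prefix.
have [Wz Iz Fz] := opp_perm_fpf Hc.
have HWz := inWnP _ Wz.
have zE x : zc c x = rev_ord (y x) by rewrite opp_permE.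
have zfix m : m < r -> zc c (pos m) = rev_ord (pos m) by move=> mr; rewrite zE Hfix.
have zge m : r <= m -> exists2 m', zc c (pos m) = pos m' & r <= m'.
  move=> rm; have Hlt := Hneg m rm.
  have Hidx : n - (y (pos m)).+1 < n by lia.
  have E : zc c (pos m) = pos (Ordinal Hidx).
    by apply: ord_inj; rewrite zE val_rev val_pos /=; lia.
  exists (Ordinal Hidx) => //; rewrite leqNgt; apply/negP => H.
  have := zfix _ H; rewrite -E Iz => /(congr1 (@nat_of_ord _)).
  by rewrite E val_rev !val_pos; have := ltn_ord m; lia.
have zstep m m' : r <= m -> m' = m.+1 :> nat ->
    zc c (pos m) = pos m' \/ zc c (pos m) < zc c (pos m').
  move=> rm Em; have Elo := adj Em.
  have [E|Ne] := eqVneq (zc c (pos m)) (pos m'); first by left.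
  right; rewrite ltnNge; apply/negP => Hle.
  have Hlt : y (lo m') < y (hi m').
    rewrite Elo /hi ltn_neqAle; apply/andP; split.
      apply/eqP => /ord_inj/perm_inj/(congr1 (@nat_of_ord _)); rewrite !val_pos Em; lia.
    by move: Hle; rewrite !zE !val_rev; have := ltn_ord (y (pos m)); have := ltn_ord (y (pos m')); lia.
  apply: (no_conj Hlt).
    by rewrite Elo; apply: contra Ne => /eqP E; rewrite zE E rev_ordK.
  by left; rewrite Elo; apply/eqP => E; have := Hneg m rm; rewrite E val_pos; lia.
have pairs j m : m = r + j.*2 :> nat ->
    exists2 m' : 'I_n, m' = m.+1 :> nat & zc c (pos m) = pos m'.
  elim/ltn_ind: j m => j IH m Em.
  have [m' Em' rm'] : exists2 m', zc c (pos m) = pos m' & r <= m' by apply: zge; lia.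
  have Nm' : m' <> m :> nat.
    by move=> E; have := Fz (pos m); rewrite Em' (ord_inj E) eqxx.
  (* A smaller partner would lie in a pair found earlier, whose two places are exchanged with each
     other. *)
  have gt : m < m'.
    rewrite ltnNge; apply/negP => Hle; have Hlt : m' < m by lia.
    have Hj : (m' - r)./2 < j by lia.
    have Hb : r + (m' - r)./2.*2 < n by have := ltn_ord m'; lia.
    have [m1 Em1] : exists m1 : 'I_n, m1 = r + (m' - r)./2.*2 :> nat by exists (Ordinal Hb).
    have [m2 Em2 Ez2] := IH _ Hj m1 Em1.
    have Em4 : zc c (pos m') = pos m by rewrite -Em' Iz.
    have Hodd := odd_double_half (m' - r).
    case: (boolP (odd (m' - r))) => Ho.
      have E : m' = m2 by apply: ord_inj; lia.
      move: Em4; rewrite E -Ez2 Iz => /(congr1 (@nat_of_ord _)); rewrite !val_pos.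
      by move: Hlt; rewrite E; lia.
    have E : m' = m1 by apply: ord_inj; lia.
    move: Em4; rewrite E Ez2 => /(congr1 (@nat_of_ord _)); rewrite !val_pos Em2.
    by move: Hlt Hodd Em; rewrite E; have := Em1; lia.
  exists m' => //; apply/eqP; rewrite eqn_leq gt andbT leqNgt; apply/negP => Hgt.
  have Em4 : zc c (pos m') = pos m by rewrite -Em' Iz.
  (* If z(m) = m' > m + 1, then z increases from m up to m' - 1 with values at least m', and its
     drop to m at the place m' is excluded by [zstep]. *)
  have mono t (m1 : 'I_n) : m1 = m + t :> nat -> m1 < m' -> n + m' <= zc c (pos m1).
    elim: t m1 => [|t IHt] m1 E1 lt1.
      by have -> : m1 = m by [apply: ord_inj; lia]; rewrite Em' val_pos.
    have H0 : m + t < n by have := ltn_ord m1; lia.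
    have := IHt (Ordinal H0) erefl => /(_ ltac:(rewrite /=; lia)) Hle.
    case: (@zstep (Ordinal H0) m1); rewrite /=; try lia.
    by move=> E2; move: Hle; rewrite E2 val_pos; lia.
  have H0 : m'.-1 < n by have := ltn_ord m'; lia.
  have Hlast : n + m' <= zc c (pos (Ordinal H0)).
    by apply: (mono (m'.-1 - m)) => /=; lia.
  case: (@zstep (Ordinal H0) m'); rewrite /=; try lia.
    move=> E; have := perm_inj (etrans E (esym Em')) => /(congr1 (@nat_of_ord _)).
    by rewrite !val_pos /=; lia.
  by rewrite Em4 val_pos; move: Hlast; lia.
have nr : ~~ odd (n - r).
  apply/negP => Ho; have Hb : r + (n - r)./2.*2 < n by have := odd_double_half (n - r); lia.
  have [m' Em' _] := pairs (n - r)./2 (Ordinal Hb) erefl.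
  by have := ltn_ord m'; have := odd_double_half (n - r); rewrite Em' /=; lia.
have Ez : zc c = yFPF n r.
  have [Wy Iy _] := yFPF_fpf rn nr; have HWy := inWnP _ Wy.
  have main m : zc c (pos m) = yFPF n r (pos m).
    case: (ltnP m r) => mr; first by rewrite zfix // yFPF_lt.
    have Hodd := odd_double_half (m - r).
    case: (boolP (odd (m - r))) => Ho.
      have H0 : m.-1 < n by have := ltn_ord m; lia.
      have [|m' Em' E] := pairs (m - r)./2 (Ordinal H0); first by rewrite /=; lia.
      have -> : m = m' by apply: ord_inj; rewrite Em' /=; lia.
      rewrite -E Iz; apply: ord_inj; rewrite E yFPF_ge // ?val_pos /twin ?Em' /=; last by lia.
      by case: ifP; lia.
    have [|m' Em' E] := pairs (m - r)./2 m; first by lia.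
    by apply: ord_inj; rewrite E yFPF_ge // /twin (negPf Ho) val_pos Em'.
  by apply/permP => x; have [m [->|->]] := pos_or_neg x; rewrite ?HWz ?HWy main.
suff Er : r = k by rewrite -Er.
have /orbit_clanP[_ Hs _] := Hc.
have sgn x : is_sign (c x) = (n - r <= x < n + r).
  by rewrite -(negated_opp _ Hc) Ez negated_yFPF.
have Hcard : #|[set x | is_sign (c x)]| = r.*2.
  rewrite -(_ : (n + r) - (n - r) = r.*2); last by lia.
  rewrite -(@card_ord_interval N) ?leq_add2l //; apply: eq_card => u.
  by rewrite !inE sgn.
have [s Es] : exists s, forall x, is_sign (c x) -> c x = inl s.
  case: (posnP r) => r0.
    by exists true => x; rewrite sgn r0; lia.
  have n0 : 0 < n by lia.
  have : is_sign (c (pos (Ordinal n0))) by rewrite sgn val_pos /=; lia.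
  case/is_signP => s Es; exists s.
  have up t (m : 'I_n) : m = t :> nat -> m < r -> c (pos m) = inl s.
    elim: t m => [|t IH] m Em mr.
      by rewrite -Es; congr (c (pos _)); apply: ord_inj.
    have H0 : t < n by have := ltn_ord m; lia.
    have Elo : lo m = pos (Ordinal H0) by apply: adj.
    rewrite -(IH (Ordinal H0) erefl) /=; last by lia.
    rewrite -Elo -/(hi m) same_sign ?Elo ?val_pos ?leq_addr // sgn val_pos /=; have := ltn_ord m; lia.
  move=> x; have [m Hm] := pos_or_neg x; rewrite sgn => Hx.
  have mr : m < r.
    by move: Hx; case: Hm => ->; rewrite ?val_rev val_pos; have := ltn_ord m; lia.
  have E := up m m erefl mr; case: Hm => -> //.
  by apply/eqP; rewrite (sy_sign Hy) E.
have cs : #|[set x | c x == inl s]%SET| = r.*2.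
  rewrite -Hcard; apply: eq_card => x; rewrite !inE; apply/eqP/idP => [-> //|]; exact: Es.
have cns : #|[set x | c x == inl (~~ s)]%SET| = 0.
  apply: eq_card0 => x; rewrite !inE; apply/eqP => E.
  by have := Es x; rewrite E => /(_ isT) [] /eqP; case: s {Es cs E}.
move: Hs; rewrite /sign_counts /k.
by case: s {Es} cs cns => -> ->; lia.
Qed.

End Sink.
End Sinks.

(** * Semi-alternating clans *)

Lemma even_card_invol N (S : {set 'I_N}) (f : 'I_N -> 'I_N) : involutive f ->
  (forall x, x \in S -> f x \in S /\ f x != x) -> ~~ odd #|S|.
Proof.
move=> fK Hf; pose A := [set x in S | x < f x]; pose B := [set x in S | f x < x].
have -> : S = A :|: B.
  apply/setP => x; rewrite !inE; case Hx : (x \in S) => //=.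
  by have [_] := Hf x Hx; case: ltngtP => // /ord_inj E; rewrite -E eqxx.
have EB : B = f @: A.
  apply/setP => x; rewrite inE; apply/andP/imsetP => [[Hx xf]|[x']].
    by exists (f x); rewrite ?fK // inE fK xf; case: (Hf x Hx) => ->.
  by rewrite inE => /andP[/Hf[H1 _] H2] ->; rewrite fK.
rewrite cardsU (_ : A :&: B = set0).
  by rewrite cards0 subn0 EB card_imset ?addnn ?odd_double //; exact: inv_inj.
by apply/setP => x; rewrite !inE; apply/negP => /andP[/andP[_ H1] /andP[_ H2]]; lia.
Qed.

Lemma alternating_parity N (sg : 'I_N -> bool) b s :
  sorted (fun x y : 'I_N => x < y) (b :: s) -> alternating (map sg (b :: s)) ->
  forall u, u \in b :: s ->
    sg u = sg b (+) odd (count (fun w : 'I_N => w < u) (b :: s)).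
Proof.
elim: s b => [|b' s IH] b Hs Ha u.
  by rewrite inE => /eqP -> /=; rewrite ltnn addbF.
have all_gt (w : 'I_N) : w \in b' :: s -> b < w.
  have : path (fun x y : 'I_N => x < y) b (b' :: s) by [].
  rewrite path_sortedE; last by move=> x1 x2 x3; apply: ltn_trans.
  by case/andP => /allP H _; apply: H.
rewrite in_cons => /orP[/eqP ->|Hu].
  rewrite -[LHS]addbF; congr (_ (+) _); apply/esym/negbTE.
  rewrite (_ : count _ _ = 0) //; apply/eqP; rewrite -leqn0 leqNgt -has_count.
  apply/hasPn => w; rewrite in_cons => /orP[/eqP ->|/all_gt H]; first by rewrite ltnn.
  by rewrite -leqNgt ltnW.
have Hs' : sorted (fun x y : 'I_N => x < y) (b' :: s) by case/andP: Hs.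
have Ha' : alternating (map sg (b' :: s)) by case/andP: Ha.
have Hb : sg b != sg b' by case/andP: Ha.
rewrite (IH b' Hs' Ha' u Hu) [in RHS]/= (all_gt u Hu) /= -/(count _ (b' :: s)).
by move: Hb; case: (sg b) (sg b') => [] [] //= _; rewrite ?addbN ?addNb ?negbK.
Qed.

Section SemiAlternating.
Variables (n p q k : nat).
Local Notation N := (n + n).
Implicit Types (c : {ffun 'I_N -> symbol}) (y z v : 'S_N) (i : 'I_n) (x : 'I_N).
Hypotheses (kn : k <= n) (nk : ~~ odd (n - k)).
Local Notation good := (orbit_clan p q).
Local Notation zc c := (opp_perm (iota_clan c)).

Definition sgn c x := if c x is inl s then s else false.

(** By symmetry there are as many signs at negative as at positive places, so halving [signs] cuts
    it at the centre. *)
Lemma signs_halves c : good c -> exists B : seq 'I_N,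
  [/\ drop (size (signs c))./2 (signs c) = map (sgn c) B,
      sorted (fun x y : 'I_N => x < y) B &
      forall x, (x \in B) = is_sign (c x) && (n <= x)].
Proof.
move=> Hc; have /orbit_clanP[_ _ Hy] := Hc.
pose A := [seq x <- take n (enum 'I_N) | is_sign (c x)].
pose B := [seq x <- drop n (enum 'I_N) | is_sign (c x)].
have ES : [seq x <- enum 'I_N | is_sign (c x)] = A ++ B.
  by rewrite -filter_cat cat_take_drop.
have Esig : signs c = map (sgn c) (A ++ B).
  rewrite signs_filter -ES; elim: (enum 'I_N) => //= x s IH.
  by case E : (c x) => [b|m] //=; rewrite /= E IH /sgn E.
have U : uniq (A ++ B) by rewrite -ES filter_uniq ?enum_uniq.
have memA x : (x \in A) = is_sign (c x) && (x < n).
  by rewrite mem_filter in_take ?mem_enum // index_enum_ord.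
have memB x : (x \in B) = is_sign (c x) && (n <= x).
  have : (x \in A ++ B) = is_sign (c x) by rewrite -ES mem_filter mem_enum andbT.
  rewrite mem_cat memA [n <= x]leqNgt; move: U; rewrite cat_uniq => /and3P[_ /hasPn H _].
  case: (boolP (x \in B)) => [/H|_]; last by case: (is_sign _); case: (x < n).
  by rewrite memA; case: (is_sign _) => //=; case: (x < n).
have srt : sorted (fun x y : 'I_N => x < y) (A ++ B).
  rewrite -ES; apply: sorted_filter; first by move=> x1 x2 x3; apply: ltn_trans.
  by have := iota_ltn_sorted 0 N; rewrite -val_enum_ord sorted_map.
have sAB : size A = size B.
  have : uniq A by move: U; rewrite cat_uniq => /andP[].
  have : uniq B by move: U; rewrite cat_uniq => /and3P[].
  move=> uB uA; rewrite -(size_map (@rev_ord N) A); apply/eqP.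
  rewrite -uniq_size_uniq ?map_inj_uniq //; try exact: rev_ord_inj.
  move=> x; rewrite memB; apply/idP/mapP => [/andP[H1 H2]|[x']].
    exists (rev_ord x); last by rewrite rev_ordK.
    rewrite memA (sym_clan_rev _ Hy) H1 val_rev /=; have := ltn_ord x; lia.
  rewrite memA => /andP[H1 H2] ->; rewrite (sym_clan_rev _ Hy) H1 val_rev /=; lia.
exists B; split=> //; last by case: (cat_sorted2 srt).
rewrite Esig map_cat size_cat !size_map sAB [size B + size B]addnn doubleK.
by rewrite drop_size_cat ?size_map.
Qed.

Lemma semi_alternating_compat c v : good c -> chain_inv k (zc c) v ->
  semi_alternating c -> compat k c v.
Proof.
move=> Hc Hv /andP[_ Halt]; have Hz := opp_perm_fpf Hc.
have HvW := inWnP _ (ci_W Hv).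
have [B [EB sB memB]] := signs_halves Hc; rewrite EB in Halt.
have nc := ci_nc Hv.
have Nmate := mate_negated kn nk Hz Hv.
(* The mate, seen on values instead of places. *)
pose mu u := v (mate k (v^-1 u)%g).
have muK : involutive mu by move=> u; rewrite /mu permK mateK // permKV.
have munc u w : is_sign (c u) -> is_sign (c w) -> ~ [/\ u < w, w < mu u & mu u < mu w].
  move=> Su Sw; have := nc (v^-1 u)%g (v^-1 w)%g; rewrite !permKV !(negated_opp _ Hc).
  by apply.
have musign u : is_sign (c u) -> is_sign (c (mu u)).
  by move=> Su; rewrite -(negated_opp _ Hc) Nmate // permKV (negated_opp _ Hc).
have murev u : mu (rev_ord u) = rev_ord (mu u).
  have E : ((v^-1)%g (rev_ord u)) = rev_ord ((v^-1)%g u).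
    by have /inWnP := Wn_inv (ci_W Hv); apply.
  by rewrite /mu E mate_rev HvW.
have mune u : mu u != u.
  by rewrite /mu -{2}(permKV v u) (inj_eq perm_inj) mate_neq.
have /orbit_clanP[_ _ Hy] := Hc.
have srev u : is_sign (c (rev_ord u)) = is_sign (c u) by rewrite (sym_clan_rev _ Hy).
suff main : forall u, is_sign (c u) -> mu u != rev_ord u -> opposite_signs (c u) (c (mu u)).
  by move=> x Sx Hx; have := main (v x) Sx; rewrite /mu permK; apply.
(* A nontrivial block with one end on each side of 0 would cross its own negative. *)
have half u : is_sign (c u) -> mu u != rev_ord u -> u < n -> mu u < n.
  move=> Su Ne un; rewrite ltnNge; apply/negP => mn.
  have Sm := musign _ Su.
  case: (ltngtP u (rev_ord (mu u))) => [H|H|H].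
  - apply: (munc u (rev_ord (mu u))) => //; first by rewrite srev.
    by rewrite murev muK !val_rev in H *; have := ltn_ord u; split; lia.
  - apply: (munc (rev_ord (mu u)) u) => //; first by rewrite srev.
    by rewrite murev muK !val_rev in H *; have := ltn_ord u; have := ltn_ord (mu u); split; lia.
  - by case/eqP: Ne; rewrite -[LHS]rev_ordK -(ord_inj H).
have key u : is_sign (c u) -> n <= u -> u < mu u -> opposite_signs (c u) (c (mu u)).
  move=> Su nu lt; have Sm := musign _ Su.
  have Hu : u \in B by rewrite memB Su.
  have Hm : mu u \in B by rewrite memB Sm (leq_trans nu) // ltnW.
  case: B sB Halt memB Hu Hm {EB} => // b s sB Halt memB Hu Hm.
  have P1 := alternating_parity sB Halt Hu; have P2 := alternating_parity sB Halt Hm.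
  pose S := [set w | is_sign (c w) & u < w < mu u].
  (* Noncrossing makes the set of signs strictly between u and mu u stable under mu, which has no
     fixed point. *)
  have evenS : ~~ odd #|S|.
    apply: (@even_card_invol _ S mu) => // w; rewrite !inE => /and3P[Sw uw wm].
    split=> //; rewrite musign //=.
    have nwu : mu w <> u :> nat.
      by move=> /ord_inj E; move: wm; rewrite -E muK ltnn.
    have nwm : mu w <> mu u :> nat.
      by move=> /ord_inj/(can_inj muK) E; move: uw; rewrite E ltnn.
    apply/andP; split; rewrite ltnNge; apply/negP => Hle.
      by apply: (munc (mu w) u); rewrite ?musign // muK; split=> //; rewrite ltn_neqAle Hle andbT; apply/eqP.
    by apply: (munc u w) => //; split=> //; rewrite ltn_neqAle Hle andbT; apply/eqP => E; apply: nwm.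
  have Ec : count (fun w : 'I_N => w < mu u) (b :: s) =
      count (fun w : 'I_N => w < u) (b :: s) + #|S|.+1.
    have U : uniq (b :: s).
      apply: sorted_uniq sB; first by move=> x1 x2 x3; apply: ltn_trans.
      by move=> x; rewrite ltnn.
    have cnt (P : pred 'I_N) : count P (b :: s) = #|[set w | (w \in b :: s) && P w]|.
      rewrite -size_filter -(card_uniqP (filter_uniq P U)); apply: eq_card => w.
      by rewrite inE mem_filter andbC.
    rewrite !cnt.
    have -> : [set w | (w \in b :: s) && (w < mu u)] =
        [set w | (w \in b :: s) && (w < u)] :|: (u |: S).
      apply/setP => w; rewrite !inE -in_cons memB.
      have [->|Nw] := eqVneq w u; first by rewrite Su nu lt orbT.
      have Nw' : w <> u :> nat by move/ord_inj/eqP; rewrite (negPf Nw).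
      case: (is_sign (c w)) => //=.
      move: Nw' nu lt; move: (mu u : nat) (u : nat) (w : nat); clear.
      by move=> m u w Nw nu lt; lia.
    rewrite cardsU cardsU1 (_ : _ :&: _ = set0) ?cards0 ?subn0.
      by rewrite inE ltnn andbF.
    apply/setP => w; rewrite !inE; apply/negP => /andP[/andP[_ H1]].
    case/orP => [/eqP E|/andP[_ /andP[H2 _]]]; first by move: H1; rewrite E ltnn.
    by have := ltn_trans H1 H2; rewrite ltnn.
  have : sgn c (mu u) = ~~ sgn c u.
    by rewrite P1 P2 Ec oddD /= (negPf evenS) addbT addbN.
  rewrite /sgn; case/is_signP: Su => s1 E1; case/is_signP: Sm => s2 E2.
  by rewrite E1 E2 => ->; exists s1.
have pos_case u : is_sign (c u) -> mu u != rev_ord u -> n <= u -> opposite_signs (c u) (c (mu u)).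
  move=> Su Ne nu; have Sm := musign _ Su.
  have nm : n <= mu u.
    rewrite leqNgt; apply/negP => H; have := half _ Sm; rewrite muK.
    by rewrite -(inj_eq rev_ord_inj) rev_ordK eq_sym Ne => /(_ isT H); lia.
  case: (ltngtP u (mu u)) => [H|H|/ord_inj H]; first exact: key.
    by apply: opposite_sym; rewrite -{2}(muK u); apply: key; rewrite ?muK.
  by have := mune u; rewrite -H eqxx.
move=> u Su Ne; case: (leqP n u) => nu; first exact: pos_case.
have := pos_case (rev_ord u); rewrite srev murev (inj_eq rev_ord_inj) => /(_ Su Ne).
rewrite val_rev => /(_ ltac:(have := ltn_ord u; lia)) /(opposite_rev Hc).
by rewrite !rev_ordK.
Qed.

End SemiAlternating.

(** * Rank conditions *)

From mathcomp Require Import boolp classical_sets reals complex.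
From mathcomp Require Import (canonicals, coercions) mpoly.

Import GRing.Theory.
Local Open Scope classical_set_scope.

Local Open Scope ring_scope.

Section Ranks.
Variable F : fieldType.

Lemma mxrank_addv m k (W : 'M[F]_(m, k)) (u : 'rV_k) :
  \rank (W + u)%MS = (\rank W + ~~ (u <= W)%MS)%N.
Proof.
case: (boolP (u <= W)%MS) => H /=.
  by rewrite addn0; apply/eqP; rewrite eqn_leq !mxrankS ?addsmxSl // addsmx_sub submx_refl.
apply/eqP; rewrite eqn_leq; apply/andP; split.
  by rewrite (leq_trans (mxrank_adds_leqif _ _)) // leq_add2l rank_leq_row.
rewrite addn1 ltn_neqAle mxrankS ?addsmxSl // andbT.
apply: contra H => /eqP E; have := mxrank_leqif_sup (addsmxSl W u).
by case=> _; rewrite E eqxx => /esym; rewrite addsmx_sub submx_refl.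
Qed.

(* A pencil of lines through W meets the hyperplane condition u <= W at most
   once, unless it lies in it. *)
Lemma rank_pencil m k (W : 'M[F]_(m, k)) (v v' : 'rV_k) :
  (\rank (W + v')%MS <= \rank (W + v)%MS)%N ->
  exists b, forall t, t != b -> \rank (W + (v + t *: v')%R)%MS = \rank (W + v)%MS.
Proof.
rewrite !mxrank_addv leq_add2l; case: (boolP (v <= W)%MS) => Hv /= H.
  have Hv' : (v' <= W)%MS by move: H; case: (v' <= W)%MS.
  by exists 0 => t _; rewrite mxrank_addv addmx_sub ?scalemx_sub.
case: (pselect (exists b, ((v + b *: v')%R <= W)%MS)) => [[b Hb]|Hno].
  exists b => t tb; rewrite mxrank_addv; suff -> : ((v + t *: v')%R <= W)%MS = false by [].
  apply: contraNF Hv => Ht; have D : b - t != 0 by rewrite subr_eq0 eq_sym.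
  have Hv' : (v' <= W)%MS.
    rewrite -(scale1r v') -(mulVf D) -scalerA scalemx_sub // scalerBl.
    have -> : b *: v' - t *: v' = (v + b *: v') - (v + t *: v').
      by rewrite opprD addrACA subrr add0r.
    by rewrite addmx_sub // eqmx_opp.
  by rewrite -[v](addrK (t *: v')) addmx_sub // eqmx_opp scalemx_sub.
exists 0 => t _; rewrite mxrank_addv; case: (boolP (_ <= _)%MS) => // Ht.
by case: Hno; exists t.
Qed.

Section RankClosed.
Variables (n m l : nat) (L : {linear 'M[F]_(n + n) -> 'M[F]_(m, l)}).

(** A polynomial must separate the set from each g of larger rank. Choose D and V with D (L g) V =
    1, of size the rank of L g; then h -> det (D (L h) V) is 1 at g and vanishes wherever L h has
    rank at most r. *)
Lemma rank_le_zariski r : zariski_closed [set g | (\rank (L g) <= r)%N].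
Proof.
pose S := [set g | (\rank (L g) <= r)%N].
exists [set f | forall g, S g -> mpoly.meval (fun k => mxvec g 0 k) f = 0].
apply/seteqP; split=> [g Sg f Hf|g Hg]; first exact: Hf.
rewrite /S /= leqNgt; apply/negP => Hr.
pose U := row_base (L g).
have [V HV] : exists V, U *m V = 1%:M by apply/row_freeP; exact: row_base_free.
have [D HD] : exists D, U = D *m L g.
  by apply/submxP; rewrite eq_row_base.
(* L applied to the generic matrix, whose entries are the variables. *)
pose Lp : 'M[mpoly.mpoly _ F]_(m, l) := \matrix_(a, b)
  \sum_k (L (vec_mx (delta_mx 0 k)) a b) *: mpoly.mpolyX F (mpoly.mnm1 k).
pose cst (c : F) : mpoly.mpoly ((n + n) * (n + n)) F := mpoly.mpolyC _ c.
pose f := \det (map_mx cst D *m Lp *m map_mx cst V).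
have evL h : map_mx (mpoly.meval (fun k => mxvec h 0 k)) Lp = L h.
  apply/matrixP => a b; rewrite !mxE raddf_sum -{2}(mxvecK h).
  rewrite [in RHS](row_sum_delta (mxvec h)) !linear_sum summxE.
  by apply: eq_bigr => k _; rewrite /= mpoly.mevalZ mpoly.mevalXU !linearZ mxE mulrC.
have evC h a b (A : 'M_(a, b)) : map_mx (mpoly.meval (fun k => mxvec h 0 k)) (map_mx cst A) = A.
  by apply/matrixP => x y; rewrite !mxE mpoly.mevalC.
have evf h : mpoly.meval (fun k => mxvec h 0 k) f = \det (D *m L h *m V).
  by rewrite -det_map_mx !map_mxM evL !evC.
have : mpoly.meval (fun k => mxvec g 0 k) f = 0.
  apply: Hg => h Sh; rewrite evf; apply/eqP; apply: contraT => Nd.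
  have U1 : D *m L h *m V \in unitmx by rewrite unitmxE unitfE.
  have := mxrank_unit U1; have := mxrankM_maxl (D *m L h) V.
  have := mxrankM_maxr D (L h); rewrite /S /= in Sh => H1 H2 H3.
  by move: Hr; rewrite ltnNge -{1}H3 (leq_trans H2) // (leq_trans H1).
by rewrite evf -HD HV det1 => /eqP; rewrite oner_eq0.
Qed.

End RankClosed.

End Ranks.

(** * The symplectic group *)

Section Symplectic.
Variables (F : fieldType) (n : nat).
Local Notation N := (n + n)%N.
Local Notation mat := 'M[F]_N.
Local Notation J := (Jform F n).
Implicit Types (g h b s : mat) (i : 'I_n) (x y u : 'I_N).

Definition jsign x : F := if is_neg x then 1 else -1.

Lemma jsign_rev x : jsign (rev_ord x) = - jsign x.
Proof.
rewrite /jsign /is_neg val_rev; have := ltn_ord x => Hx.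
by case: (ltnP x n) => H; case: ifP => H'; rewrite ?opprK //; lia.
Qed.

Lemma jsign2 x : jsign x * jsign x = 1.
Proof. by rewrite /jsign; case: ifP; rewrite ?mulr1 ?mulrNN ?mulr1. Qed.

Lemma jsign_neq0 x : jsign x != 0.
Proof. by rewrite /jsign; case: ifP; rewrite ?oppr_eq0 oner_eq0. Qed.

Lemma mulJmx g x y : (J *m g) x y = jsign x * g (rev_ord x) y.
Proof.
rewrite mxE (bigD1 (rev_ord x)) //= mxE eqxx big1 ?addr0 // => u Hu.
by rewrite mxE (negPf Hu) mul0r.
Qed.

Lemma mulmxJ g x y : (g *m J) x y = - (g x (rev_ord y) * jsign y).
Proof.
rewrite mxE (bigD1 (rev_ord y)) //= mxE rev_ordK eqxx -/(jsign _) jsign_rev mulrN.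
rewrite big1 ?addr0 // => u Hu; rewrite mxE ifN ?mulr0 //.
by apply: contra Hu => /eqP ->; rewrite rev_ordK.
Qed.

Lemma J2 : J *m J = - 1%:M.
Proof.
apply/matrixP => x y; rewrite mulJmx !mxE rev_ordK eq_sym.
case: eqP => [->|_]; last by rewrite mulr0 mulr0n oppr0.
by rewrite -/(jsign _) jsign_rev mulrN jsign2.
Qed.

(** The inverse of a symplectic matrix in closed form. Its entries are those of g up to sign and
    mirroring, so conditions on vanishing entries pass from g to its inverse. *)
Definition invSp g : mat := - (J *m g^T *m J).

Lemma Sp_invE g x y : invSp g x y = jsign x * jsign y * g (rev_ord y) (rev_ord x).
Proof. by rewrite mxE mulmxJ opprK mulJmx mxE mulrAC. Qed.

Lemma Sp_invl g : Sp g -> invSp g *m g = 1%:M.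
Proof.
move=> Hg; rewrite /invSp mulNmx -!mulmxA (_ : g^T *m (J *m g) = J) ?mulmxA //.
by rewrite J2 opprK.
Qed.

Lemma Sp_invr g : Sp g -> g *m invSp g = 1%:M.
Proof. by move=> Hg; apply: mulmx1C; exact: Sp_invl. Qed.

Lemma Sp1 : Sp (1%:M : mat).
Proof. by rewrite /Sp /= trmx1 mul1mx mulmx1. Qed.

Lemma SpM g h : Sp g -> Sp h -> Sp (g *m h).
Proof.
move=> Hg Hh; rewrite /Sp /= trmx_mul -!mulmxA (mulmxA J) (mulmxA g^T).
by rewrite (mulmxA g^T J) Hg mulmxA.
Qed.

Lemma Sp_invSp g : Sp g -> Sp (invSp g).
Proof.
move=> Hg; rewrite /Sp /= -[in LHS]Hg -!mulmxA Sp_invr // mulmx1.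
by rewrite mulmxA -trmx_mul Sp_invr // trmx1 mul1mx.
Qed.

Lemma Sp_tr g : Sp g -> Sp g^T.
Proof.
move=> Hg; rewrite /Sp /= trmxK; have := congr1 (mulmx^~ J) (Sp_invr Hg).
rewrite /invSp mulmxN mulNmx mul1mx -!mulmxA J2 !mulmxN mulmx1 opprK; exact.
Qed.

Lemma Sp_unit g : Sp g -> g \in unitmx.
Proof. by move=> Hg; case: (mulmx1_unit (Sp_invl Hg)). Qed.

Lemma Borel1 : Borel (1%:M : mat).
Proof.
by split=> [|x y yx]; [exact: Sp1|rewrite mxE; case: eqP => // E; rewrite E ltnn in yx].
Qed.

Lemma BorelM g h : Borel g -> Borel h -> Borel (g *m h).
Proof.
move=> [Sg Ug] [Sh Uh]; split=> [|x y yx]; first exact: SpM.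
rewrite mxE big1 // => u _; case: (ltnP u x) => Hu; first by rewrite Ug ?mul0r.
by rewrite Uh ?mulr0 // (leq_trans yx).
Qed.

Lemma Borel_inv g : Borel g -> Borel (invSp g).
Proof.
move=> [Sg Ug]; split=> [|x y yx]; first exact: Sp_invSp.
rewrite Sp_invE Ug ?mulr0 // !val_rev; have := ltn_ord x; lia.
Qed.

(** * Minimal parabolics and negative root subgroups *)

Section Parabolic.
Variable i : 'I_n.

(** The entries just below the diagonal that the minimal parabolic allows to be nonzero; for i = 0
    the two coincide. *)
Definition exceptional x y :=
  ((x == hi i) && (y == lo i)) || ((x == rev_ord (lo i)) && (y == rev_ord (hi i))).

(** Membership in [parabolic i] as a condition on entries; [parabolicE] compares it with the
    definition by Bruhat cells. *)
Definition block_upper : set mat :=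
  [set g | Sp g /\ forall x y, (y < x)%N -> ~~ exceptional x y -> g x y = 0].

Let Hll := val_lo i.
Let Hlh := val_hi i.
Let Hi := ltn_ord i.
Let Hrl : rev_ord (lo i) = (n - i)%N :> nat. Proof. by rewrite val_rev Hll; lia. Qed.
Let Hrh : rev_ord (hi i) = (n - i.+1)%N :> nat. Proof. by rewrite val_rev Hlh; lia. Qed.

Lemma exceptionalP x y : exceptional x y =
  ((x == n + i :> nat)%N && (y == n + i - 1 :> nat)%N) ||
  ((x == n - i :> nat)%N && (y == n - i.+1 :> nat)%N).
Proof. by rewrite /exceptional -!(inj_eq (@ord_inj _)) Hll Hlh Hrl Hrh. Qed.

Lemma exceptional_inv x y : exceptional (rev_ord y) (rev_ord x) = exceptional x y.
Proof.
rewrite /exceptional orbC andbC [X in _ || X]andbC.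
by rewrite -{2}(rev_ordK (hi i)) -{2}(rev_ordK (lo i)) !(inj_eq rev_ord_inj).
Qed.

Lemma block_upperE g x y : block_upper g -> g x y != 0 -> (x <= y)%N || exceptional x y.
Proof.
move=> [_ H] Ne; case: (leqP x y) => //= yx; apply: contraT => E.
by rewrite H ?eqxx in Ne.
Qed.

Lemma block_upperM g h : block_upper g -> block_upper h -> block_upper (g *m h).
Proof.
move=> Qg Qh; have [Sg _] := Qg; have [Sh _] := Qh; split; first exact: SpM.
move=> x y yx Ne; rewrite mxE big1 // => u _.
have [->|H1] := eqVneq (g x u) 0; first by rewrite mul0r.
have [->|H2] := eqVneq (h u y) 0; first by rewrite mulr0.
have := block_upperE Qg H1; have := block_upperE Qh H2; move: Ne.
by rewrite !exceptionalP; move: (ltn_ord i); lia.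
Qed.

Lemma block_upper_inv g : block_upper g -> block_upper (invSp g).
Proof.
move=> [Sg Ug]; split=> [|x y yx Ne]; first exact: Sp_invSp.
rewrite Sp_invE Ug ?mulr0 // ?exceptional_inv // !val_rev; have := ltn_ord x; lia.
Qed.

Lemma Borel_block_upper g : Borel g -> block_upper g.
Proof. by move=> [Sg Ug]; split=> // x y yx _; exact: Ug. Qed.

Lemma weyl_block_upper s : weyl_rep (tgen i) s -> block_upper s.
Proof.
move=> [Ss Ws]; split=> // x y yx; apply: contraNeq => /Ws E.
rewrite exceptionalP; have := congr1 (@nat_of_ord _) E; rewrite tgen_val.
by do 4?case: eqP; lia.
Qed.

(** The second exceptional entry is, up to sign, the entry (hi, lo) of the inverse, which vanishes
    too: compare the column lo in h^-1 h = 1. *)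
Lemma block_upper_Borel h : block_upper h -> h (hi i) (lo i) = 0 -> Borel h.
Proof.
move=> Qh H0; have [Sh Uh] := Qh; split=> // x y yx.
have [Ex|] := boolP (exceptional x y); last exact: Uh.
have Qk := block_upper_inv Qh; have Ek := Sp_invl Sh.
have low u : h u (lo i) != 0 -> (u <= lo i)%N.
  move=> Hu; have := block_upperE Qh Hu; case: leqP => //= lu.
  rewrite exceptionalP Hll => Hex; have Eu : u = hi i by apply: ord_inj; rewrite Hlh; lia.
  by rewrite Eu H0 eqxx in Hu.
have Ell : h (lo i) (lo i) != 0.
  have := congr1 (fun m : mat => m (lo i) (lo i)) Ek; rewrite mxE [RHS]mxE eqxx.
  rewrite (bigD1 (lo i)) //= big1 ?addr0 => [E|u ul].
    by apply/eqP => E'; move: E; rewrite E' mulr0 => /esym/eqP; rewrite oner_eq0.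
  have [->|Hu] := eqVneq (h u (lo i)) 0; first by rewrite mulr0.
  have [->|Hk] := eqVneq (invSp h (lo i) u) 0; first by rewrite mul0r.
  have := low u Hu; have := block_upperE Qk Hk; rewrite exceptionalP Hll.
  by move: ul; rewrite -(inj_eq (@ord_inj _)) Hll; move: (ltn_ord i); lia.
have Ek0 : invSp h (hi i) (lo i) = 0.
  have := congr1 (fun m : mat => m (hi i) (lo i)) Ek; rewrite mxE [RHS]mxE.
  rewrite [hi i == _]eq_sym (negPf (lo_neq_hi i)) (bigD1 (lo i)) //= big1 ?addr0 => [/eqP|u ul].
    by rewrite mulf_eq0 (negPf Ell) orbF => /eqP.
  have [->|Hu] := eqVneq (h u (lo i)) 0; first by rewrite mulr0.
  have [->|Hk] := eqVneq (invSp h (hi i) u) 0; first by rewrite mul0r.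
  have := low u Hu; have := block_upperE Qk Hk; rewrite exceptionalP Hlh Hll.
  by move: ul; rewrite -(inj_eq (@ord_inj _)) Hll; move: (ltn_ord i); lia.
case/orP: Ex => /andP[/eqP -> /eqP ->] //.
by move/eqP: Ek0; rewrite Sp_invE mulf_eq0 mulf_eq0 !(negPf (jsign_neq0 _)) /= => /eqP.
Qed.

(** Root vector of the negative simple root; the -1 puts it in the symplectic Lie algebra
    ([nilp_J]). For i = 0 both tests describe one entry, and the first one wins. *)
Definition nilp : mat := \matrix_(u, x)
  (if (u == hi i) && (x == lo i) then 1 else
   if (u == rev_ord (lo i)) && (x == rev_ord (hi i)) then -1 else 0).

Lemma nilpE u x : nilp u x != 0 -> exceptional u x.
Proof. by rewrite mxE /exceptional; do 2?case: ifP => //; rewrite eqxx. Qed.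

Lemma nilp_hi_lo : nilp (hi i) (lo i) = 1.
Proof. by rewrite mxE !eqxx. Qed.

Lemma nilp_rev : (0 < i)%N -> nilp (rev_ord (lo i)) (rev_ord (hi i)) = -1.
Proof.
move=> i0; rewrite mxE !eqxx /= ifN //.
by apply/negP => /andP[/eqP/(congr1 (@nat_of_ord _)) + _]; rewrite Hrl Hlh; lia.
Qed.

Lemma jsign_rev_hi : jsign (rev_ord (hi i)) = 1.
Proof. by rewrite jsign_rev /jsign /is_neg Hlh ltnNge leq_addr opprK. Qed.

Lemma nilp_rev_jsign : nilp (rev_ord (lo i)) (rev_ord (hi i)) * jsign (lo i) = 1.
Proof.
case: (posnP i) => Hi0.
  have E : lo i = rev_ord (hi i) by apply: ord_inj; rewrite Hll Hrh; lia.
  by rewrite E rev_ordK -{1}E nilp_hi_lo mul1r jsign_rev_hi.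
rewrite nilp_rev // /jsign /is_neg Hll ifN ?mulrNN ?mulr1 //; lia.
Qed.

Lemma nilp0 u x : ~~ exceptional u x -> nilp u x = 0.
Proof. by apply: contraNeq => /nilpE. Qed.

Lemma nilp_J : nilp^T *m J + J *m nilp = 0.
Proof.
apply/matrixP => x y; rewrite mxE mulmxJ mulJmx [nilp^T _ _]mxE [RHS]mxE.
apply/eqP; rewrite addrC subr_eq0; apply/eqP.
have [Hex|Hex] := boolP (exceptional (rev_ord x) y); last first.
  by rewrite !nilp0 ?mulr0 ?mul0r // -exceptional_inv rev_ordK.
case/orP: Hex => /andP[/eqP Ex /eqP Ey].
  have -> : x = rev_ord (hi i) by rewrite -Ex rev_ordK.
  by rewrite Ey rev_ordK nilp_hi_lo mulr1 jsign_rev_hi nilp_rev_jsign.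
have -> : x = lo i by apply: rev_ord_inj.
by rewrite Ey rev_ordK nilp_hi_lo mul1r jsign_rev_hi mulrC nilp_rev_jsign.
Qed.

Lemma nilp_J_nilp : nilp^T *m J *m nilp = 0.
Proof.
apply/matrixP => x y; rewrite -mulmxA mxE [RHS]mxE big1 // => u _.
rewrite mulJmx mxE.
have [->|H1] := eqVneq (nilp u x) 0; first by rewrite mul0r.
have [->|H2] := eqVneq (nilp (rev_ord u) y) 0; first by rewrite !mulr0.
move: (nilpE H1) (nilpE H2); rewrite !exceptionalP val_rev; have := ltn_ord u.
by move: (ltn_ord i); lia.
Qed.

(** One-parameter subgroup of the negative simple root; [nilp_J_nilp] makes the linear expression
    symplectic without higher terms. Its cosets sweep out a fibre of the projection except for the
    point of s. *)
Definition lower t : mat := 1%:M + t *: nilp.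

Lemma lower_Sp t : Sp (lower t).
Proof.
have E : (lower t)^T = 1%:M + t *: nilp^T.
  by apply/matrixP => x y; rewrite !mxE [x == y]eq_sym.
rewrite /Sp /= E /lower.
transitivity (J + t *: (nilp^T *m J + J *m nilp) + (t * t) *: (nilp^T *m J *m nilp)).
  rewrite !mulmxDl !mulmxDr !mul1mx !mulmx1 -!scalemxAl -!scalemxAr ?scalerA scalerDr.
  by rewrite !addrA; congr (_ + _); rewrite addrAC.
by rewrite nilp_J nilp_J_nilp !scaler0 !addr0.
Qed.

Lemma lowerE t u x : lower t u x = (u == x)%:R + t * nilp u x.
Proof. by rewrite !mxE. Qed.

Lemma lower_block_upper t : block_upper (lower t).
Proof.
split; first exact: lower_Sp; move=> x y yx Ne.
rewrite lowerE nilp0 // mulr0 addr0; case: eqP => // E.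
by rewrite E ltnn in yx.
Qed.

Lemma lowerT_Borel t : Borel (lower t)^T.
Proof.
split; first exact/Sp_tr/lower_Sp; move=> x y yx.
rewrite mxE lowerE; case: eqP => [E|_]; first by rewrite E ltnn in yx.
rewrite add0r nilp0 ?mulr0 // exceptionalP; move: yx; move: (ltn_ord i); lia.
Qed.

Lemma exceptional_lo u : exceptional u (lo i) = (u == hi i).
Proof.
apply/idP/eqP => [|->]; last by rewrite /exceptional !eqxx.
rewrite exceptionalP Hll => H; apply: ord_inj; rewrite Hlh; move: H (ltn_ord i); lia.
Qed.

(** An element whose entry (hi, lo) vanishes is in the Borel subgroup; otherwise this entry serves
    as a pivot that brings the element into BsB, with s as the middle factor. *)
Lemma parabolicE s : weyl_rep (tgen i) s -> parabolic i = block_upper.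
Proof.
move=> Hs; have [Ss Ws] := Hs; apply/seteqP; split=> g.
  case=> [|[b1 [s' [b2 [B1 S' B2 ->]]]]]; first exact: Borel_block_upper.
  apply: block_upperM; last exact: Borel_block_upper.
  by apply: block_upperM; [exact: Borel_block_upper|exact: weyl_block_upper].
move=> Qg; have [Sg _] := Qg; have [E|Ne] := eqVneq (g (hi i) (lo i)) 0.
  by left; apply: block_upper_Borel.
(* The upper unipotent b clears the entry (lo, lo) of g. *)
right; pose t := g (lo i) (lo i) / g (hi i) (lo i).
pose b := (lower (- t))^T; have Bb : Borel b := lowerT_Borel (- t).
have Sb : Sp b by case: Bb.
have bE u : b (lo i) u = lower (- t) u (lo i) by rewrite mxE.
exists (invSp b), s, (invSp s *m b *m g); split=> //; first exact: Borel_inv.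
  apply: block_upper_Borel.
    apply: block_upperM => //; apply: block_upperM; last exact: Borel_block_upper.
    exact/block_upper_inv/weyl_block_upper.
  rewrite -mulmxA mxE big1 // => u _; rewrite Sp_invE.
  have [->|/Ws Eu] := eqVneq (s (rev_ord u) (rev_ord (hi i))) 0; first by rewrite mulr0 mul0r.
  have {Eu}-> : u = lo i by apply: rev_ord_inj; rewrite Eu tgen_rev tgen_hi.
  have -> : (b *m g) (lo i) (lo i) = 0; last by rewrite mulr0.
  rewrite mxE (bigD1 (lo i)) //= (bigD1 (hi i)) 1?eq_sym ?lo_neq_hi //= big1 ?addr0 => [|u' /andP[ul uh]].
    rewrite !bE !lowerE nilp_hi_lo nilp0; last by rewrite exceptional_lo lo_neq_hi.
    rewrite eqxx eq_sym (negPf (lo_neq_hi i)) mulr0 addr0 add0r mulr1 mul1r.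
    by rewrite mulNr divfK ?subrr.
  by rewrite bE lowerE nilp0 ?exceptional_lo // (negPf ul) mulr0 addr0 mul0r.
rewrite !mulmxA -[invSp b *m s *m invSp s]mulmxA Sp_invr // mulmx1 Sp_invl //.
by rewrite mul1mx.
Qed.

End Parabolic.
End Symplectic.

(** * Flags *)

Section Cosets.
Variables (F : fieldType) (n : nat).
Local Notation N := (n + n)%N.
Local Notation mat := 'M[F]_N.
Implicit Types (g h b s : mat) (i : 'I_n) (x y u : 'I_N).
Local Notation B := (@Borel F n).

Lemma lcos_Borel g b : B b -> lcos B (g *m b) = lcos B g.
Proof.
move=> Bb; have [Sb _] := Bb; apply/seteqP; split=> _ [h Bh <-].
  by exists (b *m h); rewrite ?mulmxA //; exact: BorelM.
exists (invSp b *m h); first by apply: BorelM => //; exact: Borel_inv.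
by rewrite -!mulmxA [b *m _]mulmxA Sp_invr // mul1mx.
Qed.

Lemma lcos_self g : lcos B g g.
Proof. by exists 1%:M; rewrite ?mulmx1 //; exact: Borel1. Qed.

Lemma lcos_eq g g' : lcos B g = lcos B g' -> exists2 b, B b & g' = g *m b.
Proof. by move=> E; have := lcos_self g'; rewrite -E => -[b Bb <-]; exists b. Qed.

Lemma parabolic_Borel i b h : B b -> parabolic i h -> parabolic i (b *m h).
Proof.
move=> Bb [Bh|[b1 [s [b2 [B1 Ws B2 ->]]]]]; first by left; exact: BorelM.
by right; exists (b *m b1), s, b2; split; rewrite ?mulmxA //; exact: BorelM.
Qed.

Lemma parabolic1 i : parabolic i (1%:M : mat).
Proof. by left; exact: Borel1. Qed.

Lemma proj_lcos i g : proj i (lcos B g) = lcos (@parabolic F n i) g.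
Proof.
apply/seteqP; split=> [_ [_ [b Bb <-]] [h Ph <-]|_ [h Ph <-]].
  by exists (b *m h); rewrite ?mulmxA //; exact: parabolic_Borel.
by exists g; [exact: lcos_self|exists h].
Qed.

Lemma proj_block_upper i s g e : weyl_rep (tgen i) s -> block_upper i e ->
  proj i (lcos B (g *m e)) = proj i (lcos B g).
Proof.
move=> Ws Qe; rewrite !proj_lcos (parabolicE Ws).
have [Se _] := Qe; apply/seteqP; split=> _ [h Qh <-].
  by exists (e *m h); rewrite ?mulmxA //; exact: block_upperM.
exists (invSp e *m h); first by apply: block_upperM => //; exact: block_upper_inv.
by rewrite -!mulmxA [e *m _]mulmxA Sp_invr // mul1mx.
Qed.

Lemma row_flag g j x : row x (flag_mx g j) = (x < j)%:R *: row x g^T.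
Proof.
apply/rowP => y; rewrite !mxE (bigD1 x) //= big1 ?addr0 => [|u ux].
  by rewrite mxE eqxx !mxE.
by rewrite mxE; case: eqP => [/ord_inj E|_]; [rewrite E eqxx in ux|rewrite mul0r].
Qed.

Lemma row_flag_sub g j x : (x < j)%N -> (row x g^T <= flag_mx g j)%MS.
Proof. by move=> xj; rewrite -[row x _]scale1r -[1]/(true%:R) -xj -row_flag row_sub. Qed.

Lemma flag_sub g j m (W : 'M_(m, N)) :
  (forall x, (x < j)%N -> (row x g^T <= W)%MS) -> (flag_mx g j <= W)%MS.
Proof.
move=> H; apply/row_subP => x; rewrite row_flag.
by case: (ltnP x j) => xj; rewrite ?scale0r ?sub0mx // scale1r H.
Qed.

Lemma row_mul g h x : row x (g *m h)^T = \sum_u h u x *: row u g^T.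
Proof.
apply/rowP => y; rewrite !mxE summxE; apply: eq_bigr => u _.
by rewrite !mxE mulrC.
Qed.

Lemma flag_block_sub g h j : (forall u x, (x < j)%N -> h u x != 0 -> (u < j)%N) ->
  (flag_mx (g *m h) j <= flag_mx g j)%MS.
Proof.
move=> H; apply: flag_sub => x xj; rewrite row_mul summx_sub // => u _.
have [->|/(H _ _ xj) uj] := eqVneq (h u x) 0; first by rewrite scale0r sub0mx.
by rewrite scalemx_sub // row_flag_sub.
Qed.

(** Only two members of the flag can move. As F_j is spanned by the columns of index below j, j = hi
    means that column lo is in and column hi is out; j = -lo does the same for -hi and -lo. *)
Lemma flag_block_eq i g h j : block_upper i h -> j != hi i :> nat ->
  j != rev_ord (lo i) :> nat -> (flag_mx (g *m h) j :=: flag_mx g j)%MS.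
Proof.
move=> Qh j1 j2.
have stab h' : block_upper i h' -> forall u x, (x < j)%N -> h' u x != 0 -> (u < j)%N.
  move=> Q' u x xj /(block_upperE Q'); rewrite exceptionalP.
  by move: j1 j2; rewrite val_rev val_hi val_lo; have := ltn_ord i; lia.
apply/eqmxP/andP; split; first exact/flag_block_sub/stab.
have [Sh _] := Qh; rewrite -{1}[g]mulmx1 -(Sp_invr Sh) mulmxA.
exact/flag_block_sub/stab/block_upper_inv.
Qed.

Lemma flag_Borel g b j : B b -> (flag_mx (g *m b) j :=: flag_mx g j)%MS.
Proof.
have stab h' : B h' -> forall u x, (x < j)%N -> h' u x != 0 -> (u < j)%N.
  move=> [_ U'] u x xj Ne; case: (ltnP u j) => // ju.
  by rewrite U' ?eqxx // in Ne; apply: leq_trans ju.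
move=> Bb; have [Sb _] := Bb; apply/eqmxP/andP; split; first exact/flag_block_sub/stab.
rewrite -{1}[g]mulmx1 -(Sp_invr Sb) mulmxA.
exact/flag_block_sub/stab/Borel_inv.
Qed.

Lemma flag_succ g x : (flag_mx g x.+1 :=: flag_mx g x + row x g^T)%MS.
Proof.
apply/eqmxP/andP; split.
  apply: flag_sub => u; rewrite ltnS leq_eqVlt => /orP[/eqP/ord_inj ->|ux].
    exact: addsmxSr.
  by apply: submx_trans (addsmxSl _ _); exact: row_flag_sub.
rewrite addsmx_sub row_flag_sub // andbT; apply: flag_sub => u ux.
by rewrite row_flag_sub // ltnW.
Qed.

Lemma rank_flag g j : Sp g -> (j <= N)%N -> \rank (flag_mx g j) = j.
Proof.
move=> Sg jN; rewrite /flag_mx mxrankMfree ?rank_pid_mx //.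
by rewrite row_free_unit unitmx_tr Sp_unit.
Qed.

(* The flag of g * lower t is a pencil through that of g (at t = 0), whose
   point at infinity is the flag of g * s. *)
Lemma flag_pencil i s g j : weyl_rep (tgen i) s -> (j <= N)%N ->
  exists m (W : 'M[F]_(m, N)) (v v' : 'rV[F]_N),
    [/\ (flag_mx g j :=: W + v)%MS, (flag_mx (g *m s) j :=: W + v')%MS,
      forall t, (flag_mx (g *m lower i t) j :=: W + (v + t *: v')%R)%MS &
      j != hi i :> nat -> j != rev_ord (lo i) :> nat -> v = 0 /\ v' = 0].
Proof.
move=> Ws jN; have Qs := weyl_block_upper Ws; have [Ss Us] := Ws.
have Hll := val_lo i; have Hlh := val_hi i; have Hi := ltn_ord i.
have Hrl : rev_ord (lo i) = (n - i)%N :> nat by rewrite val_rev Hll; lia.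
have Hrh : rev_ord (hi i) = (n - i.+1)%N :> nat by rewrite val_rev Hlh; lia.
case: (boolP ((j == hi i :> nat) || (j == rev_ord (lo i) :> nat))) => Hj; last first.
  move: Hj; rewrite negb_or => /andP[j1 j2].
  have add0 h : block_upper i h -> (flag_mx (g *m h) j :=: flag_mx g j + (0 : 'rV_N))%MS.
    move=> Qh; apply: eqmx_trans (flag_block_eq g Qh j1 j2) _.
    by apply/eqmx_sym; exact: addsmx0.
  exists _, (flag_mx g j), 0, 0; split=> // [||t].
  - by have := add0 _ (Borel_block_upper i (Borel1 F n)); rewrite mulmx1.
  - exact: add0.
  - by rewrite scaler0 addr0; apply/add0/lower_block_upper.
(* x is the last column of F_j, y the column that t exchanges with it, and c the entry of [nilp] at
   (y, x). *)
have [x [y [c [c0 [Ej Exy Hx1 Hx2 Hn]]]]] : exists x y c, c != 0 /\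
   [/\ j = x.+1 :> nat, tgen i x = y, x != hi i :> nat, x != rev_ord (lo i) :> nat &
     forall u, nilp F i u x = if u == y then c else 0].
  have col1 u x y : exceptional i u x -> exceptional i y x -> u = y.
    rewrite !exceptionalP => H1 H2; apply: ord_inj; move: H1 H2; lia.
  case: (eqVneq j (hi i : nat)) => [Ej|Nj].
    exists (lo i), (hi i), 1; split; first exact: oner_neq0.
    rewrite tgen_lo Ej Hlh Hll Hrl; split=> //; try lia.
    move=> u; case: eqP => [->|Ne]; first by rewrite nilp_hi_lo.
    by apply: nilp0; apply/negP => /col1 E; apply: Ne; apply: E; rewrite /exceptional !eqxx.
  have Ej : j = rev_ord (lo i) by apply/eqP; move: Hj; rewrite (negPf Nj).
  have i0 : (0 < i)%N by move: Nj; rewrite Ej Hrl Hlh; lia.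
  exists (rev_ord (hi i)), (rev_ord (lo i)), (-1); split; first by rewrite oppr_eq0 oner_neq0.
  rewrite tgen_rev tgen_hi Ej Hrl Hrh Hlh; split=> //; try lia.
  move=> u; case: eqP => [->|Ne]; first by rewrite nilp_rev.
  by apply: nilp0; apply/negP => /col1 E; apply: Ne; apply: E; rewrite /exceptional !eqxx orbT.
have Eys : row x (g *m s)^T = s y x *: row y g^T.
  rewrite row_mul (bigD1 y) //= big1 ?addr0 // => u uy.
  have [->|/Us E] := eqVneq (s u x) 0; first by rewrite scale0r.
  by rewrite E Exy eqxx in uy.
have sn0 : s y x != 0.
  apply/eqP => E; have := congr1 (fun m : mat => m x x) (Sp_invl Ss).
  rewrite mxE [RHS]mxE eqxx big1 => [/esym/eqP|u _]; first by rewrite oner_eq0.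
  have [->|/Us Eu] := eqVneq (s u x) 0; first by rewrite mulr0.
  by rewrite Eu Exy E mulr0.
exists _, (flag_mx g x), (row x g^T), (c *: row y g^T); split.
- by rewrite Ej; exact: flag_succ.
- rewrite Ej; apply: eqmx_trans (flag_succ _ _) _; rewrite Eys.
  apply: adds_eqmx; first exact: (flag_block_eq g Qs Hx1 Hx2).
  by apply: eqmx_trans (eqmx_scale _ sn0) _; apply/eqmx_sym; exact: eqmx_scale.
- move=> t; rewrite Ej; apply: eqmx_trans (flag_succ _ _) _.
  apply: adds_eqmx; first exact: (flag_block_eq g (lower_block_upper i t) Hx1 Hx2).
  suff -> : row x (g *m lower i t)^T = row x g^T + t *: (c *: row y g^T) by [].
  rewrite row_mul; under eq_bigr do rewrite lowerE Hn scalerDl.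
  rewrite big_split /=; congr (_ + _).
    rewrite (bigD1 x) //= eqxx scale1r big1 ?addr0 // => u ux.
    by rewrite (negPf ux) scale0r.
  rewrite (bigD1 y) //= eqxx big1 ?addr0 ?scalerA // => u uy.
  by rewrite (negPf uy) mulr0 scale0r.
- by move=> /negPf j1 /negPf j2; move: Hj; rewrite j1 j2.
Qed.

End Cosets.

(** * Rank conditions and orbit closures *)

Section RankConditions.
Variables (F : fieldType) (n p : nat).
Local Notation N := (n + n)%N.
Local Notation mat := 'M[F]_N.
Implicit Types (g h b s A C : mat) (i : 'I_n) (x y u : 'I_N) (c : {ffun 'I_N -> symbol}).
Local Notation Bo := (@Borel F n).
Local Notation Pp := (Pplus F n p).
Local Notation Pm := (Pminus F n p).

(** A common form for the three rank conditions: (A, C) will be ([Pminus], 0), ([Pplus], 0) or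
    ([Pplus], 1). *)
Definition flag_rank A C g (j k : nat) : nat :=
  \rank (flag_mx g j *m A + flag_mx g k *m C)%MS.

Lemma flag_rank_Borel A C g b j k : Bo b -> flag_rank A C (g *m b) j k = flag_rank A C g j k.
Proof.
move=> Bb; apply/eqmx_rank/eqmxP/adds_eqmx; apply/eqmxMr; exact: flag_Borel.
Qed.

Lemma Pplus_idem : Pp *m Pp = Pp.
Proof.
apply/matrixP => x y; rewrite !mxE (bigD1 x) //= big1 ?addr0 => [|u ux].
  by rewrite !mxE eqxx /=; case: (x == y); case: in_Vplus; rewrite ?mulr0 ?mul0r ?mulr1.
by rewrite !mxE eq_sym (negPf ux) mul0r.
Qed.

(** For complementary projections the row space of Q is the kernel of Q', so rank-nullity trades the
    dimension of an intersection for the rank of an image, which is lower semicontinuous in the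
    flag. *)
Lemma rank_cap_ker (A Q Q' : mat) : Q + Q' = 1%:M -> Q *m Q' = 0 ->
  (\rank (A :&: Q)%MS + \rank (A *m Q'))%N = \rank A.
Proof.
move=> H1 H0; rewrite addnC -(mxrank_mul_ker A Q'); congr (_ + _)%N.
apply/eqmx_rank/eqmxP/cap_eqmx => //; apply/eqmxP/andP; split; first by apply/sub_kermxP.
by rewrite -{1}[kermx Q']mulmx1 -H1 mulmxDr mulmx_ker addr0 submxMl.
Qed.

Lemma PpPm : Pp *m Pm = 0.
Proof. by rewrite /Pminus mulmxBr mulmx1 Pplus_idem subrr. Qed.

Lemma PmPp : Pm *m Pp = 0.
Proof. by rewrite /Pminus mulmxBl mul1mx Pplus_idem subrr. Qed.

Definition fits c g := [/\
    forall j, (j <= N)%N -> \rank (flag_mx g j :&: Pp)%MS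
        = (signs_within c true j + pairs_within c j)%N,
    forall j, (j <= N)%N -> \rank (flag_mx g j :&: Pm)%MS
        = (signs_within c false j + pairs_within c j)%N
    & forall i j : nat, (i < j)%N -> (j <= N)%N ->
      \rank (flag_mx g i *m Pp + flag_mx g j)%MS = (j + pairs_across c i j)%N].

Lemma fitsE c g : Sp g -> fits c g <-> [/\
    forall j, (j <= N)%N ->
      (signs_within c true j + pairs_within c j + flag_rank Pm 0 g j j = j)%N,
    forall j, (j <= N)%N ->
      (signs_within c false j + pairs_within c j + flag_rank Pp 0 g j j = j)%N
    & forall i j : nat, (i < j)%N -> (j <= N)%N ->
      flag_rank Pp 1%:M g i j = (j + pairs_across c i j)%N].
Proof.
move=> Sg.
have E0 A j : flag_rank A 0 g j j = \rank (flag_mx g j *m A).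
  by rewrite /flag_rank mulmx0; apply/eqmx_rank/eqmxP/addsmx0.
have E1 (i j : nat) : flag_rank Pp 1%:M g i j = \rank (flag_mx g i *m Pp + flag_mx g j)%MS.
  by rewrite /flag_rank mulmx1.
have K1 j : (j <= N)%N -> (\rank (flag_mx g j :&: Pp)%MS + \rank (flag_mx g j *m Pm))%N = j.
  move=> jN; rewrite rank_cap_ker ?rank_flag //; last exact: PpPm.
  by rewrite addrC subrK.
have K2 j : (j <= N)%N -> (\rank (flag_mx g j :&: Pm)%MS + \rank (flag_mx g j *m Pp))%N = j.
  by move=> jN; rewrite rank_cap_ker ?rank_flag // ?subrK // PmPp.
split=> -[H1 H2 H3]; split=> [j jN|j jN|j k jk kN].
- by rewrite E0 -H1 // K1.
- by rewrite E0 -H2 // K2.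
- by rewrite E1 H3.
- by apply/eqP; rewrite -(eqn_add2r (flag_rank Pm 0 g j j)) H1 // E0 K1.
- by apply/eqP; rewrite -(eqn_add2r (flag_rank Pp 0 g j j)) H2 // E0 K2.
- by rewrite -E1 H3.
Qed.

Lemma fits_Borel c g b : Sp g -> Bo b -> fits c (g *m b) <-> fits c g.
Proof.
move=> Sg Bb; have Sgb : Sp (g *m b) by case: Bb => ? _; exact: SpM.
rewrite !fitsE //; split=> -[H1 H2 H3]; split=> *.
- by rewrite -(flag_rank_Borel _ _ _ _ _ Bb) H1.
- by rewrite -(flag_rank_Borel _ _ _ _ _ Bb) H2.
- by rewrite -(flag_rank_Borel _ _ _ _ _ Bb) H3.
- by rewrite flag_rank_Borel // H1.
- by rewrite flag_rank_Borel // H2.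
- by rewrite flag_rank_Borel // H3.
Qed.

Lemma clan_orbitP c g : Sp g -> clan_orbit p c (lcos Bo g) <-> fits c g.
Proof.
move=> Sg; split=> [[g' [Sg' E H1 H2 H3]]|[H1 H2 H3]]; last by exists g; split.
have [b Bb Eg] := lcos_eq E; apply/(fits_Borel _ Sg Bb); rewrite -Eg.
by split.
Qed.

Lemma clan_orbit_lcos c (x : set mat) : clan_orbit p c x -> exists g, [/\ Sp g, x = lcos Bo g & fits c g].
Proof. by case=> g [Sg E H1 H2 H3]; exists g; split. Qed.

Lemma clan_orbit_quot c : clan_orbit p c `<=` quot Bo.
Proof. by move=> _ /clan_orbit_lcos[g [Sg -> _]]; exists g. Qed.

Lemma flag_rank_closed A C j k r :
  qclosed Bo [set x | exists g, [/\ Sp g, x = lcos Bo g & (flag_rank A C g j k <= r)%N]].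
Proof.
pose L (g : mat) : 'M[F]_(N + N, N) := col_mx (flag_mx g j *m A) (flag_mx g k *m C).
have HL : linear L.
  move=> a g h; rewrite /L /flag_mx !linearP /= !mulmxDl -!scalemxAl.
  by rewrite scale_col_mx add_col_mx.
pose L' : {linear mat -> 'M[F]_(N + N, N)} := HB.pack L (GRing.isLinear.Build _ _ _ _ L HL).
have EL g : \rank (L g) = flag_rank A C g j k by apply/eqmx_rank/eqmxP/eqmx_sym/addsmxE.
split=> [_ [g [Sg -> _]]|]; first by exists g.
exists [set g | (\rank (L' g) <= r)%N]; first exact: rank_le_zariski.
apply/seteqP; split=> g /= [Sg].
  case=> g' [Sg' E Hr]; split=> //; have [b Bb Eg] := lcos_eq E.
  by rewrite EL -(flag_rank_Borel _ _ _ _ _ Bb) -Eg.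
by rewrite EL => Hr; split=> //; exists g; split.
Qed.

(** The orbit lies in the closed set where this rank is at most its constant value, hence so does
    its closure. *)
Lemma closure_flag_rank c g g' A C j k : Sp g -> Sp g' ->
  qclosure Bo (clan_orbit p c) (lcos Bo g') ->
  (forall h, Sp h -> fits c h -> flag_rank A C h j k = flag_rank A C g j k) ->
  (flag_rank A C g' j k <= flag_rank A C g j k)%N.
Proof.
move=> Sg Sg' [_ Hcl] Hconst.
have [|h [Sh E Hr]] := Hcl _ (flag_rank_closed A C j k (flag_rank A C g j k)).
  by move=> _ /clan_orbit_lcos[h [Sh -> Hh]]; exists h; split=> //; rewrite Hconst.
by have [b Bb ->] := lcos_eq (esym E); rewrite flag_rank_Borel.
Qed.

(** The condition on j, k and C lets at most one of the two summands depend on t, so the space is a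
    fixed one plus a single vector moving linearly, as [rank_pencil] requires. *)
Lemma flag_rank_pencil i s g A C (j k : nat) : weyl_rep (tgen i) s -> (j <= N)%N -> (k <= N)%N ->
  (j != hi i :> nat) && (j != rev_ord (lo i) :> nat) \/
  (k != hi i :> nat) && (k != rev_ord (lo i) :> nat) \/ C = 0 ->
  (flag_rank A C (g *m s) j k <= flag_rank A C g j k)%N ->
  exists b : F, forall t : F, t != b -> flag_rank A C (g *m lower i t) j k = flag_rank A C g j k.
Proof.
move=> Ws jN kN.
have [m1 [W1 [v1 [v1' [E1 E1s E1t S1]]]]] := flag_pencil g Ws jN.
have [m2 [W2 [v2 [v2' [E2 E2s E2t S2]]]]] := flag_pencil g Ws kN.
have rk h (w1 w2 : 'rV[F]_N) :
   (flag_mx h j :=: W1 + w1)%MS -> (flag_mx h k :=: W2 + w2)%MS ->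
   flag_rank A C h j k = \rank ((W1 *m A + W2 *m C) + (w1 *m A + w2 *m C)%MS)%MS.
  move=> H1 H2; apply/eqmx_rank/eqmxP; apply: eqmx_trans.
    by apply: adds_eqmx; [exact: eqmxMr H1|exact: eqmxMr H2].
  apply: eqmx_trans; first by apply: adds_eqmx; exact: addsmxMr.
  rewrite -!addsmxA [(w1 *m A + (_ + _))%MS]addsmxA [(w1 *m A + _)%MS]addsmxC -addsmxA.
  exact: eqmx_refl.
move=> Hs; rewrite (rk _ _ _ E1 E2) (rk _ _ _ E1s E2s).
have fin (w w' : 'rV[F]_N) :
    (forall t, ((v1 + t *: v1')%R *m A + (v2 + t *: v2')%R *m C :=: (w + t *: w')%R)%MS) ->
    (v1 *m A + v2 *m C :=: w)%MS -> (v1' *m A + v2' *m C :=: w')%MS ->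
    (\rank (W1 *m A + W2 *m C + (v1' *m A + v2' *m C)) <=
       \rank (W1 *m A + W2 *m C + (v1 *m A + v2 *m C)))%N ->
    exists b : F, forall t : F, t != b ->
    flag_rank A C (g *m lower i t) j k = \rank (W1 *m A + W2 *m C + (v1 *m A + v2 *m C)).
  move=> Ht H0 H1.
  rewrite (eqmx_rank (introT eqmxP (adds_eqmx (eqmx_refl _) H0))).
  rewrite (eqmx_rank (introT eqmxP (adds_eqmx (eqmx_refl _) H1))) => /rank_pencil[b Hb].
  exists b => t /Hb <-; rewrite (rk _ _ _ (E1t t) (E2t t)).
  by apply/eqmx_rank/eqmxP/adds_eqmx.
case: Hs => [/andP[j1 j2]|[/andP[k1 k2]|C0]].
- move: fin; have [-> ->] := S1 j1 j2 => fin.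
  apply: (fin (v2 *m C) (v2' *m C)) => [t||];
    rewrite ?scaler0 ?addr0 mul0mx ?mulmxDl -?scalemxAl; exact: adds0mx.
- move: fin; have [-> ->] := S2 k1 k2 => fin.
  apply: (fin (v1 *m A) (v1' *m A)) => [t||];
    rewrite ?scaler0 ?addr0 mul0mx ?mulmxDl -?scalemxAl; exact: addsmx0.
- move: fin; rewrite C0 => fin.
  apply: (fin (v1 *m A) (v1' *m A)) => [t||];
    rewrite !mulmx0 ?mulmxDl -?scalemxAl; exact: addsmx0.
Qed.

End RankConditions.

(** * Absence of doubled edges *)

Section NotDoubled.
Variables (F : fieldType) (n p q : nat).
Local Notation N := (n + n)%N.
Local Notation mat := 'M[F]_N.
Implicit Types (g h b s A C : mat) (i : 'I_n) (x y u : 'I_N) (c : {ffun 'I_N -> symbol}).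
Local Notation Bo := (@Borel F n).
Local Notation Pp := (Pplus F n p).
Local Notation Pm := (Pminus F n p).

Hypothesis Finf : forall s : seq F, exists2 t : F, t != 0 & t \notin s.
Hypothesis Hidx : clans_index_orbits F n p q.

(* Inclusion-exclusion, as no clan matches x to its negative. *)
Lemma pairs_across_square c x : orbit_clan p q c -> (x < n)%N ->
  (pairs_across c x.+1 (rev_ord x) + pairs_across c x (rev_ord x).+1 =
   pairs_across c x (rev_ord x) + pairs_across c x.+1 (rev_ord x).+1)%N.
Proof.
move=> /orbit_clanP[_ _ [Hi _ _ Hn]] xn; rewrite /pairs_across.
set S11 := [set st | _]%SET; set S00 := [set st | _]%SET;
set S01 := [set st | _]%SET; set S10 := [set st | _]%SET.
have -> : S11 = (S01 :|: S10)%SET.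
  apply/setP => -[a b]; rewrite !inE /=.
  case M : (matched c a b) => //=.
  have Nab : ~ (a = x /\ b = rev_ord x).
    case=> Ea Eb; move: M; rewrite (matched_invol _ _ Hi) Ea Eb => /andP[_ /eqP E].
    by have := Hn x; rewrite E eqxx.
  have {}Nab : ~ (a = x :> nat /\ b = rev_ord x :> nat).
    by case=> /ord_inj Ea /ord_inj Eb; apply: Nab.
  by move: Nab; rewrite val_rev; lia.
have -> : S00 = (S01 :&: S10)%SET.
  apply/setP => -[a b]; rewrite !inE /=.
  by case M : (matched c a b) => //=; lia.
exact: cardsUI.
Qed.

Lemma Kgrp1 : Kgrp p (1%:M : mat).
Proof. by split; [exact: Sp1|rewrite mul1mx mulmx1]. Qed.

Lemma in_some_clan_orbit g : Sp g -> exists2 c, orbit_clan p q c & clan_orbit p c (lcos Bo g).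
Proof.
move=> Sg; have [_ _ H] := Hidx.
pose O := [set [set k *m h | h in lcos Bo g] | k in @Kgrp F n p].
have [|c Hc E] := H O; first by exists (lcos Bo g) => //; exists g.
exists c => //; rewrite -E; exists 1%:M; first exact: Kgrp1.
apply/seteqP; split=> [_ [h Hh <-]|h Hh]; first by rewrite mul1mx.
by exists h => //; rewrite mul1mx.
Qed.

Lemma avoid_finitely_many (T : finType) (P : T -> F -> Prop) :
  (forall k, exists b : F, forall t : F, t != b -> P k t) -> exists2 t : F, t != 0 & forall k, P k t.
Proof.
move=> /fin_all_exists[f Hf]; have [t t0 Ht] := Finf (codom f).
exists t => // k; apply: Hf; apply: contra Ht => /eqP ->; exact: codom_f.
Qed.

Lemma third_point c i s g : orbit_clan p q c -> weyl_rep (tgen i) s -> Sp g -> fits p c g ->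
  qclosure Bo (clan_orbit p c) (lcos Bo (g *m s)) ->
  exists2 t : F, t != 0 & clan_orbit p c (lcos Bo (g *m lower i t)).
Proof.
move=> Hc Ws Sg Hg Hcl.
have [Ss Us] := Ws; have Sgs : Sp (g *m s) by exact: SpM.
have Hll := val_lo i; have Hlh := val_hi i; have Hi := ltn_ord i.
have Hrl : rev_ord (lo i) = (n - i)%N :> nat by rewrite val_rev Hll; lia.
have [G1 G2 G3] := (fitsE p c Sg).1 Hg.
(* The only dimensions j < k for which both members of the flag move with t. *)
pose special (j k : nat) := (j == rev_ord (lo i) :> nat) && (k == hi i :> nat).
have cond A C (j k : nat) : (j <= N)%N -> (k <= N)%N ->
  (j < k)%N && ~~ special j k \/ (j = k /\ C = 0) ->
  (forall h, Sp h -> fits p c h -> flag_rank A C h j k = flag_rank A C g j k) ->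
  exists b : F, forall t : F, t != b -> flag_rank A C (g *m lower i t) j k = flag_rank A C g j k.
  move=> jN kN Hjk Hconst; apply: (flag_rank_pencil Ws) => //.
    case: Hjk => [/andP[jk Ns]|[_ ->]]; last by right; right.
    suff : (j != hi i :> nat) && (j != rev_ord (lo i) :> nat) ||
           (k != hi i :> nat) && (k != rev_ord (lo i) :> nat).
      by case/orP; [left|right; left].
    by move: Ns; rewrite /special Hlh Hrl; lia.
  exact: (closure_flag_rank Sg Sgs Hcl).
have C1 (j : 'I_N.+1) : exists b : F, forall t : F, t != b ->
    flag_rank Pm 0 (g *m lower i t) j j = flag_rank Pm 0 g j j.
  have jN : (j <= N)%N by rewrite -ltnS.
  apply: cond => //; first by right.
  move=> h Sh Hh; have [H1 _ _] := (fitsE p c Sh).1 Hh.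
  by apply/eqP; rewrite -(eqn_add2l (signs_within c true j + pairs_within c j)%N) H1 // G1.
have C2 (j : 'I_N.+1) : exists b : F, forall t : F, t != b ->
    flag_rank Pp 0 (g *m lower i t) j j = flag_rank Pp 0 g j j.
  have jN : (j <= N)%N by rewrite -ltnS.
  apply: cond => //; first by right.
  move=> h Sh Hh; have [_ H1 _] := (fitsE p c Sh).1 Hh.
  by apply/eqP; rewrite -(eqn_add2l (signs_within c false j + pairs_within c j)%N) H1 // G2.
have C3 (jk : 'I_N.+1 * 'I_N.+1) : exists b : F, forall t : F, t != b ->
    (jk.1 < jk.2)%N && ~~ special jk.1 jk.2 ->
    flag_rank Pp 1%:M (g *m lower i t) jk.1 jk.2 = flag_rank Pp 1%:M g jk.1 jk.2.
  case: jk => j k /=; have jN : (j <= N)%N by rewrite -ltnS.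
  have kN : (k <= N)%N by rewrite -ltnS.
  case: (boolP ((j < k)%N && ~~ special j k)) => Hjk; last by exists 0.
  have [|b Hb] := cond Pp 1%:M j k jN kN (or_introl Hjk).
    move=> h Sh Hh; have [_ _ H1] := (fitsE p c Sh).1 Hh.
    by case/andP: Hjk => jk _; rewrite H1 // G3.
  by exists b => t /Hb.
have [t t0 Ht] := @avoid_finitely_many ('I_N.+1 + 'I_N.+1 + ('I_N.+1 * 'I_N.+1))%type
  (fun k t => match k with
   | inl (inl j) => flag_rank Pm 0 (g *m lower i t) j j = flag_rank Pm 0 g j j
   | inl (inr j) => flag_rank Pp 0 (g *m lower i t) j j = flag_rank Pp 0 g j j
   | inr jk => (jk.1 < jk.2)%N && ~~ special jk.1 jk.2 ->
    flag_rank Pp 1%:M (g *m lower i t) jk.1 jk.2 = flag_rank Pp 1%:M g jk.1 jk.2 end)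
   (fun k => match k with inl (inl j) => C1 j | inl (inr j) => C2 j | inr jk => C3 jk end).
exists t => //; have St : Sp (g *m lower i t) by apply: SpM => //; exact: lower_Sp.
apply/clan_orbitP => //; apply/fitsE => //.
have T1 j : (j <= N)%N -> flag_rank Pm 0 (g *m lower i t) j j = flag_rank Pm 0 g j j.
  by rewrite -ltnS => jN; exact: (Ht (inl (inl (Ordinal jN)))).
have T2 j : (j <= N)%N -> flag_rank Pp 0 (g *m lower i t) j j = flag_rank Pp 0 g j j.
  by rewrite -ltnS => jN; exact: (Ht (inl (inr (Ordinal jN)))).
have T3 (j k : nat) : (j < k)%N -> (k <= N)%N -> ~~ special j k ->
    flag_rank Pp 1%:M (g *m lower i t) j k = flag_rank Pp 1%:M g j k.
  move=> jk kN Ns; have kN' : (k < N.+1)%N by rewrite ltnS.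
  have jN' : (j < N.+1)%N by apply: ltn_trans kN'.
  by apply: (Ht (inr (Ordinal jN', Ordinal kN'))); rewrite /= jk.
split=> [j jN|j jN|j k jk kN]; first by rewrite T1 // G1.
  by rewrite T2 // G2.
case: (boolP (special j k)) => [/andP[/eqP Ej /eqP Ek]|Ns]; last by rewrite T3 // G3.
(* The new point lies in the orbit of some clan c'. Its counts agree with those of c at three
   corners of the square at x = -hi, so [pairs_across_square] gives agreement at the special
   corner. *)
have [c' Hc' Oc'] := in_some_clan_orbit St.
have [_ _ G3'] := (fitsE p c' St).1 ((clan_orbitP p c' St).1 Oc').
have agree (a b : nat) : (a < b)%N -> (b <= N)%N -> ~~ special a b ->
    pairs_across c' a b = pairs_across c a b.
  by move=> ab bN Ns; apply/eqP; rewrite -(eqn_add2l b) -G3' // -G3 // T3.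
rewrite G3' //; congr (_ + _)%N.
pose x := rev_ord (hi i).
have xn : (x < n)%N by rewrite val_rev Hlh; lia.
have Ejx : j = x.+1 by rewrite Ej Hrl val_rev Hlh; lia.
have Ekx : k = rev_ord x by rewrite rev_ordK.
have Xv : x = (n - i.+1)%N :> nat by rewrite val_rev Hlh; lia.
have Rv : rev_ord x = (n + i)%N :> nat by rewrite rev_ordK.
have Nx : (x == rev_ord (lo i) :> nat) = false by rewrite Xv Hrl; lia.
have A1 : pairs_across c' x k.+1 = pairs_across c x k.+1.
  by apply: agree; rewrite /special ?Nx // Ek Hlh ?Xv; lia.
have A2 : pairs_across c' x k = pairs_across c x k.
  by apply: agree; rewrite /special ?Nx // Ek Hlh ?Xv; lia.
have A3 : pairs_across c' j k.+1 = pairs_across c j k.+1.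
  by apply: agree; rewrite /special ?Ek ?Ej ?Hlh ?Hrl; lia.
have := pairs_across_square Hc xn; have := pairs_across_square Hc' xn.
by rewrite -Ejx -Ekx A1 A2 A3 => <- /addIn.
Qed.

Lemma not_doubled c i : orbit_clan p q c -> ~ @doubled F n i (clan_orbit p c).
Proof.
move=> Hc [U [[HU1 [_ [S HS1 HS2]]] [y0 [Uy0 [x0 clx0 Ey0]]] Hfib]].
(* An open set that meets the image of the closure meets the image of the orbit; otherwise the
   closed complement of its preimage would contain the orbit, hence its closure. *)
have [x Ox Ux] : exists2 x, clan_orbit p c x & U (proj i x).
  apply: contrapT => Hno.
  have [Qx0 Hcl] := clx0.
  have [] : [set x | quot Bo x /\ ~ U (proj i x)] x0; last by rewrite Ey0.
  apply: Hcl => [|x Ox]; last first.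
    by split; [exact: (clan_orbit_quot Ox)|move=> Ux; apply: Hno; exists x].
  split=> [x []//|]; exists S => //; rewrite -HS2; apply/seteqP; split=> g /= [Sg].
    by case=> _ H; split=> //; split; [exists g|rewrite -proj_lcos].
  by case=> _ H; split=> //; split; [exists g|rewrite proj_lcos].
have clO (x' : set mat) : clan_orbit p c x' -> qclosure Bo (clan_orbit p c) x'.
  by move=> Ox'; split=> [|Z _]; [exact: (clan_orbit_quot Ox')|exact].
have [x1 [x2 [Nx12 E]]] := Hfib (proj i x) (conj Ux (ex_intro2 _ _ x (clO x Ox) erefl)).
have Hx : [set x1; x2] x by rewrite -E; split=> //; exact: clO.
have [x' [Nx' Ex']] : exists x' : set mat, x' <> x /\ [set x1; x2] = [set x; x'].
  case: Hx => ->; first by exists x2; split=> // E'; apply: Nx12.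
  by exists x1; split=> //; rewrite setUC.
rewrite Ex' in E.
have [clx' Px'] : (qclosure Bo (clan_orbit p c) `&` [set x0 | proj i x0 = proj i x]) x'.
  by rewrite E; right.
have [g [Sg Eg Hg]] := clan_orbit_lcos Ox.
have [g' Sg' Eg'] : exists2 g', Sp g' & x' = lcos Bo g'.
  by have [[g' Sg' <-] _] := clx'; exists g'.
have Pg' : lcos (@parabolic F n i) g g'.
  by rewrite -proj_lcos -Eg -Px' Eg' proj_lcos; exists 1%:M; [exact: parabolic1|rewrite mulmx1].
(* By the Bruhat decomposition of the parabolic, two distinct points of a fibre are g b1 B and g b1
   s B for some b1 in B. *)
case: Pg' => h [Bh|[b1 [s [b2 [B1 Ws B2 Eh]]]]] Egh.
  by apply: Nx'; rewrite Eg' Eg -Egh lcos_Borel.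
have Sb1 : Sp b1 by case: B1.
have Eg1 : x = lcos Bo (g *m b1) by rewrite lcos_Borel.
have Eg1' : x' = lcos Bo (g *m b1 *m s).
  by rewrite Eg' -Egh Eh !mulmxA lcos_Borel.
have Sg1 : Sp (g *m b1) by exact: SpM.
have Hg1 : fits p c (g *m b1) by apply/(fits_Borel p c Sg B1).
rewrite Eg1' in clx'.
have [t t0 Ht] := third_point Hc Ws Sg1 Hg1 clx'.
have : [set x; x'] (lcos Bo (g *m b1 *m lower i t)).
  rewrite -E; split; first exact: clO.
  by rewrite /= Eg1; apply: (proj_block_upper _ Ws); exact: lower_block_upper.
have inj (h1 h2 : mat) : g *m b1 *m h1 = g *m b1 *m h2 -> h1 = h2.
  move=> /(congr1 (mulmx (invSp (g *m b1)))).
  by rewrite !(mulmxA (invSp _) (g *m b1)) Sp_invl // !mul1mx.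
(* The third point differs from both: [lower i t] has the nonzero entry t at (hi, lo), unlike
   elements of B, and the entry 1 at (lo, lo), where s b vanishes. *)
case=> /esym E1.
  rewrite Eg1 in E1; have [b [_ Ub] E2] := lcos_eq E1.
  have E3 : lower i t = b by apply: inj.
  have := Ub (hi i) (lo i); rewrite -E3 lowerE nilp_hi_lo mulr1 eq_sym (negPf (lo_neq_hi i)) add0r.
  rewrite val_lo val_hi => H; case/eqP: t0; apply: H.
  by have := ltn_ord i; lia.
rewrite Eg1' in E1; have [b [_ Ub] E2] := lcos_eq E1.
have E3 : lower i t = s *m b by apply: inj; rewrite mulmxA.
have := congr1 (fun m : mat => m (lo i) (lo i)) E3.
rewrite lowerE eqxx nilp0 ?exceptional_lo ?lo_neq_hi // mulr0 addr0 mxE big1.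
  by move/eqP; rewrite oner_eq0.
move=> u _; have [_ Us] := Ws; have [->|/Us Eu] := eqVneq (s (lo i) u) 0; first by rewrite mul0r.
have -> : u = hi i by rewrite -(tgenK i u) -Eu tgen_lo.
by rewrite Ub ?mulr0 // val_lo val_hi; have := ltn_ord i; lia.
Qed.

End NotDoubled.

(** * Brion atoms *)

Local Close Scope ring_scope.

Lemma num_avoid (K : numFieldType) (s : seq K) : exists2 t : K, t != 0%R & t \notin s.
Proof.
pose b : K := (\sum_(x <- s) `|x|)%R.
have b0 : (0 <= b)%R by apply: Num.Theory.sumr_ge0 => x _; exact: Num.Theory.normr_ge0.
have t0 : (0 < 1 + b)%R by apply: Num.Theory.ltr_pwDl => //; exact: Num.Theory.ltr01.
exists (1 + b)%R; first by rewrite Num.Theory.lt0r_neq0.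
apply/negP => Hs; have : (`|1 + b| <= b)%R.
  rewrite {2}/b (big_rem _ Hs) /= Num.Theory.lerDl.
  by apply: Num.Theory.sumr_ge0 => x _; exact: Num.Theory.normr_ge0.
rewrite Num.Theory.ger0_norm; last by rewrite Order.POrderTheory.ltW.
by rewrite Num.Theory.gerDr Num.Theory.ler10.
Qed.

Section BrionAtoms.
Variables (F : fieldType) (n p q : nat).
Local Notation N := (n + n).
Implicit Types (c : {ffun 'I_N -> symbol}) (i : 'I_n) (w : 'S_N).
Local Notation good := (orbit_clan p q).
Local Notation zc c := (opp_perm (iota_clan c)).
Local Notation orb c := (@clan_orbit F n p c).
Local Notation oset := (set (set 'M[F]_N)).
Variable op : 'S_N -> 'S_N -> 'S_N.
Hypothesis Hop : is_demazure op.
Hypothesis Hidx : clans_index_orbits F n p q.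
Hypothesis Hact : clan_act_orbits F p q op.
Hypothesis Finf : forall s : seq F, exists2 t : F, t != 0%R & t \notin s.

Lemma same_clan_orbit c c' : same_clan c c' -> orb c = orb c'.
Proof.
move=> [S1 S2].
have Es s j : signs_within c s j = signs_within c' s j.
  apply: eq_card => x; rewrite !inE; congr (_ && _).
  by apply/eqP/eqP => /S1.
have Ep j : pairs_within c j = pairs_within c' j.
  by apply: eq_card => x; rewrite !inE S2.
have Ea (i j : nat) : pairs_across c i j = pairs_across c' i j.
  by apply: eq_card => x; rewrite !inE S2.
apply/seteqP; split=> x [g [H0 H1 H2 H3 H4]]; exists g; split=> // *.
- by rewrite -Es -Ep H2.
- by rewrite -Es -Ep H3.
- by rewrite -Ea H4.
- by rewrite Es Ep H2.
- by rewrite Es Ep H3.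
- by rewrite Ea H4.
Qed.

Lemma orbit_zc c c' : good c -> good c' -> orb c = orb c' -> zc c = zc c'.
Proof.
move=> Hc Hc' E; have [_ H _] := Hidx.
have /orbit_clanP[_ _ [Hi _ _ _]] := Hc; have /orbit_clanP[_ _ [Hi' _ _ _]] := Hc'.
by rewrite (same_clan_iota Hi Hi' (H _ _ Hc Hc' E)).
Qed.

Lemma step_edge c c1 i : good c -> clan_step i c c1 -> edge p i (orb c) (orb c1).
Proof.
move=> Hc Hst; split; first exact: Hact (clan_step_act Hop Hc Hst).
have [[Hc1 _ Ne] _] := clan_step_opp Hop Hc Hst.
by move=> /(orbit_zc Hc1 Hc) /eqP; rewrite (negPf Ne).
Qed.

(** Uniqueness of the dense orbit in the saturation identifies the target of the edge with the orbit
    of t_i . c. *)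
Lemma edge_step c i (O : oset) : good c -> edge p i (orb c) O ->
  exists2 c1, clan_step i c c1 & O = orb c1.
Proof.
move=> Hc [[HO dO _] Ne]; have [c1 [Ha Hst]] := clan_act_step Hop i Hc.
have [_ _ U] := Hact Hc Ha; have E := U _ HO dO.
by case: Hst => [E1|Hst]; [case: Ne; rewrite E E1|exists c1].
Qed.

Lemma path_clan c (P : orbit_path F n) : good c -> is_path p (orb c) P ->
  exists c', [/\ clan_path c (map fst P) c', good c' & path_end (orb c) P = orb c'].
Proof.
elim: P c => [|[i O] P IH] c Hc /=; first by exists c.
case=> /(edge_step Hc) [c1 Hst ->] HP.
have [[Hc1 _ _] _] := clan_step_opp Hop Hc Hst.
have [c' [H1 H2 H3]] := IH c1 Hc1 HP.
by exists c'; split=> //; exists c1.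
Qed.

Lemma clan_path_path c s c' : good c -> clan_path c s c' ->
  exists P : orbit_path F n, [/\ is_path p (orb c) P, path_end (orb c) P = orb c' & map fst P = s].
Proof.
elim: s c => [|i s IH] c Hc /=; first by move=> ->; exists [::].
move=> [c1 Hst Hp]; have [[Hc1 _ _] _] := clan_step_opp Hop Hc Hst.
have [P [H1 H2 H3]] := IH c1 Hc1 Hp.
by exists ((i, orb c1) :: P); split=> //=; [split=> //; exact: step_edge|rewrite H3].
Qed.

Lemma path_wordE (P : orbit_path F n) :
  path_word P = (\prod_(i <- map fst P) tgen i)%g.
Proof.
suff H (u : 'S_N) : foldl (fun u e => Defs.pcomp (tgen e.1) u) u P =
    (u * \prod_(i <- map fst P) tgen i)%g by rewrite /path_word H mul1g.
elim: P u => [|[i O] P IH] u /=; first by rewrite big_nil mulg1.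
by rewrite IH big_cons mulgA.
Qed.

Lemma path_not_doubled c (P : orbit_path F n) : good c -> is_path p (orb c) P ->
  path_doubled (orb c) P = 0.
Proof.
elim: P c => [|[i O] P IH] c Hc //= [/(edge_step Hc) [c1 Hst ->] HP].
have [[Hc1 _ _] _] := clan_step_opp Hop Hc Hst.
rewrite IH // addn0; case: asboolP => // Hd; case: (not_doubled Finf Hidx Hc Hd).
Qed.

Variable Od : oset.
Hypothesis Hdense : dense_orbit p Od.
Let k := maxn p q - minn p q.

(** A move out of the clan of the dense orbit would give an edge to a different orbit dense in the
    saturation; but the dense orbit is dense there too, so uniqueness makes them equal. Hence this
    clan is a sink. *)
Lemma dense_clan : exists c, [/\ good c, Od = orb c, zc c = yFPF n k,
  k <= n & ~~ odd (n - k)].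
Proof.
case: Hdense => Horb [dsub dcl]; have [_ _ H] := Hidx.
have [c Hc E] := H _ Horb; exists c.
suff [Ez [kn nk]] : zc c = yFPF n k /\ [/\ k <= n & ~~ odd (n - k)] by split.
apply: (sink_zc Hc) => i c' Hst.
have [[HO dO U] Ne] := step_edge Hc Hst; apply: Ne.
rewrite -E; apply/esym; apply: U => //; rewrite -E; split.
  by move=> x Ox; split; [exact: dsub|exists x].
by move=> x [Qx _]; apply: dcl.
Qed.

Lemma brion_atoms c w : 0 < n -> good c -> brion p Od (orb c) w <->
  atoms_k op k (zc c) w /\ NCSP k c (shFPF k (w^-1)%g).
Proof.
move=> n0 Hc; have [cd [Hcd Ed Ezd kn nk]] := dense_clan.
have Hy := yFPF_fpf kn nk.
have shape s : strict op s (yFPF n k) -> foldr (act op) (yFPF n k) s = zc c ->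
    chain_inv k (zc c) (\prod_(i <- s) tgen i)^-1%g /\
    shFPF k (\prod_(i <- s) tgen i)^-1%g = blocks k (zc c) (\prod_(i <- s) tgen i)^-1%g.
  move=> Hs Es; have Hv := strict_chain_inv kn nk Hop Hs; rewrite Es in Hv.
  by split=> //; apply: shFPF_blocks => //; exact: opp_perm_fpf Hc.
split=> [[P [HP EP EW]]|[Hw HM]].
  have [c' [Hp Hc' Ec']] := path_clan Hc HP.
  have Ez' : zc c' = yFPF n k.
    by rewrite -Ezd; apply: orbit_zc => //; rewrite -Ec' EP.
  have [Hs Es Hcomp] := clan_path_chain Hop kn nk Hc Hp Ez'.
  have [Hv Esh] := shape _ Hs Es.
  move: EW; rewrite path_wordE => <-; split.
    by rewrite -Es; exact: word_atoms.
  by rewrite Esh; exact: (blocks_NCSP kn nk Hc Hv).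
have [s Ew [Hs Es]] := atoms_word Hop Hy Hw.
have [Hv Esh] := shape _ Hs Es; rewrite Ew Esh in HM.
have Hcomp := NCSP_compat kn nk Hc Hv HM.
have [c' [Hp Hc' Ez']] := chain_clan_path Hop kn nk Hc Hs Es Hcomp.
have [P [HP EP Els]] := clan_path_path Hc Hp.
exists P; split=> //; last by rewrite path_wordE Els.
(* The path ends at a clan with the involution of the dense one; both carry only the majority sign,
   so they are the same clan. *)
rewrite EP Ed; apply: same_clan_orbit.
have /orbit_clanP[_ _ [Hi' _ _ _]] := Hc'; have /orbit_clanP[_ _ [Hid _ _ _]] := Hcd.
have Ei : iota_clan c' = iota_clan cd by apply: opp_perm_inj; rewrite Ez' Ezd.
rewrite Ei in Hi'; apply: (same_clanI Hi' Hid) => x s'.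
have Esg : is_sign (c' x) = is_sign (cd x) by rewrite (cl_sign Hi') (cl_sign Hid).
apply/eqP/eqP => E.
  have : is_sign (cd x) by rewrite -Esg E.
  case/is_signP => s2 E2; rewrite E2; congr inl.
  by rewrite (dense_signs Hcd Ezd kn nk E2) (dense_signs Hc' Ez' kn nk E).
have : is_sign (c' x) by rewrite Esg E.
case/is_signP => s2 E2; rewrite E2; congr inl.
by rewrite (dense_signs Hcd Ezd kn nk E) (dense_signs Hc' Ez' kn nk E2).
Qed.

End BrionAtoms.

Theorem theorem8p4 (R : realType) (p q : nat)
    (op : 'S_((p + q) + (p + q)) -> 'S_((p + q) + (p + q)) ->
          'S_((p + q) + (p + q)))
    (Odense : set (set 'M[R[i]]_((p + q) + (p + q))))
    (gamma : {ffun 'I_((p + q) + (p + q)) -> symbol}) :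
  0 < p + q ->
  is_demazure op ->
  @clans_index_orbits R[i] (p + q) p q ->
  @clan_act_orbits R[i] (p + q) p q op ->
  dense_orbit p Odense ->
  orbit_clan p q gamma ->
  let Og := @clan_orbit R[i] (p + q) p gamma in
  let k := maxn p q - minn p q in
  let z := opp_perm (iota_clan gamma) in
  [/\ forall w, brion p Odense Og w -> brion_d p Odense Og w 0,
      brion p Odense Og = \bigcup_(M in NCSP k gamma) atoms_kM op k z M
        /\ classical_sets.trivIset (NCSP k gamma) (atoms_kM op k z),
      brion p Odense Og `<=` atoms_k op k z
    & k <= 1 -> semi_alternating gamma ->
        brion p Odense Og = atoms_FPF op z].
Proof.
move=> n0 Hop Hidx Hact Hdense Hc Og k z.
have Finf := @num_avoid (R[i] : numFieldType).
have main w : brion p Odense Og w <-> atoms_k op k z w /\ NCSP k gamma (shFPF k (w^-1)%g).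
  exact: (brion_atoms Hop Hidx Hact Hdense).
split.
- by move=> w Hw; split=> // P [HP _ _]; exact: (path_not_doubled Hop Hidx Hact Finf Hc HP).
(* The pieces are disjoint because w determines its shape. *)
- split; last by move=> M M' _ _ [w [[_ <-] [_ <-]]].
  apply/seteqP; split=> w.
    by move=> /main [Hw HM]; exists (shFPF k (w^-1)%g).
  by move=> [M HM [Hw EM]]; apply/main; split=> //; rewrite EM.
- by move=> w /main [].
- move=> k1 Halt; have [cd [_ _ _ kn nk]] := dense_clan Hop Hidx Hact Hdense.
  (* As n - k is even, k = 0 or 1 is the parity of n. *)
  have -> : atoms_FPF op z = atoms_k op k z.
    rewrite /atoms_FPF; have : k = 0 \/ k = 1 by lia.
    by rewrite -/k in nk; case=> Ek; move: nk; rewrite Ek; case: ifP => //; lia.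
  apply/seteqP; split=> w; first by move=> /main [].
  move=> Hw; apply/main; split=> //.
  have [s Ew [Hs Es]] := atoms_word Hop (yFPF_fpf kn nk) Hw.
  have Hv := strict_chain_inv kn nk Hop Hs; rewrite Es -Ew in Hv.
  rewrite (shFPF_blocks kn nk n0 (opp_perm_fpf Hc) Hv).
  apply: (blocks_NCSP kn nk Hc Hv).
  exact: (semi_alternating_compat kn nk Hc Hv Halt).
Qed.
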